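(* For any positive integer $n$, there exist $x,y,z,w\in\mathbb{N}$ and a prime $p$ such that $n=x^2+y^2+z^2+2w^2$ and $x+2y=p$.
   Context: $\mathbb{N}=\{0,1,2,\dots\}$. *)

(* Defs.v *)
From mathcomp Require Import all_boot.

Set Implicit Arguments.
Unset Strict Implicit.
Unset Printing Implicit Defensive.

(* Main.v *)
(* Let p <> 5 be a prime with 4n <= p^2 <= 5n. If x + 2y = p and 2x - y = t,
   then 5(x^2 + y^2) = p^2 + t^2, so it suffices to write N = 5n - p^2 as
   s^2 + 5z^2 + 10w^2 and to take t = s or t = -s according to residues modulo 5;
   the bounds on p make x and y nonnegative.

   Such a p exists once n >= 3249, because there is a prime between x and
   sqrt(5/4) x for x >= 114: for large x by a Chebyshev-Sylvester argument, in
   which upper and lower bounds for psi are fed into each other until their ratio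
   drops below sqrt(5/4), and for smaller x by an explicit chain of primes.

   The form s^2 + 5z^2 + 10w^2 represents every N = 1, 4 mod 5. For N squarefree
   one builds an integral ternary form of determinant 10 representing 5N out of a
   binary form of determinant 2N in a prescribed genus; reduction theory leaves
   only forms that represent the same multiples of 5 as x^2 + 2y^2 + 5z^2. The
   genus is shown to be nonempty without Dirichlet's theorem: by linear duality
   over F_2 it is enough to find, for two real nonprincipal characters, one prime
   at which both are -1, and this follows from the hyperbola method. *)

Require Import Defs.
From Stdlib Require Import BinNat BinPos BinInt Nnat Pnat.
From Stdlib Require Rdefinitions.
From mathcomp Require Import all_boot all_order all_algebra.
From mathcomp Require Import all_fingroup cyclic all_field.
From mathcomp Require Import boolp reals exp Rstruct.
From mathcomp Require Import ssrZ zify ring lra.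
Import Order.TTheory GRing.Theory Num.Theory.
Local Open Scope ring_scope.

(** * Positive ternary forms of determinant 10 *)

(** Why 5N and not N: -2 is not a square modulo 5, so u^2 + 2v^2 + 5w^2 = 5N forces u = 5p and v =
    5q, and dividing by 5 leaves N = w^2 + 5p^2 + 10q^2.

    The genus: the construction needs q prime to N with -2N a square modulo q and -5q a square
    modulo N. Asking for a prime q would call for Dirichlet's theorem. A product of distinct primes
    l with (-2N/l) = 1 serves as well, so it is enough that the sign vectors with entries (l/p), for
    the odd p dividing N, generate the vector with entries (-5/p). By duality a failure would be an
    obstruction character on some subset of these p. Reciprocity writes (-2N/l) as this character
    times a complementary one, and a prime at which both are -1 refutes the obstruction.

    The interval: the first bounds for psi have ratio 117/100, while sqrt(5/4) is about 1.118.
    Iteration brings the ratio down to 496/445, about 1.115, but inflates the coefficient of the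
    square-root error to several hundred thousand. This is why the explicit chain of primes has to
    reach 2^60. *)

Definition ternary (a b c r s t x y z : int) : int :=
  a * x ^+ 2 + b * y ^+ 2 + c * z ^+ 2
  + 2 * (r * x * y + s * x * z + t * y * z).

(* The last clause expresses that the form modulo 5 is anisotropic modulo its
   radical. *)
Definition admissible (M a b c r s t : int) : Prop :=
  let Q := ternary a b c r s t in
  [/\ 0 < a, 0 < a * b - r ^+ 2,
      a * (b * c - t ^+ 2) - r * (r * c - s * t) + s * (r * t - s * b) = 10,
      exists x y z, Q x y z = M
    & forall x y z x' y' z', (5 %| Q x y z)%Z -> (5 %| Q x' y' z')%Z ->
        (5 %| Q (x + x') (y + y') (z + z'))%Z].

Lemma admissible_shift_x M a b c r s t k l :
  admissible M a b c r s t ->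
  admissible M a (b + 2 * k * r + k ^+ 2 * a) (c + 2 * l * s + l ^+ 2 * a)
    (r + k * a) (s + l * a) (t + k * s + l * r + k * l * a).
Proof.
case=> a0 A0 d [x [y [z e]]] cl.
have E u v w : ternary a (b + 2 * k * r + k ^+ 2 * a) (c + 2 * l * s + l ^+ 2 * a)
    (r + k * a) (s + l * a) (t + k * s + l * r + k * l * a) u v w
  = ternary a b c r s t (u + k * v + l * w) v w by rewrite /ternary; ring.
split=> //.
- by rewrite (_ : _ - _ = a * b - r ^+ 2) //; ring.
- by rewrite -d; ring.
- by exists (x - k * y - l * z), y, z; rewrite E -e; congr ternary; ring.
- move=> u v w u' v' w'; rewrite !E => h h'; have := cl _ _ _ _ _ _ h h'.
  by congr (_ %| ternary _ _ _ _ _ _ _ _ _)%Z; ring.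
Qed.

Lemma admissible_shift_y M a b c r s t k :
  admissible M a b c r s t ->
  admissible M a b (c + 2 * k * t + k ^+ 2 * b) r (s + k * r) (t + k * b).
Proof.
case=> a0 A0 d [x [y [z e]]] cl.
have E u v w : ternary a b (c + 2 * k * t + k ^+ 2 * b) r (s + k * r) (t + k * b) u v w
  = ternary a b c r s t u (v + k * w) w by rewrite /ternary; ring.
split=> //.
- by rewrite -d; ring.
- by exists x, (y - k * z), z; rewrite E -e; congr ternary; ring.
- move=> u v w u' v' w'; rewrite !E => h h'; have := cl _ _ _ _ _ _ h h'.
  by congr (_ %| ternary _ _ _ _ _ _ _ _ _)%Z; ring.
Qed.

Lemma admissible_swap_xy M a b c r s t :
  admissible M a b c r s t -> admissible M b a c r t s.
Proof.
case=> a0 A0 d [x [y [z e]]] cl.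
have E u v w : ternary b a c r t s u v w = ternary a b c r s t v u w
  by rewrite /ternary; ring.
split.
- by nia.
- by rewrite mulrC.
- by rewrite -d; ring.
- by exists y, x, z; rewrite E.
- by move=> u v w u' v' w'; rewrite !E => h h'; apply: cl.
Qed.

Lemma admissible_swap_yz M a b c r s t :
  admissible M a b c r s t -> admissible M a c b s r t.
Proof.
case=> a0 A0 d [x [y [z e]]] cl.
have E u v w : ternary a c b s r t u v w = ternary a b c r s t u w v
  by rewrite /ternary; ring.
split=> //.
(* Condensation identity for a symmetric 3 x 3 determinant, here equal to 10: the product of the two
   minors is positive. *)
- have H : (a * b - r ^+ 2) * (a * c - s ^+ 2) = 10 * a + (a * t - r * s) ^+ 2.
    by rewrite -d; ring.
  by nia.
- by rewrite -d; ring.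
- by exists x, z, y; rewrite E.
- by move=> u v w u' v' w'; rewrite !E => h h'; apply: cl.
Qed.

Lemma centered_residue (a r : int) : 0 < a -> exists k, - a < 2 * (r + k * a) <= a.
Proof.
move=> a0; exists (- ((2 * r + a - 1) %/ (2 * a))%Z).
have a2 : 2 * a != 0 by lia.
have := divz_eq (2 * r + a - 1) (2 * a).
have := modz_ge0 (2 * r + a - 1) a2.
have := ltz_mod (2 * r + a - 1) a2.
move: (_ %% _)%Z (_ %/ _)%Z => m q.
rewrite gtr0_norm; nia.
Qed.

(** Descent on a and, for fixed a, on the minor ab - r^2. A shift of y reduces at - rs modulo this
    minor; shifts of x then reduce r and s modulo a and change neither the minor nor at - rs. If the
    form is still not reduced, a swap strictly lowers a or the minor. *)
Lemma admissible_reduction M a b c r s t : admissible M a b c r s t ->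
  exists a b c r s t : int, admissible M a b c r s t /\
  [/\ - a < 2 * r <= a, - a < 2 * s <= a, a <= b, a * b - r ^+ 2 <= a * c - s ^+ 2
    & let A := a * b - r ^+ 2 in - A < 2 * (a * t - r * s) <= A].
Proof.
have [n] := ubnP `|a|%N; elim: n a b c r s t => // n IHn a b c r s t an.
have [m] := ubnP `|(a * b - r ^+ 2)%R|%N.
elim: m b c r s t => // m IHm b c r s t Am adm.
have [a0 A0 _ _ _] := adm; have A0a := a0.
have [k Hk] := centered_residue (a * b - r ^+ 2) (a * t - r * s) A0.
have {}adm := admissible_shift_y M a b c r s t k adm.
have {Hk} : - (a * b - r ^+ 2) < 2 * (a * (t + k * b) - r * (s + k * r)) <= a * b - r ^+ 2.
  suff -> : a * (t + k * b) - r * (s + k * r)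
    = a * t - r * s + k * (a * b - r ^+ 2) by []; ring.
move: (c + _ + _) (s + _) (t + _) adm => {t s}c s t adm HB.
have [k1 H1] := centered_residue a r a0; have [k2 H2] := centered_residue a s a0.
have {}adm := admissible_shift_x M a b c r s t k1 k2 adm.
have EA : a * (b + 2 * k1 * r + k1 ^+ 2 * a) - (r + k1 * a) ^+ 2 = a * b - r ^+ 2 by ring.
have {HB} : - (a * b - r ^+ 2) <
    2 * (a * (t + k1 * s + k2 * r + k1 * k2 * a) - (r + k1 * a) * (s + k2 * a))
    <= a * b - r ^+ 2.
  suff -> : a * (t + k1 * s + k2 * r + k1 * k2 * a) - (r + k1 * a) * (s + k2 * a)
    = a * t - r * s by []; ring.
rewrite -!EA in Am A0 *; move: H1 H2 adm Am A0 {EA}.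
move: (b + _ + _) (c + _ + _) (r + _) (s + _) (t + _ + _ + _).
move=> {b c r s t}b c r s t H1 H2 adm Am A0 HB.
have [ba|ab] := ltP b a.
  apply: (IHn _ _ _ _ _ _ _ (admissible_swap_xy _ _ _ _ _ _ _ adm)).
  have: 0 < b by rewrite -(pmulr_rgt0 _ A0a); have := sqr_ge0 r; lia.
  lia.
have [CA|AC] := ltP (a * c - s ^+ 2) (a * b - r ^+ 2).
  have {}adm := admissible_swap_yz _ _ _ _ _ _ _ adm.
  by apply: (IHm _ _ _ _ _ _ adm); have [_ + _ _ _] := adm; lia.
by exists a, b, c, r, s, t.
Qed.

(** Let A = ab - r^2, B = at - rs, C = ac - s^2. Condensation gives AC = 10a + B^2; with A <= C and
    2|B| <= A this becomes 3A^2 <= 40a. In the same way a <= b and 2|r| <= a give 3a^2 <= 4A.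
    Together they force a <= 2 and A <= 5, and a finite check remains. *)
Lemma admissible_reduced_forms M a b c r s t : admissible M a b c r s t ->
  [/\ - a < 2 * r <= a, - a < 2 * s <= a, a <= b, a * b - r ^+ 2 <= a * c - s ^+ 2
    & let A := a * b - r ^+ 2 in - A < 2 * (a * t - r * s) <= A] ->
  [\/ [/\ a = 1, b = 1, c = 10 & [/\ r = 0, s = 0 & t = 0]],
   [/\ a = 1, b = 2, c = 5 & [/\ r = 0, s = 0 & t = 0]],
   [/\ a = 2, b = 2, c = 3 & [/\ r = 0, s = 1 & t = 0]]
   \/ [/\ a = 2, b = 2, c = 3 & [/\ r = 0, s = 0 & t = 1]] |
   [/\ a = 2, b = 2, c = 4 & [/\ r = 1, s = 1 & t = 0 \/ t = 1]]].
Proof.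
case=> a0 A0 d _ _ [r1 s1 ab AC /= B1].
have EAC : (a * b - r ^+ 2) * (a * c - s ^+ 2) = 10 * a + (a * t - r * s) ^+ 2.
  by rewrite -d; ring.
set A := a * b - r ^+ 2 in A0 AC B1 EAC.
set B := a * t - r * s in B1 EAC.
have hA : 3 * A ^+ 2 <= 40 * a.
  have : 0 <= (A - 2 * B) * (A + 2 * B) by apply: mulr_ge0; lia.
  have -> : (A - 2 * B) * (A + 2 * B) = A ^+ 2 - 4 * B ^+ 2 by ring.
  have : A ^+ 2 <= A * (a * c - s ^+ 2) by rewrite expr2 ler_pM2l.
  lia.
have hA2 : 3 * a ^+ 2 <= 4 * A.
  have : 0 <= (a - 2 * r) * (a + 2 * r) by apply: mulr_ge0; lia.
  have -> : (a - 2 * r) * (a + 2 * r) = a ^+ 2 - 4 * r ^+ 2 by ring.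
  have : a ^+ 2 <= a * b by rewrite expr2 ler_pM2l.
  rewrite /A; lia.
have a2 : a <= 2.
  rewrite leNgt; apply/negP=> a3.
  have h1 : 9 * a <= 4 * A.
    have : 0 <= a * (a - 3) by apply: mulr_ge0; lia.
    have -> : a * (a - 3) = a ^+ 2 - 3 * a by ring.
    lia.
  have h2 : A <= 5.
    rewrite -(ler_pM2l A0) leNgt; apply/negP=> h.
    have : 7 * A <= A * A by rewrite ler_pM2r //; lia.
    rewrite -expr2; lia.
  lia.
have A5 : A <= 5.
  rewrite leNgt; apply/negP=> A6.
  have : 6 * A <= A * A by rewrite ler_pM2r //; lia.
  rewrite -expr2; lia.
have [a_1|a_2] : a = 1 \/ a = 2 by lia.
  have ? : r = 0 by lia.
  have ? : s = 0 by lia.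
  subst a r s; have {}A5 : b <= 5 by move: A5; rewrite /A; lia.
  have : b = 1 \/ b = 2 \/ b = 3 \/ b = 4 \/ b = 5 by lia.
  have : t = -2 \/ t = -1 \/ t = 0 \/ t = 1 \/ t = 2 by move: B1; rewrite /A /B; lia.
  rewrite /A /B in hA AC B1 * => {EAC hA2 A0 A B}.
  by move=> [|[|[|[]]]] ? [|[|[|[]]]] ?; subst b t;
     (exfalso; lia) || (constructor 1; do ?split; lia) || (constructor 2; do ?split; lia).
have : r = 0 \/ r = 1 by lia.
have : s = 0 \/ s = 1 by lia.
subst a => hs hr.
have hb : b = 2 \/ b = 3.
  by move: A5 hA2 ab; rewrite /A; case: hr => ->; lia.
have ht : t = -2 \/ t = -1 \/ t = 0 \/ t = 1 \/ t = 2.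
  by move: A5 B1; rewrite /A /B; case: hs => ->; case: hr => ->; lia.
rewrite /A /B in hA AC B1 * => {EAC hA2 A0 A5 A B}.
by case: hr => ?; case: hs => ?; case: hb => ?;
   case: ht => [|[|[|[]]]] ?; subst b r s t;
   (exfalso; lia) || (constructor 3; (left + right); do ?split; lia)
   || (constructor 4; do ?split; lia).
Qed.

Lemma even_form_represented (x y z : int) : exists u v w,
  2 * (x ^+ 2 + y ^+ 2 + 2 * z ^+ 2 + x * y + x * z + y * z)
  = u ^+ 2 + 2 * v ^+ 2 + 5 * w ^+ 2.
Proof.
(* Two of the three coordinates have the same parity. *)
have [[u ->]|[[u ->]|[u ->]]] : (exists u, x = y + 2 * u) \/
    (exists u, x = z + 2 * u) \/ (exists u, y = z + 2 * u).
- have [e|] := eqVneq ((x - y) %% 2)%Z 0.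
    by left; exists ((x - y) %/ 2)%Z; lia.
  have [e|] := eqVneq ((x - z) %% 2)%Z 0.
    by right; left; exists ((x - z) %/ 2)%Z; lia.
  by move=> h1 h2; right; right; exists ((y - z) %/ 2)%Z; lia.
- by exists (u + y + 2 * z), u, (u + y); ring.
- by exists (z - u), (y + z + u), (z + u); ring.
- by exists (z - u), (x + z + u), (z + u); ring.
Qed.

(** As -1 is a square modulo 5, the forms that begin with x^2 + y^2 or 2(x^2 + y^2) violate the last
    clause of [admissible]: two vectors such as (1, 2, 0) and (1, -2, 0) have values divisible by 5,
    but their sum does not. The even forms cannot be excluded, but their values are also values of
    x^2 + 2y^2 + 5z^2. *)
Lemma admissible_represented M a b c r s t : admissible M a b c r s t ->
  exists u v w : int, M = u ^+ 2 + 2 * v ^+ 2 + 5 * w ^+ 2.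
Proof.
case/admissible_reduction=> {a b c r s t} [a [b [c [r [s [t [adm red]]]]]]].
have fin := admissible_reduced_forms _ _ _ _ _ _ _ adm red.
have {red} [_ _ _ [x [y [z <-]]] cl] := adm.
case: fin => [[? ? ? [? ? ?]]|[? ? ? [? ? ?]]|[[? ? ? [? ? ?]]|[? ? ? [? ? ?]]]|[? ? ? [? ? ht]]];
  subst a b c r s.
- by subst t; have := cl 1 2 0 1 (-2) 0 isT isT.
- by subst t; exists x, y, z; rewrite /ternary; ring.
- by subst t; have := cl 1 2 0 1 (-2) 0 isT isT.
- by subst t; have := cl 2 1 0 (-2) 1 0 isT isT.
- case: ht => ?; subst t.
    have [u [v [w E]]] := even_form_represented (x + z) y (- z).
    by exists u, v, w; rewrite -E /ternary; ring.
  have [u [v [w E]]] := even_form_represented x y z.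
  by exists u, v, w; rewrite -E /ternary; ring.
Qed.

(** Modulo 5 the equation reads u^2 = -2v^2 with -2 a nonresidue, hence 5 divides u and v. *)
Lemma represented_div5 (N : nat) (u v w : int) :
  5 * N%:Z = u ^+ 2 + 2 * v ^+ 2 + 5 * w ^+ 2 ->
  exists s z w : nat, N = (s ^ 2 + 5 * z ^ 2 + 10 * w ^ 2)%N.
Proof.
move=> E; pose p := (u %/ 5)%Z; pose q := (v %/ 5)%Z.
have [eu ev] : u = 5 * p /\ v = 5 * q.
  have : ((u %% 5)%Z ^+ 2 + 2 * (v %% 5)%Z ^+ 2) =
     5 * (N%:Z - w ^+ 2 - 5 * p ^+ 2 - 2 * p * (u %% 5)%Z - 10 * q ^+ 2 - 4 * q * (v %% 5)%Z).
    have eu : (u %% 5)%Z = u - 5 * p by rewrite /p; lia.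
    have ev : (v %% 5)%Z = v - 5 * q by rewrite /q; lia.
    rewrite eu ev.
    suff -> : (u - 5 * p) ^+ 2 + 2 * (v - 5 * q) ^+ 2 =
      5 * N%:Z - 5 * w ^+ 2 + (u - 5 * p) ^+ 2 + 2 * (v - 5 * q) ^+ 2 - (u ^+ 2 + 2 * v ^+ 2).
      by ring.
    by rewrite E; ring.
  move: (_ - _ - 4 * q * _) => k.
  have : (u %% 5)%Z = 0 \/ (u %% 5)%Z = 1 \/ (u %% 5)%Z = 2 \/
      (u %% 5)%Z = 3 \/ (u %% 5)%Z = 4 by lia.
  have : (v %% 5)%Z = 0 \/ (v %% 5)%Z = 1 \/ (v %% 5)%Z = 2 \/
      (v %% 5)%Z = 3 \/ (v %% 5)%Z = 4 by lia.
  by move=> [|[|[|[]]]] ev [|[|[|[]]]] eu; rewrite ev eu /p /q; lia.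
exists `|w|%N, `|p|%N, `|q|%N.
by rewrite -!abszX; move: E; rewrite eu ev; lia.
Qed.

Lemma residue5 (x : int) : exists k r, x = 5 * k + r /\
  (r = 0 \/ r = 1 \/ r = 2 \/ r = 3 \/ r = 4).
Proof. by exists (x %/ 5)%Z, (x %% 5)%Z; lia. Qed.

(** N is a nonzero square modulo 5, so -2N is a nonresidue. *)
Lemma anisotropic5 (N x y : int) : (N %% 5)%Z = 1 \/ (N %% 5)%Z = 4 ->
  (5 %| x ^+ 2 + 2 * N * y ^+ 2)%Z -> (5 %| x)%Z /\ (5 %| y)%Z.
Proof.
have [k [r [-> hr]]] := residue5 x; have [l [s [-> hs]]] := residue5 y.
have [j [t [-> ht]]] := residue5 N => hN /dvdzP[m].
have -> : (5 * k + r) ^+ 2 + 2 * (5 * j + t) * (5 * l + s) ^+ 2 =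
  5 * (5 * k ^+ 2 + 2 * k * r + 2 * j * (5 * l + s) ^+ 2
       + 2 * t * (5 * l ^+ 2 + 2 * l * s)) + (r ^+ 2 + 2 * t * s ^+ 2) by ring.
move: (5 * k ^+ 2 + _ + _ + _) => i.
have {hN ht} : t = 1 \/ t = 4 by lia.
case: hr => [|[|[|[]]]] ->; case: hs => [|[|[|[]]]] ->; case=> ->; lia.
Qed.

(** The binary form B(x, y) = q x^2 + 2h xy + c' y^2 has determinant 2N, and the condition on a
    makes -B congruent to 5(ax + by)^2 modulo N for a suitable b. So (5(Nz + ax + by)^2 + B(x, y)) /
    N is an integral ternary form; its determinant is 5 N^2 2N / N^3 = 10 and its value at (0, 0, 1)
    is 5N. If 5 divides one of its values, then 5 divides B(x, y), which is anisotropic modulo 5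
    because q B(x, y) = (qx + hy)^2 + 2N y^2. *)
Lemma represented_of_genus (N q h a : nat) :
  (N %% 5 = 1)%N \/ (N %% 5 = 4)%N -> (0 < q)%N -> coprime q N ->
  (q %| h ^ 2 + 2 * N)%N -> (N %| 5 * a ^ 2 + q)%N ->
  exists s z w : nat, N = (s ^ 2 + 5 * z ^ 2 + 10 * w ^ 2)%N.
Proof.
move=> N5 q0 qN /dvdnP[c' Ec'] /dvdnP[k' Ek'].
pose n := N%:Z; pose p := q%:Z; pose H := h%:Z; pose u := a%:Z.
pose c := c'%:Z; pose k := k'%:Z.
have n0 : 0 < n by rewrite /n; lia.
have p0 : 0 < p by rewrite /p; lia.
have Ec : H ^+ 2 + 2 * n = c * p by rewrite /H /n /c /p; lia.
have Ek : 5 * u ^+ 2 + p = k * n by rewrite /u /n /k /p; lia.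
have [al [be B1]] : exists al be, al * p + be * n = 1.
  by have /coprimezP[[al be] /= e] : coprimez p n by []; exists al, be.
have Ep : p = k * n - 5 * u ^+ 2 by lia.
(* [al] inverts p modulo n, so b is Hu/p: the value that completes the square in the binary form, as
   5u^2 = -p modulo n. *)
pose b := H * u * al.
have [f Ef] : exists f, 5 * u * b + H = f * n.
  exists (H * (k * al + be)).
  have EH : H = H * (al * (k * n - 5 * u ^+ 2) + be * n) by rewrite -Ep B1 mulr1.
  by rewrite /b [X in _ + X]EH; ring.
have [g Eg] : exists g, 5 * b ^+ 2 + c = g * n.
  have : (n %| p * (5 * b ^+ 2 + c))%Z.
    apply/dvdzP; exists (5 * b ^+ 2 * k + (H - 5 * u * b) * f + 2).
    have -> : p * (5 * b ^+ 2 + c) = 5 * b ^+ 2 * p + c * p by ring.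
    rewrite -Ec Ep.
    have -> : 5 * b ^+ 2 * (k * n - 5 * u ^+ 2) + (H ^+ 2 + 2 * n)
      = 5 * b ^+ 2 * k * n + (H - 5 * u * b) * (5 * u * b + H) + 2 * n by ring.
    by rewrite Ef; ring.
  by rewrite Gauss_dvdzr; [case/dvdzP=> g; exists g | rewrite coprimez_sym].
have nQ x y z : n * ternary k g (5 * n) f (5 * u) (5 * b) x y z =
    5 * (n * z + u * x + b * y) ^+ 2 + (p * x ^+ 2 + 2 * H * x * y + c * y ^+ 2).
  rewrite /ternary (_ : n * _ = (k * n) * x ^+ 2 + (g * n) * y ^+ 2 + 5 * n ^+ 2 * z ^+ 2
    + 2 * ((f * n) * x * y + 5 * u * n * x * z + 5 * b * n * y * z)); last by ring.
  by rewrite -Ek -Ef -Eg; ring.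
have pg x y : p * (p * x ^+ 2 + 2 * H * x * y + c * y ^+ 2)
    = (p * x + H * y) ^+ 2 + 2 * n * y ^+ 2.
  have -> : p * (p * x ^+ 2 + 2 * H * x * y + c * y ^+ 2)
    = p ^+ 2 * x ^+ 2 + 2 * p * H * x * y + (c * p) * y ^+ 2 by ring.
  by rewrite -Ec; ring.
have n5 : (n %% 5)%Z = 1 \/ (n %% 5)%Z = 4 by rewrite /n; lia.
have Q5 x y z : (5 %| ternary k g (5 * n) f (5 * u) (5 * b) x y z)%Z ->
    (5 %| x)%Z /\ (5 %| y)%Z.
  move=> h5.
  have : (5 %| (p * x + H * y) ^+ 2 + 2 * n * y ^+ 2)%Z.
    have : (5 %| p * (n * ternary k g (5 * n) f (5 * u) (5 * b) x y z))%Z.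
      by rewrite !dvdz_mull.
    rewrite nQ mulrDr pg rpredDl //.
    by rewrite mulrCA dvdz_mulr.
  case/(anisotropic5 _ _ _ n5) => h1 h2; split=> //.
  have : (5 %| p * x)%Z by move: h1; rewrite rpredDr // dvdz_mull.
  rewrite Gauss_dvdzr //.
  have p5 : ~~ (5 %| p)%Z.
    apply/negP=> hp; have : (5 %| H ^+ 2 + 2 * n * 1 ^+ 2)%Z.
      by rewrite expr1n mulr1 Ec dvdz_mull.
    by case/(anisotropic5 _ _ _ n5).
  by rewrite coprimezE prime_coprime.
have A0 : 0 < k * g - f ^+ 2.
  have E : p * (n ^+ 2 * (k * g - f ^+ 2)) =
      5 * ((p * b - H * u) ^+ 2 + 2 * n * u ^+ 2) + 2 * n * p.
    have -> : n ^+ 2 * (k * g - f ^+ 2) = (k * n) * (g * n) - (f * n) ^+ 2 by ring.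
    rewrite -Ek -Ef -Eg.
    have -> : p * ((5 * u ^+ 2 + p) * (5 * b ^+ 2 + c) - (5 * u * b + H) ^+ 2) =
      5 * (u ^+ 2 * (c * p) + (p * b) ^+ 2 - 2 * u * b * H * p) + (c * p - H ^+ 2) * p by ring.
    by rewrite -Ec; ring.
  rewrite -(pmulr_rgt0 _ (exprn_gt0 2 n0)) -(pmulr_rgt0 _ p0) E.
  have h1 : 0 <= (p * b - H * u) ^+ 2 by apply: sqr_ge0.
  have h2 : 0 <= n * u ^+ 2 by rewrite mulr_ge0 ?sqr_ge0 ?ltW.
  have h3 : 0 < n * p by rewrite mulr_gt0.
  by move: h1 h2 h3; clear; lia.
have k0 : 0 < k by rewrite -(pmulr_lgt0 _ n0) -Ek ltr_wpDl ?mulr_ge0 ?sqr_ge0.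
suff adm : admissible (5 * n) k g (5 * n) f (5 * u) (5 * b).
  have [x [y [z E]]] := admissible_represented _ _ _ _ _ _ _ adm.
  exact: (represented_div5 N x y z).
split=> //.
- have N0 : n ^+ 2 != 0 by rewrite sqrf_eq0 gt_eqF.
  apply: (mulfI N0).
  have -> : n ^+ 2 * (k * (g * (5 * n) - (5 * b) ^+ 2) - f * (f * (5 * n) - 5 * u * (5 * b))
      + 5 * u * (f * (5 * b) - 5 * u * g)) =
    5 * n * ((k * n) * (g * n) - (f * n) ^+ 2) - 25 * n * (b ^+ 2 * (k * n)
      - 2 * u * b * (f * n) + u ^+ 2 * (g * n)) by ring.
  rewrite -Ek -Ef -Eg.
  have -> : 5 * n * ((5 * u ^+ 2 + p) * (5 * b ^+ 2 + c) - (5 * u * b + H) ^+ 2)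
     - 25 * n * (b ^+ 2 * (5 * u ^+ 2 + p) - 2 * u * b * (5 * u * b + H) + u ^+ 2 * (5 * b ^+ 2 + c))
     = 5 * n * (c * p - H ^+ 2) by ring.
  by rewrite -Ec; ring.
- by exists 0, 0, 1; rewrite /ternary; ring.
move=> x y z x' y' z' /Q5[hx hy] /Q5[hx' hy'].
have : (5 %| n * ternary k g (5 * n) f (5 * u) (5 * b) (x + x') (y + y') (z + z'))%Z.
  rewrite nQ rpredD ?dvdz_mulr //.
  have [hx2 hy2] : (5 %| x + x')%Z /\ (5 %| y + y')%Z by rewrite !rpredD.
  by rewrite !rpredD // ?expr2 ?dvdz_mull // ?mulrA dvdz_mull.
rewrite Gauss_dvdzr // coprimezE prime_coprime //.
by apply/negP=> h5; move: n5 h5; clear; lia.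
Qed.

(** * Quadratic symbols and reciprocity *)

Lemma finField_prim_root (F : finFieldType) : exists z : F, #|F|.-1.-primitive_root z.
Proof.
have F1 := finNzRing_gt1 F.
have F0 : (0 < #|F|.-1)%N by case: #|F| F1 => [|[]].
have : has #|F|.-1.-primitive_root (enum (predC1 (0 : F))).
  apply: has_prim_root => //.
  - apply/allP=> x; rewrite mem_enum inE /= => x0; rewrite unity_rootE -subr_eq0.
    have := expf_card x; rewrite -(ltn_predK F1) exprS => /eqP.
    by rewrite -subr_eq0 -[X in _ - X]mulr1 -mulrBr mulf_eq0 (negPf x0).
  - exact: enum_uniq.
  - by rewrite -cardE cardC1.
by case/hasP=> z _ zP; exists z.
Qed.

Lemma intr_eq0_pchar (F : fieldType) (l : nat) (k : int) : l \in [pchar F] ->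
  (k%:~R == 0 :> F) = (l %| k)%Z.
Proof.
move=> lF; case: k => n; first by rewrite -(dvdn_pcharf lF).
by rewrite NegzE mulrNz oppr_eq0 dvdzE abszN -(dvdn_pcharf lF).
Qed.

Lemma eqr_int_pchar (F : fieldType) (l : nat) (k j : int) : l \in [pchar F] ->
  (k%:~R == j%:~R :> F) = (l %| k - j)%Z.
Proof. by move=> lF; rewrite -(intr_eq0_pchar F) // rmorphB subr_eq0. Qed.

Definition is_sign (k : int) := (k == 0) || (k == 1) || (k == -1).

Lemma is_signM k j : is_sign k -> is_sign j -> is_sign (k * j).
Proof. by rewrite /is_sign => /orP[/orP[]|] /eqP-> /orP[/orP[]|] /eqP->. Qed.

(** Two signs differ by at most 2, so an equality in characteristic l > 2 lifts to the integers.
    Symbols are computed in finite fields and compared in this way. *)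
Lemma sign_inj (F : fieldType) l k j : l \in [pchar F] -> (2 < l)%N ->
  is_sign k -> is_sign j -> k%:~R = j%:~R :> F -> k = j.
Proof.
move=> lF l2 sk sj /eqP; rewrite (eqr_int_pchar F l) //.
move: sk sj; rewrite /is_sign => /orP[/orP[]|] /eqP-> /orP[/orP[]|] /eqP-> //;
  by rewrite dvdzE /= => /dvdn_leq H; have := H isT; lia.
Qed.

Definition qsym (p : nat) (x : 'F_p) : int :=
  if x == 0 then 0 else if x ^+ p.-1./2 == 1 then 1 else -1.

Definition legendre (p : nat) (a : int) : int := qsym p a%:~R.

Lemma qsym_is_sign p x : is_sign (qsym p x).
Proof. by rewrite /qsym; do 2?case: ifP. Qed.

Section OddPrime.
Variable p : nat.
Hypotheses (pr : prime p) (p2 : (2 < p)%N).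

Let podd : odd p. Proof. by case: (even_prime pr) p2 => [->|]. Qed.
Let pch : p \in [pchar 'F_p]. Proof. exact: pchar_Fp. Qed.
Let half2 : p.-1 = (p.-1./2 * 2)%N.
Proof. by have := podd; lia. Qed.

Lemma qsymE (x : 'F_p) : (qsym p x)%:~R = x ^+ p.-1./2.
Proof.
rewrite /qsym; case: eqVneq => [->|x0].
  by rewrite expr0n; case: eqP => // h; exfalso; lia.
case: eqVneq => [->//|x1].
have : (x ^+ p.-1./2) ^+ 2 = 1.
  rewrite -exprM -half2; apply: (mulfI x0); rewrite -exprS mulr1 prednK ?prime_gt0 //.
  by have := expf_card x; rewrite card_Fp.
by move/eqP; rewrite sqrf_eq1 (negPf x1) => /eqP ->.
Qed.

Lemma qsymM x y : qsym p (x * y) = qsym p x * qsym p y.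
Proof.
apply: (sign_inj _ _ _ _ pch p2); rewrite ?is_signM ?qsym_is_sign //.
by rewrite rmorphM /= !qsymE exprMn.
Qed.

Lemma qsym_square x : qsym p x = 1 -> exists y, x = y ^+ 2.
Proof.
move=> q1; have x1 : x ^+ p.-1./2 = 1 by rewrite -qsymE q1.
have [z zP] := finField_prim_root 'F_p; rewrite card_Fp // in zP.
have [i xi] : {i : 'I_p.-1 | x = z ^+ i}.
  by apply: (prim_rootP zP); rewrite half2 exprM x1 expr1n.
move/eqP: x1; rewrite xi -exprM -(prim_order_dvd zP) {1}half2 mulnC.
rewrite dvdn_pmul2r ?dvdn2; last by lia.
move=> i2; exists (z ^+ i./2); rewrite -exprM; congr (_ ^+ _); lia.
Qed.

Lemma legendre_is_sign a : is_sign (legendre p a).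
Proof. exact: qsym_is_sign. Qed.

Lemma legendreM a b : legendre p (a * b) = legendre p a * legendre p b.
Proof. by rewrite /legendre rmorphM qsymM. Qed.

Lemma legendre1 : legendre p 1 = 1.
Proof. by rewrite /legendre /qsym rmorph1 oner_eq0 expr1n eqxx. Qed.

Lemma legendre_mod a b : (p %| a - b)%Z -> legendre p a = legendre p b.
Proof. by rewrite -(eqr_int_pchar 'F_p) // => /eqP; rewrite /legendre => ->. Qed.

Lemma legendre_eq0 a : (legendre p a == 0) = (p %| a)%Z.
Proof.
rewrite -(intr_eq0_pchar 'F_p) // /legendre /qsym.
by case: (a%:~R == 0 :> 'F_p) => //; case: ifP.
Qed.

Lemma legendreE a : (legendre p a)%:~R = a%:~R ^+ p.-1./2 :> 'F_p.
Proof. exact: qsymE. Qed.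

Lemma Fp_nat (y : 'F_p) : exists n : nat, y = n%:R.
Proof. by exists y; rewrite natr_Zp. Qed.

Lemma legendre_sqr_ex a : legendre p a = 1 -> exists n : nat, (p %| n%:Z ^+ 2 - a)%Z.
Proof.
move/qsym_square=> [y]; have [n ->] := Fp_nat y => E; exists n.
by rewrite -(eqr_int_pchar 'F_p) // E rmorphXn.
Qed.

Lemma legendre_nonresidue : exists n : nat, legendre p n = -1.
Proof.
have [z zP] := finField_prim_root 'F_p; rewrite card_Fp // in zP.
have [n En] := Fp_nat z; exists n; rewrite /legendre /qsym -[_%:~R]/(n%:R) -En.
rewrite (prim_root_eq0 zP) (_ : (p.-1 == 0)%N = false); last by lia.
suff /negPf-> : z ^+ p.-1./2 != 1 by [].
rewrite -(prim_order_dvd zP); apply/negP=> /dvdn_leq H; lia.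
Qed.

Lemma legendreN1 : legendre p (-1) = (-1) ^+ p.-1./2.
Proof.
apply: (sign_inj _ _ _ _ pch p2); first exact: legendre_is_sign.
  by rewrite -signr_odd; case: odd.
by rewrite legendreE !rmorphXn /= rmorphN1.
Qed.

End OddPrime.

(** * Gauss sums and the reciprocity law *)

Section GaussSum.
Variables (p l : nat) (F : fieldType) (z : F).
Hypotheses (pr : prime p) (p2 : (2 < p)%N) (zP : p.-primitive_root z).
Hypotheses (lF : l \in [pchar F]) (l2 : (2 < l)%N) (lp : l != p).

Let e (x : 'F_p) : F := z ^+ x.
Let X (x : 'F_p) : F := (qsym p x)%:~R.
Definition gauss_sum : F := \sum_(x : 'F_p) (qsym p x)%:~R * z ^+ x.

Let lpr : prime l. Proof. by case/andP: lF. Qed.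
Let lodd : odd l. Proof. by case: (even_prime lpr) l2 => [->|]. Qed.

Let eD x y : e (x + y) = e x * e y.
Proof.
rewrite /e -exprD -[in LHS](natr_Zp x) -[in LHS](natr_Zp y) -natrD val_Fp_nat //.
by rewrite (prim_expr_mod zP).
Qed.

Let e_nat n : e n%:R = z ^+ n.
Proof. by rewrite /e val_Fp_nat // (prim_expr_mod zP). Qed.

Let e_neq1 x : x != 0 -> e x != 1.
Proof.
rewrite /e -(prim_order_dvd zP); apply: contra => px.
by rewrite -(natr_Zp x) -(dvdn_pcharf (pchar_Fp pr)).
Qed.

Let e_sum c : \sum_x e (x * c) = if c == 0 then p%:R else 0.
Proof.
case: eqVneq => [->|c0].
  rewrite (eq_bigr (fun=> 1)) => [|x _]; last by rewrite mulr0 /e expr0.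
  by rewrite sumr_const card_Fp.
have E : \sum_x e (x * c) = e c * \sum_x e (x * c).
  rewrite {1}(reindex_inj (addrI 1)) big_distrr /=; apply: eq_bigr => x _.
  by rewrite mulrDl mul1r eD.
apply/eqP; move/eqP: E; rewrite -subr_eq0 -{1}[\sum_x _]mul1r -mulrBl mulf_eq0.
by rewrite subr_eq0 eq_sym (negPf (e_neq1 _ c0)).
Qed.

Let XM x y : X (x * y) = X x * X y.
Proof. by rewrite /X qsymM // rmorphM. Qed.

Let qsym_sqr (x : 'F_p) : x != 0 -> qsym p x * qsym p x = 1.
Proof. by rewrite /qsym => /negPf->; case: ifP. Qed.

Let X_sqr x : X x * X x = (x != 0)%:R.
Proof.
rewrite /X -rmorphM; case: eqVneq => [->|x0]; last by rewrite qsym_sqr.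
by rewrite /qsym eqxx.
Qed.

Let X_sum : \sum_x X x = 0.
Proof.
suff E : \sum_x qsym p x = 0 by rewrite /X -rmorph_sum E.
have [n En] := legendre_nonresidue p pr p2.
have n0 : n%:R != 0 :> 'F_p.
  by apply/eqP=> h; move: En; rewrite /legendre -[_%:~R]/(n%:R) h /qsym eqxx.
have : \sum_x qsym p x = - \sum_x qsym p x; last by lia.
rewrite {1}(reindex_inj (mulfI n0)) -mulN1r big_distrr /=; apply: eq_bigr => x _.
by rewrite qsymM // -En.
Qed.

Lemma gauss_sum_sqr : gauss_sum ^+ 2 = (legendre p (-1) * p%:Z)%:~R.
Proof.
(* Substitute y = xc: the symbols of x cancel and the sum over x becomes a complete exponential sum
   without its term at x = 0, which is nontrivial only for c = -1. *)
have E x : X x * e x * (\sum_y X y * e y) =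
    \sum_c X x * X x * (X c * e (x * (1 + c))).
  rewrite big_distrr /=; have [->|x0] := eqVneq x 0.
    have X0 : X 0 = 0 by rewrite /X /qsym eqxx.
    by rewrite X0 !big1 // => ? _; rewrite !mul0r.
  rewrite (reindex_inj (mulfI x0)) /=; apply: eq_bigr => c _.
  by rewrite XM mulrDr mulr1 eD; ring.
rewrite /gauss_sum expr2 big_distrl /= (eq_bigr _ (fun x _ => E x)) exchange_big /=.
have E2 c : \sum_x X x * X x * (X c * e (x * (1 + c)))
    = X c * (if 1 + c == 0 then p%:R else 0) - X c.
  rewrite -e_sum (bigD1 0) //= [X in _ = _ * X - _](bigD1 0) //= X_sqr eqxx mul0r add0r.
  rewrite mul0r /e expr0 mulrDr mulr1 addrAC subrr add0r big_distrr /=.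
  by apply: eq_bigr => x x0; rewrite X_sqr x0 mul1r.
rewrite (eq_bigr _ (fun x _ => E2 x)) sumrB X_sum subr0.
rewrite (bigD1 (-1)) //= subrr eqxx big1 ?addr0 => [|c c1].
  by rewrite rmorphM /= /legendre rmorphN1.
by rewrite addrC addr_eq0 (negPf c1) mulr0.
Qed.

(** Frobenius fixes the signs, as l is odd, and sends z to z^l; replacing x by lx extracts the
    symbol of l. *)
Lemma gauss_sum_Frobenius : gauss_sum ^+ l = (legendre p l)%:~R * gauss_sum.
Proof.
rewrite -(pFrobenius_autE lF) /gauss_sum rmorph_sum big_distrr /=.
have l0 : l%:R != 0 :> 'F_p.
  rewrite -(dvdn_pcharf (pchar_Fp pr)); apply: contra lp => h.
  by move: h; rewrite dvdn_prime2 // eq_sym.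
rewrite [RHS](reindex_inj (mulfI l0)) /=; apply: eq_bigr => x _.
rewrite pFrobenius_autE exprMn -/(X x) -/(X (l%:R * x)) -/(e (l%:R * x)) XM mulrA mulrA.
rewrite -[(legendre _ _)%:~R]/(X l%:R) X_sqr l0 mul1r.
congr (_ * _); last first.
  by rewrite -[in RHS](natr_Zp x) -natrM e_nat -exprM mulnC.
have : is_sign (qsym p x) by apply: qsym_is_sign.
rewrite /X; case/orP => [/orP[]|] /eqP->; rewrite ?expr1n //.
  by rewrite expr0n; case: (l) l2.
by rewrite rmorphN1 -signr_odd lodd.
Qed.

Lemma gauss_sum_legendre : (l %| (legendre p (-1) * p%:Z) ^+ l.-1./2 - legendre p l)%Z.
Proof.
rewrite -(eqr_int_pchar F) // rmorphXn /= -gauss_sum_sqr -exprM.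
have g0 : gauss_sum != 0.
  rewrite -(@sqrf_eq0 F) gauss_sum_sqr (intr_eq0_pchar F l) //.
  rewrite Gauss_dvdzr.
    by rewrite dvdzE /= dvdn_prime2.
  rewrite coprimezE /= prime_coprime //; apply/negP.
  have /orP[/orP[]|] := legendre_is_sign p (-1) => [|/eqP->|/eqP->].
  - rewrite legendre_eq0 // dvdzE /= dvdn1; lia.
  - by rewrite /= dvdn1; lia.
  - by rewrite /= dvdn1; lia.
apply/eqP; apply: (mulIf g0); rewrite -gauss_sum_Frobenius -exprSr; congr (_ ^+ _).
by have := lodd; lia.
Qed.

End GaussSum.

(* Gauss' proof: the sum lives in a finite field of characteristic l. *)
Lemma quadratic_reciprocity p l : prime p -> prime l -> (2 < p)%N -> (2 < l)%N -> l != p ->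
  legendre l (legendre p (-1) * p%:Z) = legendre p l.
Proof.
move=> pr lpr p2 l2 lp.
have p10 : (0 < p.-1)%N by lia.
(* By Fermat's little theorem p divides l^(p-1) - 1, so the field of l^(p-1) elements contains a
   primitive p-th root of unity. *)
have [F lF cF] := pPrimePowerField lpr p10.
have [y yP] := finField_prim_root F; rewrite cF in yP.
have pd : (p %| (l ^ p.-1).-1)%N.
  have : coprime l p by rewrite prime_coprime // dvdn_prime2.
  move/Euler_exp_totient; rewrite totient_prime // => /eqP.
  by rewrite eqn_mod_dvd ?subn1 // expn_gt0 prime_gt0.
have gp := gauss_sum_legendre p l F _ pr p2 (dvdn_prim_root yP pd) lF l2 lp.
apply: (sign_inj _ l _ _ (pchar_Fp lpr) l2); rewrite ?legendre_is_sign //.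
by rewrite legendreE //; apply/eqP; rewrite -rmorphXn (eqr_int_pchar _ l) ?pchar_Fp.
Qed.

Lemma legendreN1_mod4 l : prime l -> (2 < l)%N ->
  legendre l (-1) = if (l %% 4 == 1)%N then 1 else -1.
Proof.
move=> lpr l2.
have lodd : odd l by case: (even_prime lpr) l2 => [->|].
rewrite legendreN1 // -signr_odd; case: eqP => h.
  by have -> : odd l.-1./2 = false by lia.
by have -> : odd l.-1./2 = true by lia.
Qed.

(** The analogue of a Gauss sum for 2: the field of l^2 elements has an element y of order 8, and w
    = y + y^(-1), written with y^7, satisfies w^2 = 2. Frobenius sends w to y^l + y^(-l), which is w
    or -w according to l modulo 8. *)
Lemma legendre2 l : prime l -> (2 < l)%N ->
  legendre l 2 = if (l %% 8 == 1)%N || (l %% 8 == 7)%N then 1 else -1.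
Proof.
move=> lpr l2.
have lodd : odd l by case: (even_prime lpr) l2 => [->|].
have [F lF cF] := pPrimePowerField lpr (isT : (0 < 2)%N).
have [y0 y0P] := finField_prim_root F; rewrite cF in y0P.
have pd : (8 %| (l ^ 2).-1)%N.
  have : (l %% 8 = 1 \/ l %% 8 = 3 \/ l %% 8 = 5 \/ l %% 8 = 7)%N by lia.
  have := divn_eq l 8; move: (l %/ 8)%N (l %% 8)%N => q r El.
  by case=> [|[|[]]] Er; apply/dvdnP; [exists (8 * q ^ 2 + 2 * q)%N | exists (8 * q ^ 2 + 6 * q + 1)%N
    | exists (8 * q ^ 2 + 10 * q + 3)%N | exists (8 * q ^ 2 + 14 * q + 6)%N]; rewrite El Er; lia.
have := dvdn_prim_root y0P pd; move: (y0 ^+ _) => y yP {y0 y0P pd}.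
have y0 : y != 0 by rewrite (prim_root_eq0 yP).
have y8 : y ^+ 8 = 1 by apply: prim_expr_order.
have y4 : y ^+ 4 = -1.
  have : (y ^+ 4) ^+ 2 = 1 by rewrite -exprM.
  move/eqP; rewrite sqrf_eq1 => /orP[|/eqP//].
  by rewrite -(prim_order_dvd yP).
pose w := y + y ^+ 7.
have w2 : w ^+ 2 = 2%:R.
  rewrite /w sqrrD -exprS -exprM y8 (_ : 7 * 2 = 8 + 6)%N // exprD y8 mul1r.
  by rewrite -[y ^+ 6]/(y ^+ (4 + 2)) exprD y4; ring.
have w0 : w != 0.
  by rewrite -sqrf_eq0 w2 -(dvdn_pcharf lF); apply/negP=> /dvdn_leq h; lia.
have wl : w ^+ l = (if (l %% 8 == 1)%N || (l %% 8 == 7)%N then 1 else -1)%:~R * w.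
  rewrite -(pFrobenius_autE lF) rmorphD /= !pFrobenius_autE -exprM.
  rewrite -(prim_expr_mod yP l) -(prim_expr_mod yP (7 * l)) -modnMmr.
  have : (l %% 8 = 1 \/ l %% 8 = 3 \/ l %% 8 = 5 \/ l %% 8 = 7)%N by lia.
  rewrite /w; case=> [|[|[]]] -> /=; rewrite ?mul1r ?mulN1r //.
  - rewrite -[(7 * 3 %% 8)%N]/(1 + 4)%N -[7%N]/(3 + 4)%N !exprD y4; ring.
  - rewrite -[(7 * 5 %% 8)%N]/3%N -[5%N]/(1 + 4)%N -[7%N]/(3 + 4)%N !exprD y4; ring.
  - by rewrite -[(7 * 7 %% 8)%N]/1%N addrC.
apply: (sign_inj _ l _ _ (pchar_Fp lpr) l2); rewrite ?legendre_is_sign //.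
  by case: ifP.
rewrite legendreE //; apply/eqP; rewrite -rmorphXn (eqr_int_pchar _ l) ?pchar_Fp //.
rewrite -(eqr_int_pchar F) // rmorphXn /= -[2%:~R]/(2%:R) -w2 -exprM.
apply/eqP; apply: (mulIf w0); rewrite -wl -exprSr; congr (_ ^+ _); lia.
Qed.

(** * Sums of real characters *)

Record real_character (m : nat) (chi : nat -> int) : Prop := RealCharacter {
  rchar1 : chi 1%N = 1;
  rcharM : forall a b, chi (a * b)%N = chi a * chi b;
  rchar_sign : forall a, is_sign (chi a);
  rchar_periodic : forall a, chi (a + m)%N = chi a;
  rchar_eq0 : forall a, (chi a == 0) = ~~ coprime a m
}.

Section CharacterSums.
Variables (m : nat) (chi : nat -> int) (n0 : nat).
Hypotheses (m0 : (0 < m)%N) (chiP : real_character m chi) (chi_n0 : chi n0 = -1).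

Lemma rchar_mod a : chi (a %% m)%N = chi a.
Proof.
rewrite {2}(divn_eq a m); elim: (a %/ m)%N => [|k IHk]; first by rewrite mul0n.
by rewrite mulSn -addnA addnC (rchar_periodic _ _ chiP).
Qed.

(** Multiplication by [n0] permutes the residues modulo m and negates the sum. *)
Lemma rchar_period_sum : \sum_(i < m) chi i = 0.
Proof.
have co : coprime n0 m.
  by apply: contraT => h; have := rchar_eq0 _ _ chiP n0; rewrite h chi_n0.
pose f (i : 'I_m) := Ordinal (ltn_pmod (n0 * i) m0).
have f_inj : injective f.
  move=> i j; wlog ij : i j / (i <= j)%N.
    by move=> H fij; case: (leqP i j) => [|/ltnW] h; [apply: H | apply/esym/H].
  move=> /(congr1 val) /= /eqP; rewrite eq_sym eqn_mod_dvd ?leq_mul2l ?ij ?orbT //.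
  rewrite -mulnBr Gauss_dvdr 1?coprime_sym // => /dvdn_leq mij.
  by apply/val_inj => /=; have := ltn_ord j; lia.
have : \sum_(i < m) chi i = - \sum_(i < m) chi i; last by lia.
rewrite {1}(reindex_inj f_inj) -mulN1r big_distrr /=; apply: eq_bigr => i _.
by rewrite rchar_mod (rcharM _ _ chiP) chi_n0.
Qed.

Lemma rchar_prefix_sum n : `|\sum_(0 <= i < n) chi i| <= m%:Z.
Proof.
have per k : \sum_(0 <= i < k + m) chi i = \sum_(0 <= i < k) chi i.
  rewrite addnC (big_cat_nat _ (n := m)) //=; last by lia.
  rewrite big_mkord rchar_period_sum add0r -{1}[m]add0n big_addn addKn.
  by apply: eq_bigr => i _; rewrite (rchar_periodic _ _ chiP).
have -> : \sum_(0 <= i < n) chi i = \sum_(0 <= i < n %% m) chi i.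
  rewrite {1}(divn_eq n m) addnC; elim: (n %/ m)%N => [|k IHk]; first by rewrite addn0.
  by rewrite mulSn addnCA addnC per.
apply: (le_trans (ler_norm_sum _ _ _)).
apply: (@le_trans _ _ (\sum_(0 <= i < n %% m) 1)).
  apply: ler_sum => i _; have := rchar_sign _ _ chiP i.
  by case/orP => [/orP[]|] /eqP->.
by rewrite sumr_const_nat subn0 natz; have := ltn_pmod n m0; lia.
Qed.

Lemma rchar_range_sum a b : (a <= b)%N -> `|\sum_(a <= i < b) chi i| <= (2 * m)%:Z.
Proof.
move=> ab; have := rchar_prefix_sum b; have := rchar_prefix_sum a.
rewrite (big_cat_nat _ (n := a) (m := 0%N) (p := b)) //=.
move: (\sum_(0 <= i < a) _) (\sum_(a <= i < b) _) => u v; lia.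
Qed.

Variable R : rcfType.

(* By Abel summation. *)
Lemma rchar_weighted_sum (w : nat -> R) a b : (a <= b)%N ->
  (forall i, 0 <= w i) -> (forall i, (a <= i)%N -> w i.+1 <= w i) ->
  `|\sum_(a <= i < b) (chi i)%:~R * w i| <= (2 * m)%:R * w a.
Proof.
move=> ab w0 wS.
pose T n : R := (\sum_(a <= i < n) chi i)%:~R.
have TD n : (a <= n)%N -> `|T n| <= (2 * m)%:R.
  move=> an; rewrite /T -intr_norm -[_%:R]/((2 * m)%:Z%:~R) ler_int.
  exact: rchar_range_sum.
have key b' : (a <= b')%N ->
    `|\sum_(a <= i < b') (chi i)%:~R * w i - T b' * w b'| <= (2 * m)%:R * (w a - w b').
  elim: b' => [|n IHn] ab'.
    move: ab'; rewrite leqn0 => /eqP a0.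
    by rewrite /T a0 !big_geq // mul0r subrr normr0 subrr mulr0.
  move: ab'; rewrite leq_eqVlt => /orP[/eqP<-|an].
    by rewrite /T !big_geq // mul0r subrr normr0 subrr mulr0.
  have TS : T n.+1 = T n + (chi n)%:~R by rewrite /T big_nat_recr //= rmorphD.
  rewrite big_nat_recr //=.
  have -> : \sum_(a <= i < n) (chi i)%:~R * w i + (chi n)%:~R * w n - T n.+1 * w n.+1 =
     (\sum_(a <= i < n) (chi i)%:~R * w i - T n * w n) + T n.+1 * (w n - w n.+1).
    by rewrite TS; ring.
  apply: (le_trans (ler_normD _ _)).
  have -> : w a - w n.+1 = (w a - w n) + (w n - w n.+1) by ring.
  rewrite [leRHS]mulrDr lerD ?IHn // normrM ler_pM ?TD //; first exact: ltnW.
  by rewrite ger0_norm // subr_ge0 wS.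
have := key b ab; rewrite mulrBr => h.
have h2 : `|T b * w b| <= (2 * m)%:R * w b.
  by rewrite normrM ler_pM ?TD // ger0_norm.
rewrite -[\sum_(_ <= _ < _) _](subrK (T b * w b)).
apply: (le_trans (ler_normD _ _)); lra.
Qed.

End CharacterSums.

(** * Convolution of two real characters and the hyperbola method *)

Definition divconv (chi psi : nat -> int) (n : nat) : int :=
  \sum_(d <- divisors n) chi d * psi (n %/ d)%N.

Section Convolution.
Variables (m : nat) (chi psi : nat -> int).
Hypotheses (m0 : (0 < m)%N) (chiP : real_character m chi) (psiP : real_character m psi).

Let h := divconv chi psi.

Let psiX p k : psi (p ^ k)%N = psi p ^+ k.
Proof.
elim: k => [|k IHk]; first exact: rchar1 psiP.
by rewrite expnS (rcharM _ _ psiP) IHk exprS.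
Qed.

(** The divisors of p^(k+1) r that are multiples of p are p times the divisors of p^k r; the others
    are the divisors of r. *)
Lemma divconv_step p k r : prime p -> (0 < r)%N -> ~~ (p %| r)%N ->
  h (p ^ k.+1 * r)%N = chi p * h (p ^ k * r)%N + psi p ^+ k.+1 * h r.
Proof.
move=> pr r0 pr'; have p0 := prime_gt0 pr.
have n0 : (0 < p ^ k * r)%N by rewrite muln_gt0 expn_gt0 p0.
have n1 : (0 < p * (p ^ k * r))%N by rewrite muln_gt0 p0.
rewrite {1}/h /divconv expnS -mulnA (bigID (fun d => (p %| d)%N)) /=; congr (_ + _).
  rewrite -big_filter (perm_big [seq (p * d)%N | d <- divisors (p ^ k * r)]) /=.
    rewrite big_map /h /divconv big_distrr /=; apply: eq_bigr => d _.
    by rewrite (rcharM _ _ chiP) divnMl // mulrA.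
  apply: uniq_perm.
  - by rewrite filter_uniq // divisors_uniq.
  - by rewrite map_inj_uniq ?divisors_uniq // => x y /eqP; rewrite eqn_pmul2l // => /eqP.
  move=> d; rewrite mem_filter -dvdn_divisors //.
  apply/andP/mapP => [[/dvdnP[e ->]]|[e]].
    by rewrite mulnC dvdn_pmul2l // => he; exists e; rewrite // -dvdn_divisors.
  by rewrite -dvdn_divisors // => he ->; rewrite dvdn_mulr // dvdn_pmul2l.
rewrite -big_filter (perm_big (divisors r)) /=.
  rewrite /h /divconv big_distrr /= !big_seq; apply: eq_bigr => d.
  rewrite -dvdn_divisors // => dr.
  by rewrite mulnA -expnS -muln_divA // (rcharM _ _ psiP) psiX mulrCA.
apply: uniq_perm; rewrite ?filter_uniq ?divisors_uniq //.
move=> d; rewrite mem_filter -!dvdn_divisors //.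
rewrite mulnA -expnS; apply/andP/idP => [[pd]|dr].
  by rewrite Gauss_dvdr // coprimeXr // coprime_sym prime_coprime.
split; last by rewrite dvdn_mull.
by apply: contra pr' => h'; apply: dvdn_trans dr.
Qed.

(* With one of the symbols equal to 1, the local factor at p is a geometric
   sum with nonnegative value, positive at even exponents. *)
Lemma divconv_local p : ~~ ((chi p == -1) && (psi p == -1)) ->
  prime p -> exists A : nat -> int,
  [/\ forall k, 0 <= A k, coprime p m -> forall k, 1 <= A (2 * k)%N &
      forall k r, (0 < r)%N -> ~~ (p %| r)%N -> h (p ^ k * r)%N = A k * h r].
Proof.
move=> np pr.
pose A k := \sum_(i < k.+1) chi p ^+ (k - i) * psi p ^+ i.
have AS k : A k.+1 = chi p * A k + psi p ^+ k.+1.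
  rewrite /A big_ord_recr /= subnn expr0 mul1r big_distrr /=; congr (_ + _).
  apply: eq_bigr => i _; by rewrite (subSn (leq_ord i)) exprS mulrA.
have A0 : A 0%N = 1 by rewrite /A big_ord_recl big_ord0.
have hA k r : (0 < r)%N -> ~~ (p %| r)%N -> h (p ^ k * r)%N = A k * h r.
  move=> r0 pr'; elim: k => [|k IHk]; first by rewrite A0 mul1r mul1n.
  by rewrite divconv_step // IHk AS; ring.
have [co|nco] := boolP (coprime p m); last first.
  have chi0 : chi p = 0 by apply/eqP; rewrite (rchar_eq0 _ _ chiP).
  have psi0 : psi p = 0 by apply/eqP; rewrite (rchar_eq0 _ _ psiP).
  exists A; split=> //; case=> [|k]; first by rewrite A0.
  by rewrite AS chi0 psi0 mul0r exprS mul0r.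
have sgn1 c : real_character m c -> c p = 1 \/ c p = -1.
  move=> cP; have := rchar_eq0 _ _ cP p; rewrite co.
  by case/orP: (rchar_sign _ _ cP p) => [/orP[]|] /eqP->; [|left|right].
have AP k : 1 <= A (2 * k)%N /\ 0 <= A (2 * k).+1.
  elim: k => [|k [IH1 IH2]]; rewrite ?mulnS ?[(2 + _)%N]/((2 * k).+2) !AS.
    rewrite muln0 A0 !mulr1 expr1; move: np.
    by case: (sgn1 _ chiP) => ->; case: (sgn1 _ psiP) => ->.
  move: IH1 IH2; rewrite AS; move: np.
  have E1 : (-1 : int) ^+ (2 * k) = 1 by rewrite exprM sqrrN !expr1n.
  case: (sgn1 _ chiP) => ->; case: (sgn1 _ psiP) => -> //= _;
    rewrite ?expr1n; do ?rewrite exprS; rewrite ?E1; lia.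
exists A; split=> //.
  move=> k; have [hA1 hA2] := AP k./2.
  by rewrite -[k]odd_double_half -mul2n; case: odd; rewrite ?add1n ?add0n; lia.
by move=> _ k; have [] := AP k.
Qed.

Hypothesis no_common : forall p, prime p -> ~~ ((chi p == -1) && (psi p == -1)).

Let pdiv_split n : (1 < n)%N -> exists p k r,
  [/\ prime p, (0 < r)%N, ~~ (p %| r)%N, (r < n)%N & n = (p ^ k * r)%N].
Proof.
move=> n1; have n0 := ltnW n1; have pr := pdiv_prime n1.
have [k npk e] := pfactor_coprime pr n0.
exists (pdiv n), (logn (pdiv n) n), k.
have k0 : (0 < k)%N by case: k npk e => // _ e; rewrite e in n0.
split=> //; first by rewrite -prime_coprime.
  rewrite [ltnRHS]e ltn_Pmulr // -[1%N](expn0 (pdiv n)) ltn_exp2l ?prime_gt1 //.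
  by rewrite logn_gt0 -pi_pdiv in n1 *.
by rewrite mulnC -e.
Qed.

Let h1 : h 1%N = 1.
Proof. by rewrite /h /divconv big_seq1 (rchar1 _ _ chiP) (rchar1 _ _ psiP). Qed.

Lemma divconv_ge0 n : (0 < n)%N -> 0 <= h n.
Proof.
elim/ltn_ind: n => n IHn n0; have [n1|] := ltnP 1 n; last first.
  by move=> n1; have -> : n = 1%N; [lia | rewrite h1].
have [p [k [r [pr r0 pr' rn ->]]]] := pdiv_split n n1.
have [A [A0 _ ->]] := divconv_local p (no_common p pr) pr => //.
by rewrite mulr_ge0 ?IHn.
Qed.

Lemma divconv_square_ge1 n : (0 < n)%N -> coprime n m -> 1 <= h (n ^ 2)%N.
Proof.
elim/ltn_ind: n => n IHn n0; have [n1|] := ltnP 1 n; last first.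
  by move=> n1; have -> : n = 1%N; [lia | rewrite h1].
have [p [k [r [pr r0 pr' rn En]]]] := pdiv_split n n1.
have [A [A0 A1 hA]] := divconv_local p (no_common p pr) pr.
case: k En => [En|k En co]; first by exfalso; lia.
have [cp cr] : coprime p m /\ coprime r m.
  by move: co; rewrite En coprimeMl coprime_pexpl // => /andP[].
rewrite En expnMn -expnM mulnC (mulnC k.+1) mulnC hA ?expn_gt0 ?r0 //; last first.
  by rewrite Euclid_dvdX // negb_and pr'.
have := A1 cp k.+1; have := IHn r rn r0 cr; nia.
Qed.

End Convolution.

Section Hyperbola.
Variables (R : rcfType) (m : nat) (chi psi : nat -> int) (n1 n2 : nat).
Hypotheses (m0 : (0 < m)%N) (chiP : real_character m chi) (psiP : real_character m psi).
Hypotheses (chi_n1 : chi n1 = -1) (psi_n2 : psi n2 = -1).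

(** At n = 0 the weight is 0, the inverse of 0, so terms with a zero index vanish. *)
Let w (n : nat) : R := (Num.sqrt n%:R)^-1.
Let D : R := (2 * m)%:R.
Let F a b : R := (chi a)%:~R * w a * ((psi b)%:~R * w b).

Let w0 : w 0%N = 0. Proof. by rewrite /w sqrtr0 invr0. Qed.
Let w_ge0 n : 0 <= w n. Proof. by rewrite /w invr_ge0 sqrtr_ge0. Qed.
Let wM a b : w (a * b)%N = w a * w b.
Proof. by rewrite /w natrM sqrtrM ?ler0n // invfM. Qed.
Let w1 : w 1%N = 1. Proof. by rewrite /w sqrtr1 invr1. Qed.
Let w_le a b : (0 < a)%N -> (a <= b)%N -> w b <= w a.
Proof.
move=> a0 ab; have b0 := leq_trans a0 ab.
by rewrite /w lef_pV2 ?posrE ?sqrtr_gt0 ?ltr0n // ler_sqrt ?ler_nat // ltr0n.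
Qed.
Let wXX n : (0 < n)%N -> w (n ^ 2)%N = n%:R^-1.
Proof. by move=> n0; rewrite /w natrX sqrtr_sqr ger0_norm. Qed.

Let w_sum X : \sum_(1 <= b < X.+1) w b <= 2 * Num.sqrt X%:R.
Proof.
elim: X => [|X IH]; first by rewrite big_geq // sqrtr0 mulr0.
rewrite big_nat_recr //=; apply: (le_trans (lerD IH (lexx _))).
set s := Num.sqrt X%:R; set t := Num.sqrt X.+1%:R.
have t0 : 0 < t by rewrite sqrtr_gt0 ltr0n.
have s0 : 0 <= s by apply: sqrtr_ge0.
have E : t ^+ 2 = s ^+ 2 + 1 by rewrite !sqr_sqrtr ?ler0n // -natr1.
rewrite -lerBrDl -mulrBr /w -/t -(ler_pM2r t0) mulVf ?gt_eqF //.
have : 0 <= (t - s) ^+ 2 by apply: sqr_ge0.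
lra.
Qed.

Lemma divconv_sum_regroup Y :
  \sum_(n < Y.+1) (divconv chi psi n)%:~R * w n
  = \sum_(0 <= a < Y.+1) \sum_(0 <= b < Y.+1 | (a * b <= Y)%N) F a b.
Proof.
have E (n : 'I_Y.+1) : (divconv chi psi n)%:~R * w n =
    \sum_(a < Y.+1) \sum_(b < Y.+1) if (a * b == n)%N then F a b else 0.
  have [n0|n0] := posnP n.
    rewrite n0 w0 mulr0 big1 // => a _; rewrite big1 // => b _; case: eqP => //.
    move/eqP; rewrite muln_eq0 /F => /orP[]/eqP->; rewrite w0 ?mulr0 ?mul0r //.
  rewrite /divconv rmorph_sum big_distrl /=.
  rewrite [RHS](bigID (fun a : 'I_Y.+1 => (a %| n)%N)) /= [X in _ + X]big1 => [|a na]; last first.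
    by rewrite big1 // => b _; case: eqP => // e; rewrite -e dvdn_mulr in na.
  rewrite addr0 -(big_mkord (fun a => (a %| n)%N) (fun a =>
     \sum_(b < Y.+1) if (a * b == n)%N then F a b else 0)).
  rewrite -[RHS]big_filter [RHS](perm_big (divisors n)); last first.
    apply: uniq_perm.
    - by rewrite filter_uniq ?iota_uniq.
    - exact: divisors_uniq.
    move=> d; rewrite mem_filter mem_index_iota -dvdn_divisors // leq0n /=.
    case dn: (d %| n)%N => //=; have := dvdn_leq n0 dn; have := ltn_ord n; lia.
  rewrite !big_seq; apply: eq_bigr => d; rewrite -dvdn_divisors // => dn.
  have dY : (n %/ d < Y.+1)%N by apply: leq_ltn_trans (leq_div _ _) (ltn_ord n).
  have d0 : (0 < d)%N by apply: dvdn_gt0 dn.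
  rewrite -big_mkcond /= (big_pred1 (Ordinal dY)) => [|b] /=.
    rewrite -[in LHS](divnK dn) mulnC wM /F mulnC divnK //.
    by rewrite rmorphM /=; ring.
  by rewrite -val_eqE /= eqn_div // mulnC.
rewrite (eq_bigr _ (fun n _ => E n)) exchange_big big_mkord /=; apply: eq_bigr => a _.
rewrite exchange_big big_mkord /= [RHS]big_mkcond /=; apply: eq_bigr => b _.
rewrite -big_mkcond /=; case: leqP => h.
  by rewrite (big_pred1 (Ordinal (h : (a * b < Y.+1)%N))) // => n; rewrite -val_eqE /= eq_sym.
by rewrite big_pred0 // => n; apply/eqP => e; have := ltn_ord n; lia.
Qed.

Let range_sum Y a (G : nat -> R) c : (0 < a)%N ->
  \sum_(c <= b < Y.+1 | (a * b <= Y)%N) G b = \sum_(c <= b < (Y %/ a).+1) G b.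
Proof.
move=> a0; rewrite [RHS](big_nat_widen _ _ Y.+1) ?ltnS ?leq_div //.
by apply: eq_bigl => b; rewrite ltnS leq_divRL // mulnC.
Qed.

(** Put Y = X^2 and cut the region ab <= Y at a = X. For a <= X the inner sum over b is the full sum
    minus a tail. The full sums give D^2; a tail costs w(a) D w(Y/a + 1) <= D/X, hence D over all a.
    For a > X one has b <= X; the sum over a is at most D w(X), and the sum of w(b) is at most 2
    sqrt X, which gives 2D. *)
Lemma divconv_sum_bounded X : (0 < X)%N ->
  `|\sum_(n < (X ^ 2).+1) (divconv chi psi n)%:~R * w n| <= D ^+ 2 + 3 * D.
Proof.
move=> X0; pose Y := (X ^ 2)%N; have XY : (X <= Y)%N by rewrite /Y; nia.
have D0 : 0 <= D by apply: ler0n.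
have sX0 : 0 < Num.sqrt X%:R :> R by rewrite sqrtr_gt0 ltr0n.
rewrite divconv_sum_regroup -/Y (big_cat_nat _ (n := X.+1)) //=.
have chib a b : (0 < a)%N -> (a <= b)%N -> `|\sum_(a <= i < b) (chi i)%:~R * w i| <= D * w a.
  move=> a0 ab; apply: (rchar_weighted_sum _ _ _ m0 chiP chi_n1) => // i ai.
  by apply: w_le => //; apply: leq_trans ai.
have psib a b : (0 < a)%N -> (a <= b)%N -> `|\sum_(a <= i < b) (psi i)%:~R * w i| <= D * w a.
  move=> a0 ab; apply: (rchar_weighted_sum _ _ _ m0 psiP psi_n2) => // i ai.
  by apply: w_le => //; apply: leq_trans ai.
pose P := \sum_(1 <= b < Y.+1) (psi b)%:~R * w b.
have -> : \sum_(0 <= a < X.+1) \sum_(0 <= b < Y.+1 | (a * b <= Y)%N) F a b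
   = P * (\sum_(1 <= a < X.+1) (chi a)%:~R * w a) -
     \sum_(1 <= a < X.+1) (chi a)%:~R * w a *
        \sum_((Y %/ a).+1 <= b < Y.+1) (psi b)%:~R * w b.
  rewrite big_ltn // big1 ?add0r => [|b _]; last by rewrite /F w0 mulr0 mul0r.
  rewrite mulrC big_distrl /= -sumrB !big_nat; apply: eq_bigr => a /andP[a0 aX].
  rewrite range_sum // [LHS]big_ltn // /F w0 !mulr0 add0r -big_distrr /= -mulrBr; congr (_ * _).
  by rewrite /P [X in _ = X - _](big_cat_nat _ (n := (Y %/ a).+1)) ?ltnS ?leq_div //= addrK.
have b1 : `|P * (\sum_(1 <= a < X.+1) (chi a)%:~R * w a)| <= D ^+ 2.
  rewrite normrM expr2; apply: ler_pM => //.
    by have := psib 1%N Y.+1 isT isT; rewrite w1 mulr1.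
  by have := chib 1%N X.+1 isT isT; rewrite w1 mulr1.
have b2 : `|\sum_(1 <= a < X.+1) (chi a)%:~R * w a *
        \sum_((Y %/ a).+1 <= b < Y.+1) (psi b)%:~R * w b| <= D.
  apply: (le_trans (ler_norm_sum _ _ _)).
  have -> : D = \sum_(1 <= a < X.+1) (D / X%:R).
    by rewrite sumr_const_nat subn1 /= -[_ *+ _]mulr_natr divfK // pnatr_eq0 -lt0n.
  rewrite !big_nat; apply: ler_sum => a /andP[a0 aX].
  rewrite normrM; apply: (@le_trans _ _ (w a * (D * w (Y %/ a).+1))).
    apply: ler_pM => //; last by apply: psib; rewrite // ltnS leq_div.
    rewrite normrM (ger0_norm (w_ge0 _)) -[leRHS]mul1r ler_wpM2r //.
    by rewrite -intr_norm; case/orP: (rchar_sign _ _ chiP a) => [/orP[]|] /eqP->.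
  rewrite mulrCA ler_wpM2l // -wM -wXX // w_le ?expn_gt0 ?X0 //.
  by rewrite -/Y; have := ltn_ceil Y a0; rewrite mulnC; lia.
have b3 : `|\sum_(X.+1 <= a < Y.+1) \sum_(0 <= b < Y.+1 | (a * b <= Y)%N) F a b| <= 2 * D.
  rewrite (exchange_big_dep_nat xpredT) //= big_ltn // big1 ?add0r => [|a _]; last first.
    by rewrite /F w0 !mulr0.
  rewrite (big_cat_nat _ (n := X.+1)) //= [X in _ + X]big_nat [X in _ + X]big1 ?addr0; last first.
    move=> b /andP[bX _]; rewrite big_nat_cond big_pred0 // => a.
    by apply/negP=> /andP[/andP[aX _] ab]; move: ab; rewrite /Y; nia.
  apply: (le_trans (ler_norm_sum _ _ _)).
  apply: (@le_trans _ _ (\sum_(1 <= b < X.+1) w b * (D * w X))).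
    rewrite !big_nat; apply: ler_sum => b /andP[b0 bX].
    have -> : \sum_(X.+1 <= a < Y.+1 | (a * b <= Y)%N) F a b =
       (psi b)%:~R * w b * \sum_(X.+1 <= a < (Y %/ b).+1) (chi a)%:~R * w a.
      rewrite -(range_sum Y b) // big_distrr /=; apply: eq_big => a.
        by rewrite mulnC.
      by rewrite /F mulrC.
    rewrite normrM; apply: ler_pM => //.
      rewrite normrM (ger0_norm (w_ge0 _)) -[leRHS]mul1r ler_wpM2r //.
      by rewrite -intr_norm; case/orP: (rchar_sign _ _ psiP b) => [/orP[]|] /eqP->.
    have XYb : (X.+1 <= (Y %/ b).+1)%N by rewrite ltnS leq_divRL // /Y; nia.
    apply: (le_trans (chib X.+1 _ isT XYb)).
    by rewrite ler_wpM2l // w_le.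
  rewrite -big_distrl /=; apply: (le_trans (ler_wpM2r _ (w_sum X))).
    by rewrite mulr_ge0.
  rewrite -mulrA ler_wpM2l // mulrCA /w divff ?mulr1 // gt_eqF //.
apply: (le_trans (ler_normD _ _)).
move: (ler_normB (P * (\sum_(1 <= a < X.+1) (chi a)%:~R * w a))
  (\sum_(1 <= a < X.+1) (chi a)%:~R * w a *
        \sum_((Y %/ a).+1 <= b < Y.+1) (psi b)%:~R * w b)) b1 b2 b3.
lra.
Qed.

End Hyperbola.

Lemma harmonic_sum_ge (R : realFieldType) j :
  j%:R <= 2 * \sum_(0 <= t < 2 ^ j) (t.+1%:R)^-1 :> R.
Proof.
elim: j => [|j IH]; first by rewrite mulr_ge0 // sumr_ge0 // => t _; rewrite invr_ge0.
have le2 : (2 ^ j <= 2 ^ j.+1)%N by rewrite leq_exp2l.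
rewrite (big_cat_nat _ (n := (2 ^ j)%N)) //= mulrDr -natr1 lerD //.
have : \sum_(2 ^ j <= t < 2 ^ j.+1) (2 ^ j.+1)%:R^-1 <= \sum_(2 ^ j <= t < 2 ^ j.+1) t.+1%:R^-1 :> R.
  rewrite !big_nat; apply: ler_sum => t /andP[_ t2].
  by rewrite lef_pV2 ?posrE ?ltr0n ?expn_gt0 // ler_nat.
rewrite sumr_const_nat expnS mul2n -addnn addnK -[_ *+ (2 ^ j)]mulr_natr natrD.
have : (2 ^ j)%:R != 0 :> R by rewrite pnatr_eq0 expn_eq0.
move: (2 ^ j)%:R => x x0.
have -> : (x + x)^-1 * x = 2^-1.
  by rewrite -[x in (x + _)^-1]mulr1 -[X in (_ + X)^-1]mulr1 -mulrDr invfM mulrAC mulVf // mul1r.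
lra.
Qed.

(* If no prime had both symbols equal to -1, the convolution of the two
   characters would be nonnegative and at least 1 at the squares prime to m, so
   its sum weighted by n^(-1/2) would diverge; the hyperbola method bounds it. *)
Lemma common_nonresidue (R : rcfType) m chi psi n1 n2 : (0 < m)%N ->
  real_character m chi -> real_character m psi ->
  chi n1 = -1 -> psi n2 = -1 ->
  exists2 p : nat, prime p & chi p = -1 /\ psi p = -1.
Proof.
move=> m0 chiP psiP e1 e2.
(* The squares (1 + mt)^2 with t < T are prime to m and at most X^2. Each contributes at least 1/(1
   + mt) >= 1/(m(t+1)), so by the harmonic bound the sum is at least j/(2m) = D^2 + 3D + 1, more
   than the hyperbola method allows. *)
pose D := (2 * m)%N; pose j := (2 * m * (D ^ 2 + 3 * D + 1))%N; pose T := (2 ^ j)%N.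
pose X := (m * T)%N.
have T0 : (0 < T)%N by rewrite expn_gt0.
have X0 : (0 < X)%N by rewrite muln_gt0 m0.
suff : exists2 p, prime p & (chi p == -1) && (psi p == -1).
  by case=> p pr /andP[/eqP ? /eqP ?]; exists p.
apply: contrapT => no; have {}no p : prime p -> ~~ ((chi p == -1) && (psi p == -1)).
  by move=> pr; apply/negP=> h; apply: no; exists p.
have := divconv_sum_bounded R m chi psi n1 n2 m0 chiP psiP e1 e2 X X0.
set S := \sum_(n < _) _; rewrite leNgt => /negP; apply.
have term_ge0 (n : nat) : 0 <= (divconv chi psi n)%:~R * (Num.sqrt n%:R : R)^-1.
  have [->|n0] := posnP n; first by rewrite sqrtr0 invr0 mulr0.
  by rewrite mulr_ge0 ?invr_ge0 ?sqrtr_ge0 // ler0z (divconv_ge0 m).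
have sX (t : 'I_T) : ((1 + m * t) ^ 2 < (X ^ 2).+1)%N.
  rewrite ltnS leq_sqr /X; have := ltn_ord t; nia.
pose f t := Ordinal (sX t).
have f_inj : injective f.
  move=> s t /(congr1 val) /= /eqP; rewrite eqn_sqr eqn_add2l eqn_pmul2l //.
  by move/eqP/val_inj.
have S1 : \sum_(t < T) (1 + m * t)%:R^-1 <= S.
  rewrite /S (bigID (fun n => n \in [set f t | t in 'I_T])) /= ler_wpDr ?sumr_ge0 //.
  rewrite big_imset /=; last by move=> ? ? _ _; apply: f_inj.
  apply: ler_sum => t _; rewrite natrX sqrtr_sqr ger0_norm ?ler0n //.
  rewrite ler_peMl ?invr_ge0 ?ler0n // -[1]/(1%:~R) ler_int.
  by rewrite (divconv_square_ge1 m) // coprime_sym /coprime addnC mulnC gcdnMDl gcdn1.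
have S2 : m%:R^-1 * \sum_(0 <= t < T) t.+1%:R^-1 <= S.
  apply: le_trans S1; rewrite big_mkord big_distrr /=; apply: ler_sum => t _.
  rewrite -invfM -natrM lef_pV2 ?posrE ?ltr0n ?muln_gt0 ?m0 // ler_nat; nia.
apply: lt_le_trans (ler_norm _); apply: lt_le_trans S2.
have := harmonic_sum_ge R j; rewrite -/T /j natrM mulrC; move: (\sum_(0 <= t < T) _) => H.
rewrite natrM mulrA => hH.
have m0' : 0 < m%:R :> R by rewrite ltr0n.
rewrite [ltRHS]mulrC ltr_pdivlMr //.
apply: (@lt_le_trans _ _ ((D ^ 2 + 3 * D + 1)%:R * m%:R)); last by lra.
rewrite ltr_pM2r // !natrD natrX natrM; lra.
Qed.

(** * Genus characters *)

(** At odd n, [sign4] and [sign8] are the characters (-1/n) and (2/n). *)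
Definition sign4 (n : nat) : int := if (n %% 4 == 1)%N then 1 else -1.
Definition sign8 (n : nat) : int :=
  if (n %% 8 == 1)%N || (n %% 8 == 7)%N then 1 else -1.

Lemma odd_mod8 n : odd n -> [\/ n %% 8 = 1, n %% 8 = 3, n %% 8 = 5 | n %% 8 = 7]%N.
Proof.
move=> h; have : (n %% 8 = 1 \/ n %% 8 = 3 \/ n %% 8 = 5 \/ n %% 8 = 7)%N by lia.
by case=> [|[|[|]]]; [constructor 1|constructor 2|constructor 3|constructor 4].
Qed.

Lemma sign4_mod8 n : sign4 (n %% 8) = sign4 n.
Proof. by rewrite /sign4 modn_dvdm. Qed.

Lemma sign8_mod8 n : sign8 (n %% 8) = sign8 n.
Proof. by rewrite /sign8 modn_mod. Qed.

Lemma sign4M a b : odd a -> odd b -> sign4 (a * b) = sign4 a * sign4 b.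
Proof.
move=> /odd_mod8 ha /odd_mod8 hb; rewrite -sign4_mod8 -(sign4_mod8 a) -(sign4_mod8 b) -modnMm.
by case: ha => ->; case: hb => ->.
Qed.

Lemma sign8M a b : odd a -> odd b -> sign8 (a * b) = sign8 a * sign8 b.
Proof.
move=> /odd_mod8 ha /odd_mod8 hb; rewrite -sign8_mod8 -(sign8_mod8 a) -(sign8_mod8 b) -modnMm.
by case: ha => ->; case: hb => ->.
Qed.

Section GenusCharacters.
Variables (I : finType) (pp : I -> nat).
Hypotheses (pp_pr : forall i, prime (pp i)) (pp2 : forall i, (2 < pp i)%N).
Hypothesis pp_inj : injective pp.

Definition genus_modulus := (8 * \prod_i pp i)%N.

Definition genus_char (e4 e8 : bool) (P : pred I) (n : nat) : int :=
  if coprime n genus_modulus then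
    (if e4 then sign4 n else 1) * (if e8 then sign8 n else 1)
    * \prod_(i | P i) legendre (pp i) n
  else 0.

Lemma genus_modulus_gt0 : (0 < genus_modulus)%N.
Proof. by rewrite muln_gt0 prodn_gt0 // => i; apply: ltnW (ltnW (pp2 i)). Qed.

Lemma coprime_modulus n : coprime n genus_modulus = odd n && [forall i, ~~ (pp i %| n)%N].
Proof.
rewrite /genus_modulus coprimeMr -[8%N]/(2 ^ 3)%N coprime_pexpr // coprimen2; congr (_ && _).
rewrite (big_morph (coprime n) (id1 := true) (op1 := andb)) ?coprimen1 //; last first.
  by move=> a b; rewrite coprimeMr.
rewrite big_andE; apply: eq_forallb => i.
by rewrite coprime_sym prime_coprime.
Qed.

Lemma coprime_modulusP n : reflect (odd n /\ forall i, ~~ (pp i %| n)%N) (coprime n genus_modulus).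
Proof.
rewrite coprime_modulus; apply: (iffP andP) => -[o].
  by move/forallP.
by move=> h; split=> //; apply/forallP.
Qed.

Lemma legendre_pm1 i n : ~~ (pp i %| n)%N -> legendre (pp i) n = 1 \/ legendre (pp i) n = -1.
Proof.
move=> h; have := legendre_eq0 (pp i) (pp_pr i) n; rewrite dvdzE /= (negPf h).
by case/orP: (legendre_is_sign (pp i) n) => [/orP[]|] /eqP->; [|left|right].
Qed.

Lemma genus_char_pm1 e4 e8 P n : coprime n genus_modulus ->
  genus_char e4 e8 P n = 1 \/ genus_char e4 e8 P n = -1.
Proof.
move=> co; rewrite /genus_char co; case/coprime_modulusP: co => _ pn.
have H : \prod_(i | P i) legendre (pp i) n = 1 \/ \prod_(i | P i) legendre (pp i) n = -1.
  apply: (big_ind (fun x : int => x = 1 \/ x = -1)); first by left.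
    by move=> x y [->|->] [->|->]; [left|right|right|left].
  by move=> i _; apply: legendre_pm1.
by rewrite /sign4 /sign8; case: e4; case: e8; do ?case: ifP => _;
   case: H => ->; rewrite ?mul1r ?mulr1 ?mulN1r ?opprK; auto.
Qed.

Lemma genus_char_real e4 e8 P : real_character genus_modulus (genus_char e4 e8 P).
Proof.
split.
- rewrite /genus_char coprime1n /sign4 /sign8 /= big1 => [|i _]; last exact: legendre1.
  by case: e4; case: e8.
- move=> a b; rewrite /genus_char coprimeMl.
  case: coprime_modulusP => /= [[oa _]|_]; last by rewrite mul0r.
  case: coprime_modulusP => /= [[ob _]|_]; last by rewrite mulr0.
  rewrite sign4M // sign8M // (eq_bigr (fun i => legendre (pp i) a * legendre (pp i) b)).
    by rewrite big_split /=; case: e4; case: e8; ring.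
  by move=> i _; rewrite PoszM legendreM.
- move=> a; have [co|nco] := boolP (coprime a genus_modulus).
    by case: (genus_char_pm1 e4 e8 P a co) => ->.
  by rewrite /genus_char (negPf nco).
- move=> a; rewrite /genus_char.
  have -> : coprime (a + genus_modulus) genus_modulus = coprime a genus_modulus.
    by rewrite /coprime !(gcdnC _ genus_modulus) gcdnDr.
  rewrite -(sign4_mod8 (_ + _)) -(sign8_mod8 (_ + _)).
  rewrite [(a + _)%N]addnC /genus_modulus mulnC modnMDl sign4_mod8 sign8_mod8.
  case: ifP => // _; congr (_ * _); apply: eq_bigr => i _.
  apply: legendre_mod => //.
  by rewrite PoszD addrK dvdzE /= dvdn_mulr // (bigD1 i) //= dvdn_mulr.
- move=> a; have [co|nco] := boolP (coprime a genus_modulus).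
    by case: (genus_char_pm1 e4 e8 P a co) => ->.
  by rewrite /genus_char (negPf nco) eqxx.
Qed.

Let coprime8 i : coprime 8 (pp i).
Proof. by rewrite -[8%N]/(2 ^ 3)%N coprime_pexpl // prime_coprime // dvdn_prime2 //; have := pp2 i; lia. Qed.

Let coprime_prod k (P : pred I) : (forall i, P i -> coprime k (pp i)) ->
  coprime k (\prod_(i | P i) pp i).
Proof.
move=> h; apply: (big_ind (fun x => coprime k x)) => //; first exact: coprimen1.
by move=> x y hx hy; rewrite coprimeMr hx.
Qed.

(* Take n congruent to r modulo 8 and to 1 modulo all the primes. *)
Lemma genus_char_mod8 r e4 e8 P : odd r ->
  exists n, genus_char e4 e8 P n = (if e4 then sign4 r else 1) * (if e8 then sign8 r else 1).
Proof.
move=> orr.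
have co : coprime 8 (\prod_i pp i) by apply: coprime_prod => i _; apply: coprime8.
pose n := chinese 8 (\prod_i pp i) r 1.
have n8 : n = r %[mod 8] by apply: chinese_modl.
have n1 i : n = 1 %[mod pp i].
  have : n = 1 %[mod \prod_i pp i] by apply: chinese_modr.
  move/(congr1 (modn^~ (pp i))); rewrite !modn_dvdm //.
    by rewrite (bigD1 i) //= dvdn_mulr.
  by rewrite (bigD1 i) //= dvdn_mulr.
exists n; have on : odd n by clear -n8 orr; clearbody n; lia.
rewrite /genus_char; case: coprime_modulusP => [_|[]]; last first.
  by split=> // i; rewrite /dvdn n1 modn_small // ltnW.
rewrite big1 ?mulr1 => [|i _].
  by rewrite -(sign4_mod8 n) -(sign8_mod8 n) n8 sign4_mod8 sign8_mod8.
rewrite (legendre_mod _ (pp_pr i) _ 1) ?legendre1 //.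
by rewrite -eqz_mod_dvd -[1]/(1%N%:Z) !modz_nat n1.
Qed.

Lemma genus_char_nonresidue i e4 e8 (P : pred I) : P i ->
  exists n, genus_char e4 e8 P n = -1.
Proof.
move=> Pi; have [u Eu] := legendre_nonresidue (pp i) (pp_pr i) (pp2 i).
pose M := (8 * \prod_(j | j != i) pp j)%N.
have co : coprime (pp i) M.
  rewrite coprimeMr coprime_sym coprime8 coprime_prod // => j ji.
  by rewrite prime_coprime // dvdn_prime2 //; apply: contra ji => /eqP/pp_inj ->.
pose n := chinese (pp i) M u 1.
have ni : n = u %[mod pp i] by apply: chinese_modl.
have nM d : (d %| M)%N -> n = 1 %[mod d].
  move=> dM; have : n = 1 %[mod M] by apply: chinese_modr.
  by move/(congr1 (modn^~ d)); rewrite !modn_dvdm.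
have n8 : n = 1 %[mod 8] by apply: nM; rewrite dvdn_mulr.
have nj j : j != i -> n = 1 %[mod pp j].
  by move=> ji; apply: nM; rewrite dvdn_mull // (bigD1 j) //= dvdn_mulr.
have on : odd n by clear -n8; clearbody n; lia.
have Ei : legendre (pp i) n = -1.
  rewrite -Eu; apply: legendre_mod => //.
  have pi0 := prime_gt0 (pp_pr i).
  by rewrite -eqz_mod_dvd !modz_nat ni.
exists n; rewrite /genus_char; case: coprime_modulusP => [_|[]]; last first.
  split=> // j; have [->|ji] := eqVneq j i; last by rewrite /dvdn nj // modn_small // ltnW.
  by apply/negP => h; have := legendre_eq0 (pp i) (pp_pr i) n; rewrite Ei dvdzE /= h.
rewrite (bigD1 i) //= Ei big1 ?mulr1 => [|j /andP[_ ji]].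
  rewrite -(sign4_mod8 n) -(sign8_mod8 n) n8 sign4_mod8 sign8_mod8.
  by case: e4; case: e8.
rewrite (legendre_mod _ (pp_pr j) _ 1) ?legendre1 //.
have pj0 := prime_gt0 (pp_pr j).
by rewrite -eqz_mod_dvd -[1]/(1%N%:Z) !modz_nat nj.
Qed.

End GenusCharacters.

(** Used twice: to solve h^2 = -2N modulo q, and 5a^2 = -q modulo N. *)
Lemma sqr_crt (al be : nat) (t : seq nat) : uniq t -> all prime t ->
  (forall p, p \in t -> exists x : nat, (p %| al * x ^ 2 + be)%N) ->
  exists x : nat, (\prod_(p <- t) p %| al * x ^ 2 + be)%N.
Proof.
elim: t => [|p t IHt] /=; first by exists 0%N; rewrite big_nil dvd1n.
move=> /andP[pt ut] /andP[pr at_] H.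
have [y Hy] : exists x : nat, (\prod_(p <- t) p %| al * x ^ 2 + be)%N.
  by apply: IHt => // r rt; apply: H; rewrite inE rt orbT.
have [x Hx] := H p (mem_head _ _).
have co : coprime p (\prod_(p <- t) p).
  rewrite prime_coprime //; apply/negP => h.
  have {h} : exists2 r, r \in t & (p %| r)%N.
    elim: t at_ {IHt pt ut H Hy} h => [|r t IHt] /=; first by rewrite big_nil Euclid_dvd1.
    move=> /andP[_ at_]; rewrite big_cons Euclid_dvdM // => /orP[h|/(IHt at_)[s st ps]].
      by exists r; rewrite ?mem_head.
    by exists s; rewrite // inE st orbT.
  case=> r rt; rewrite dvdn_prime2 //; last by apply: (allP at_).
  by move/eqP => e; rewrite e rt in pt.
exists (chinese p (\prod_(p <- t) p) x y); rewrite big_cons Gauss_dvd //.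
have E d u v : (u = v %[mod d])%N -> (d %| al * v ^ 2 + be)%N -> (d %| al * u ^ 2 + be)%N.
  by move=> uv; rewrite /dvdn -modnDml -modnMmr -modnXm -uv modnXm modnMmr modnDml.
apply/andP; split; [apply: E Hx; exact: chinese_modl | apply: E Hy; exact: chinese_modr].
Qed.

(** * Linear duality for sign vectors *)

Section Duality.
Variable (k : nat).

Let sg (x : 'F_2) : int := if x == 0 then 1 else -1.

Let F2P (x : 'F_2) : x = 0 \/ x = 1.
Proof.
case: x => [[|[|n]] i] //; [left|right]; exact: val_inj.
Qed.

Let sgD x y : sg (x + y) = sg x * sg y.
Proof. by case: (F2P x) => ->; case: (F2P y) => ->. Qed.

Let sg_sum (J : finType) (P : pred J) (f : J -> 'F_2) :
  sg (\sum_(j | P j) f j) = \prod_(j | P j) sg (f j).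
Proof. by apply: (big_morph sg sgD). Qed.

Let log (e : int) : 'F_2 := if e == -1 then 1 else 0.

(* Linear duality over F_2: a sign vector is a product of vectors of S unless
   some product of coordinates is 1 on S but not on it. *)
Lemma sign_duality (T : Type) (good : T -> Prop) (v : T -> 'I_k -> int) (tau : 'I_k -> int) :
  (forall l i, good l -> v l i = 1 \/ v l i = -1) ->
  (forall i, tau i = 1 \/ tau i = -1) ->
  (forall P : pred 'I_k, (forall l, good l -> \prod_(i | P i) v l i = 1) ->
      \prod_(i | P i) tau i = 1) ->
  exists (J : finType) (f : J -> T), (forall j, good (f j)) /\
    (forall j j', (forall i, v (f j) i = v (f j') i) -> j = j') /\
    (forall i, \prod_j v (f j) i = tau i).
Proof.
move=> v1 tau1 H.
pose vec (e : 'I_k -> int) : 'rV['F_2]_k := \row_i log (e i).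
have sg_log e : e = 1 \/ e = -1 -> sg (log e) = e by case=> ->.
pose W := 'rV['F_2]_k.
pose G (u : W) := `[< exists2 l, good l & vec (v l) = u >].
(* One row for each vector of F_2^k, zeroed unless some good l realizes it: a finite matrix whose
   row space is the span of the possibly infinite family. *)
pose B := \matrix_(i < #|{: W}|) (if G (enum_val i) then enum_val i else 0 : W).
have prodE (c : 'cV['F_2]_k) e : (forall i, e i = 1 \/ e i = -1) ->
    \prod_(i | c i 0 != 0) e i = sg ((vec e *m c) 0 0).
  move=> e1; rewrite mxE sg_sum [LHS]big_mkcond; apply: eq_bigr => i _ /=; rewrite !mxE.
  by case: (F2P (c i 0)) => -> /=; rewrite ?mulr0 // mulr1 sg_log.
have tauB : (vec tau <= B)%MS.
  (* A vector outside the row space is detected by a column of the cokernel; the support of this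
     column is a predicate P that contradicts H. *)
  rewrite submxE; apply/negP => /negP n0.
  have [j nj] : exists j, (vec tau *m cokermx B) 0 j != 0.
    by case/rV0Pn: n0 => j nj; exists j.
  pose c := col j (cokermx B).
  have Hc u : (vec u *m c) 0 0 = (vec u *m cokermx B) 0 j.
    by rewrite !mxE; apply: eq_bigr => i _; rewrite !mxE.
  have := H (fun i => c i 0 != 0); rewrite prodE // Hc /sg (negPf nj) => h.
  suff : -1 = 1 :> int by [].
  apply: h => l gl; rewrite prodE; last by move=> i; apply: v1.
  suff -> : (vec (v l) *m c) 0 0 = 0 by [].
  have gl' : G (vec (v l)) by apply/asboolP; exists l.
  have -> : vec (v l) = row (enum_rank (vec (v l))) B.
    by apply/rowP => i; rewrite !mxE enum_rankK gl' !mxE.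
  by rewrite -row_mul /c colE mulmxA mulmx_coker mul0mx row0 mxE.
have [Z EZ] := submxP tauB.
(* The rows that the solution really uses. Different rows are different sign vectors, so the chosen
   elements are separated by their vectors. *)
pose Q i := (Z 0 i != 0) && G (enum_val i).
pose J := {i : 'I_#|{: W}| | Q i}.
have gJ (j : J) : exists2 l, good l & vec (v l) = enum_val (val j).
  by have /andP[_ /asboolP] := valP j.
pose f (j : J) := projT1 (cid2 (gJ j)).
have fP (j : J) : good (f j) /\ vec (v (f j)) = enum_val (val j).
  by rewrite /f; case: cid2.
exists J, f; split; [|split].
- by move=> j; case: (fP j).
- move=> j j' h; apply/val_inj/enum_val_inj.
  case: (fP j) => _ <-; case: (fP j') => _ <-.
  by apply/rowP => i; rewrite !mxE h.
move=> i; rewrite -[RHS](sg_log _ (tau1 i)).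
have -> : log (tau i) = (Z *m B) 0 i by rewrite -EZ mxE.
rewrite mxE sg_sum (bigID Q) /= [X in _ = _ * X]big1 ?mulr1 => [|j nQ]; last first.
  move: nQ; rewrite /Q negb_and negbK !mxE => /orP[/eqP->|/negPf->]; first by rewrite mul0r.
  by rewrite mxE mulr0.
rewrite (reindex_omap (val : {i : 'I_#|{: W}| | Q i} -> 'I_#|{: W}|) insub) /=; last first.
  by move=> j Qj; rewrite insubT.
apply: eq_big => [j|j _]; first by rewrite valK eqxx andbT; exact: esym (valP j).
rewrite !mxE; have /andP[z0 Gj] := valP j; rewrite Gj.
case: (F2P (Z 0 (val j))) z0 => -> //= _; rewrite mul1r.
have [gf <-] := fP j; rewrite mxE sg_log //; exact: v1.
Qed.

End Duality.

Section GenusRepresentative.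
Variables (R : rcfType) (k : nat) (pp : 'I_k -> nat) (b : bool).
Hypotheses (pp_pr : forall i, prime (pp i)) (pp2 : forall i, (2 < pp i)%N).
Hypothesis pp_inj : injective pp.

Let N' := (\prod_i pp i)%N.
Let N := (if b then N' else 2 * N')%N.
Let J : int := \prod_i legendre (pp i) (-1).

Hypothesis N5 : (N %% 5 = 1)%N \/ (N %% 5 = 4)%N.

Let sqr_legendre l a : prime l -> (2 < l)%N -> ~~ (l %| a)%Z -> legendre l a * legendre l a = 1.
Proof.
move=> lpr l2; rewrite -legendre_eq0 //.
by case/orP: (legendre_is_sign l a) => [/orP[]|] /eqP->.
Qed.

Let legendreN1_pm1 l : prime l -> (2 < l)%N -> legendre l (-1) = 1 \/ legendre l (-1) = -1.
Proof. by move=> lpr l2; rewrite legendreN1_mod4 //; case: ifP; [left|right]. Qed.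

Let J_pm1 : J = 1 \/ J = -1.
Proof.
rewrite /J; apply: (big_ind (fun x : int => x = 1 \/ x = -1)); first by left.
  by move=> x y [->|->] [->|->]; [left|right|right|left].
by move=> i _; apply: legendreN1_pm1.
Qed.

(** Reciprocity turns the condition on l into the value at l of a character modulo 8 times the
    product of the [pp i]. The signs from reciprocity combine into J, which cancels (-1/l) when J =
    -1. For even N, 2N is 4N' and the symbol of 2 disappears. *)
Lemma legendreN2N l : prime l -> (2 < l)%N -> (forall i, pp i != l) ->
  legendre l (- (2 * N)%:Z) = (if J == 1 then sign4 l else 1) * (if b then sign8 l else 1)
     * \prod_i legendre (pp i) l.
Proof.
move=> lpr l2 lpp.
have legJ (x : int) : x = 1 \/ x = -1 -> legendre l x * legendre l x = 1.
  by case=> ->; rewrite ?legendre1 // sqr_legendre // dvdzE /= dvdn1; lia.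
have E i : legendre l (pp i) = legendre l (legendre (pp i) (-1)) * legendre (pp i) l.
  have := quadratic_reciprocity (pp i) l (pp_pr i) lpr (pp2 i) l2.
  rewrite eq_sym lpp => /(_ isT) <-.
  by rewrite legendreM // mulrA legJ ?mul1r //; apply: legendreN1_pm1.
have EN' : legendre l N' = legendre l J * \prod_i legendre (pp i) l.
  rewrite /N' /J (big_morph Posz PoszM (erefl 1%:Z)).
  rewrite !(big_morph (legendre l) (legendreM l lpr l2) (legendre1 l)).
  by rewrite -big_split /=; apply: eq_bigr => i _; apply: E.
have EJ : legendre l (-1) * legendre l J = if J == 1 then sign4 l else 1.
  rewrite /sign4 -legendreN1_mod4 //; case: J_pm1 => -> /=; rewrite ?legendre1 ?mulr1 //.
  by rewrite legJ //; right.
have -> : - (2 * N)%:Z = -1 * (2%:Z * N%:Z) by lia.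
rewrite legendreM // legendreM // -EJ /N; case: b.
  rewrite EN' legendre2 // /sign8; ring.
have h2 : legendre l 2%:Z * legendre l 2%:Z = 1.
  by apply: sqr_legendre => //; rewrite dvdzE /= dvdn_prime2 //; lia.
by rewrite PoszM legendreM // [X in _ * X]mulrA h2 mul1r EN'; ring.
Qed.

Definition genus_prime (l : nat) : Prop :=
  [/\ prime l, (2 < l)%N, forall i, pp i != l & legendre l (- (2 * N)%:Z) = 1].

(** The condition that [sign_duality] asks for. If the product at -5 were -1, take the character
    supported on P and the complementary one, whose product at l is (-2N/l). A prime where both are
    -1 is a genus prime at which the product over P is -1, against the hypothesis. *)
Lemma genus_obstruction (P : pred 'I_k) :
  (forall l, genus_prime l -> \prod_(i | P i) legendre (pp i) l = 1) ->
  \prod_(i | P i) legendre (pp i) (-5) = 1.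
Proof.
move=> H; have p5 i : legendre (pp i) (-5) = 1 \/ legendre (pp i) (-5) = -1.
  have : legendre (pp i) (-5) != 0.
    rewrite legendre_eq0 // dvdzE /= dvdn_prime2 //; apply/eqP => e.
    have : (5 %| N)%N.
      rewrite /N; case: b; rewrite ?dvdn_mull // /N' (bigD1 i) //= e dvdn_mulr //.
    by case: N5; lia.
  by case/orP: (legendre_is_sign (pp i) (-5)) => [/orP[]|] /eqP->; [|left|right].
have [//|tau] : \prod_(i | P i) legendre (pp i) (-5) = 1 \/
    \prod_(i | P i) legendre (pp i) (-5) = -1.
  apply: (big_ind (fun x : int => x = 1 \/ x = -1)); first by left.
    by move=> x y [->|->] [->|->]; [left|right|right|left].
  by move=> i _; apply: p5.
exfalso.
have [i0 Pi0] : exists i, P i.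
  apply: contrapT => no; suff : \prod_(i | P i) legendre (pp i) (-5) = 1 by rewrite tau.
  by rewrite big1 // => i Pi; case: no; exists i.
pose e4 := J == 1.
have [n1 E1] := genus_char_nonresidue _ pp pp_pr pp2 pp_inj i0 false false P Pi0.
(* The complementary character has to take the value -1: through a prime outside P, or else through
   [sign8] at 5 or [sign4] at 3. *)
have [n2 E2] : exists n2, genus_char _ pp e4 b (predC P) n2 = -1.
  have [[i Pi]|all] := pselect (exists i, ~~ P i).
    exact: (genus_char_nonresidue _ pp pp_pr pp2 pp_inj i e4 b (predC P) Pi).
  have {}all i : P i by apply: contrapT => /negP nP; apply: all; exists i.
  have [bE|bE] := boolP b.
    have [n En] := genus_char_mod8 _ pp pp_pr pp2 5 e4 b (predC P) isT.
    by exists n; move: En; rewrite bE => ->; case: e4.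
  have [e4E|e4E] := boolP e4.
    have [n En] := genus_char_mod8 _ pp pp_pr pp2 3 e4 b (predC P) isT.
    by exists n; move: En; rewrite e4E (negPf bE) => ->.
  (* Here the complementary character is principal, so the product is computed: it is J (N'/5).
     Since N = 2N' is 1 or -1 modulo 5, N' is 2 or -2 and (N'/5) = -1; with J = -1 the product is
     1. *)
  exfalso; have JN : J = -1 by case: J_pm1 => // JE; move: e4E; rewrite /e4 JE eqxx.
  suff : \prod_(i | P i) legendre (pp i) (-5) = 1 by rewrite tau.
  have F i : legendre (pp i) (-5) = legendre (pp i) (-1) * legendre 5 (pp i).
    rewrite -[-5]/(-1 * 5%:Z) legendreM //; congr (_ * _).
    have i5 : pp i != 5 by apply/eqP => e; have := legendre_eq0 (pp i) (pp_pr i) (-5); case: (p5 i) => ->; rewrite e.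
    by rewrite -(quadratic_reciprocity 5 (pp i)) // legendreN1_mod4 // mul1r.
  rewrite (eq_bigl xpredT) => [|i]; last by rewrite all.
  rewrite (eq_bigr _ (fun i _ => F i)) big_split /= -/J JN.
  rewrite -(big_morph (legendre 5) (legendreM 5 isT isT) (legendre1 5)).
  rewrite -(big_morph Posz PoszM (erefl 1%:Z)) -/N'.
  move: N5; rewrite /N (negPf bE) => N5'.
  have leg2 : legendre 5 2 = -1 by rewrite legendre2.
  have [h|h] : (N' %% 5 = 3)%N \/ (N' %% 5 = 2)%N by lia.
    rewrite (legendre_mod 5 isT _ (-1 * 2)); last by lia.
    by rewrite legendreM // leg2 legendreN1_mod4.
  by rewrite (legendre_mod 5 isT _ 2) ?leg2 //; lia.
have m0 := genus_modulus_gt0 _ pp pp2.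
have [l lpr [X1 X2]] := common_nonresidue R _ _ _ n1 n2 m0
  (genus_char_real _ pp pp_pr pp2 false false P)
  (genus_char_real _ pp pp_pr pp2 e4 b (predC P)) E1 E2.
have co : coprime l (genus_modulus _ pp).
  by apply: contraT => h; move: X1; rewrite /genus_char (negPf h).
have /(coprime_modulusP _ pp pp_pr)[lodd lpp] := co.
move: X1 X2; rewrite /genus_char co !mul1r => X1 X2.
have l2 : (2 < l)%N by apply: odd_prime_gt2.
have lp i : pp i != l by apply: contra (lpp i) => /eqP->.
suff : genus_prime l by move/H; rewrite X1.
split=> //; rewrite legendreN2N // -/e4 (bigID P) /= X1 mulrCA.
by rewrite mulN1r X2.
Qed.

End GenusRepresentative.

(** * The form s^2 + 5z^2 + 10w^2 *)

Lemma prod_primes_squarefree N : (0 < N)%N ->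
  (forall p, prime p -> ~~ (p ^ 2 %| N)%N) -> (\prod_(p <- primes N) p = N)%N.
Proof.
move=> N0 sf; rewrite [RHS]prod_prime_decomp // prime_decompE big_map /=.
rewrite !big_seq; apply: eq_bigr => p; rewrite mem_primes => /and3P[pr _ pN].
have l1 : (0 < logn p N)%N by rewrite logn_gt0 mem_primes pr N0.
have l2 : (logn p N < 2)%N by rewrite ltnNge -pfactor_dvdn // sf.
by have -> : logn p N = 1%N by lia.
Qed.

Lemma odd_prod (J : finType) (f : J -> nat) : (forall j, odd (f j)) -> odd (\prod_j f j).
Proof.
by move=> h; apply: (big_ind odd) => // x y hx hy; rewrite oddM hx.
Qed.

(** Duality provides distinct genus primes whose product q satisfies (q/p) = (-5/p) for every odd p
    dividing N. Then -2N is a square modulo q and -5q is a square modulo each such p, which are the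
    two conditions of [represented_of_genus]. *)
Lemma ternary_squarefree (R : rcfType) N : (0 < N)%N ->
  (forall p, prime p -> ~~ (p ^ 2 %| N)%N) ->
  (N %% 5 = 1)%N \/ (N %% 5 = 4)%N ->
  exists s z w : nat, N = (s ^ 2 + 5 * z ^ 2 + 10 * w ^ 2)%N.
Proof.
move=> N0 sf N5.
pose s := [seq p <- primes N | p != 2].
pose pp (i : 'I_(size s)) := nth 0%N s i.
have us : uniq s by rewrite filter_uniq ?primes_uniq.
have ps i : pp i \in s by apply: mem_nth.
have [pp_pr ppN] : (forall i, prime (pp i)) /\ (forall i, (pp i %| N)%N).
  by split=> i; have := ps i; rewrite mem_filter mem_primes => /and4P[].
have pp2 i : (2 < pp i)%N.
  have := ps i; have := prime_gt1 (pp_pr i); rewrite mem_filter => h /andP[]; lia.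
have pp_inj : injective pp.
  by move=> i j /eqP; rewrite nth_uniq // => /eqP/val_inj.
have ppP p : prime p -> p != 2 -> (p %| N)%N -> exists i, p = pp i.
  move=> pr p2 pN; have p_s : p \in s by rewrite mem_filter p2 mem_primes pr N0.
  have := p_s; rewrite -index_mem => h; exists (Ordinal h); by rewrite /pp /= nth_index.
have prods : (\prod_i pp i = \prod_(p <- s) p)%N.
  by rewrite (big_nth 0%N) big_mkord.
have NE : N = (if odd N then \prod_i pp i else 2 * \prod_i pp i)%N.
  rewrite prods big_filter.
  rewrite -{1}(prod_primes_squarefree N N0 sf) (bigID (fun p => p == 2)) /=.
  rewrite -big_filter (perm_big (if odd N then [::] else [:: 2])) /=.
    by case: odd; rewrite ?big_nil ?big_seq1 ?mul1n.
  apply: uniq_perm; [by rewrite filter_uniq ?primes_uniq|by case: odd|].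
  move=> p; rewrite mem_filter mem_primes.
  have [->|p2] := eqVneq p 2; first by rewrite N0 dvdn2 /=; case: odd.
  by case: odd; rewrite // inE (negPf p2).
have N5' := N5; rewrite NE in N5'.
have obs := genus_obstruction R (size s) pp (odd N) pp_pr pp2 pp_inj N5'.
pose good := genus_prime (size s) pp (odd N).
have goodE l : good l -> [/\ prime l, (2 < l)%N, forall i, pp i != l & legendre l (- (2 * N)%:Z) = 1].
  by rewrite [in X in _ -> X]NE.
have leg_pm1 i a : ~~ (pp i %| a)%Z -> legendre (pp i) a = 1 \/ legendre (pp i) a = -1.
  rewrite -(legendre_eq0 (pp i) (pp_pr i)).
  by case/orP: (legendre_is_sign (pp i) a) => [/orP[]|] /eqP->; [|left|right].
have p5 i : ~~ (pp i %| -5)%Z.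
  rewrite dvdzE /= dvdn_prime2 //; apply/eqP => e.
  have := ppN i; rewrite e; lia.
have v1 l i : good l -> legendre (pp i) l = 1 \/ legendre (pp i) l = -1.
  case/goodE=> lpr l2 lp _; apply: leg_pm1.
  by rewrite dvdzE /= dvdn_prime2.
have [J [f [fg [f_inj fE]]]] := sign_duality (size s) nat good
  (fun l i => legendre (pp i) l) (fun i => legendre (pp i) (-5)) v1
  (fun i => leg_pm1 i (-5) (p5 i)) obs.
pose q := (\prod_j f j)%N.
have f_pr j : prime (f j) by case: (goodE _ (fg j)).
have qodd : odd q.
  by apply: odd_prod => j; case: (goodE _ (fg j)) => pr l2 _ _; case: (even_prime pr) l2 => [->|].
have fN j : ~~ (f j %| N)%N.
  case: (goodE _ (fg j)) => pr l2 lp _; apply/negP => /ppP[] //; first by apply/eqP; lia.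
  by move=> i e; have := lp i; rewrite -e eqxx.
have qN : coprime q N.
  rewrite coprime_sym; apply: (big_ind (fun x => coprime N x)); first exact: coprimen1.
    by move=> x y hx hy; rewrite coprimeMr hx.
  by move=> j _; rewrite coprime_sym prime_coprime.
have [h hq] : exists h, (q %| 1 * h ^ 2 + 2 * N)%N.
  have -> : q = (\prod_(p <- [seq f j | j : J]) p)%N by rewrite big_image.
  apply: sqr_crt.
  - rewrite map_inj_uniq ?enum_uniq // => j j' e; apply: f_inj => i; by rewrite e.
  - by apply/allP => p /imageP[j _ ->].
  move=> p /imageP[j _ ->]; case: (goodE _ (fg j)) => pr l2 _ /(legendre_sqr_ex _ pr l2)[n].
  by rewrite opprK dvdzE => hn; exists n; rewrite mul1n; exact: hn.
have [a ha] : exists a, (\prod_(p <- primes N) p %| 5 * a ^ 2 + q)%N.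
  apply: sqr_crt.
  - exact: primes_uniq.
  - by apply/allP => p; rewrite mem_primes => /andP[].
  move=> p; rewrite mem_primes => /and3P[pr _ pN].
  have [->|p2] := eqVneq p 2; first by exists 1%N; rewrite dvdn2 oddD qodd.
  have [i pE] := ppP p pr p2 pN.
  have : legendre (pp i) (- (5 * q)%:Z) = 1.
    have -> : - (5 * q)%:Z = -5 * q%:Z by lia.
    rewrite legendreM // /q (big_morph Posz PoszM (erefl 1%:Z)).
    rewrite (big_morph (legendre (pp i)) (legendreM (pp i) (pp_pr i) (pp2 i)) (legendre1 (pp i))).
    by rewrite fE; case: (leg_pm1 i (-5) (p5 i)) => ->.
  case/(legendre_sqr_ex _ (pp_pr i) (pp2 i)) => n; rewrite opprK -pE => hn.
  have co : coprime 5 p.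
    by rewrite coprime_sym prime_coprime //; have := p5 i; rewrite -pE dvdzE.
  (* n is a square root of -5q modulo p; moving it to a multiple of 5 permits an exact division, as
     5(a/5)^2 + q is (a^2 + 5q)/5. *)
  pose a := chinese 5 p 0 n.
  have a5 : (5 %| a)%N by rewrite /dvdn /a chinese_modl.
  have ap : (a = n %[mod p])%N by apply: chinese_modr.
  exists (a %/ 5)%N.
  rewrite -(Gauss_dvdr _ (_ : coprime p 5)) 1?coprime_sym //.
  have -> : (5 * (5 * (a %/ 5) ^ 2 + q) = a ^ 2 + 5 * q)%N.
    by rewrite -{2}(divnK a5) expnMn; lia.
  move: hn; rewrite dvdzE /= => hn.
  by rewrite /dvdn -modnDml -modnXm ap modnXm modnDml.
rewrite prod_primes_squarefree // in ha.
apply: (represented_of_genus N q h a) => //.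
  by rewrite prodn_gt0 // => j; apply: prime_gt0.
by rewrite mul1n in hq.
Qed.

Lemma ternary_represented (R : rcfType) N : (N %% 5 = 1)%N \/ (N %% 5 = 4)%N ->
  exists s z w : nat, N = (s ^ 2 + 5 * z ^ 2 + 10 * w ^ 2)%N.
Proof.
elim/ltn_ind: N => N IHN N5.
have N0 : (0 < N)%N by lia.
have [[p [pr /dvdnP[M E]]]|no] := pselect (exists p, prime p /\ (p ^ 2 %| N)%N).
  have p1 := prime_gt1 pr.
  have MN : (M < N)%N.
    rewrite E -[ltnLHS]muln1 ltn_pmul2l; last by case: M E => // e; rewrite e in N0.
    by rewrite -[1%N](exp1n 2) ltn_exp2r.
  have [s [z [w EM]]] : exists s z w : nat, M = (s ^ 2 + 5 * z ^ 2 + 10 * w ^ 2)%N.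
    apply: IHN => //; move: N5; rewrite E -modnMm -modnXm.
    have := ltn_pmod p (isT : 0 < 5)%N; have := ltn_pmod M (isT : 0 < 5)%N.
    by case: (M %% 5)%N => [|[|[|[|[|]]]]] //; case: (p %% 5)%N => [|[|[|[|[|]]]]] // _ _ [] h;
       (left; reflexivity) || (right; reflexivity) || discriminate h.
  by exists (p * s)%N, (p * z)%N, (p * w)%N; rewrite E EM !expnMn; lia.
apply: (ternary_squarefree R) => // p pr; apply/negP => h; apply: no; by exists p.
Qed.

(** * Sums over prime powers *)

Section PrimePowerSums.
Variable R : realType.

(* In terms of von Mangoldt's function, the sum of Lambda(n) G(floor(x / n)). *)
Definition mangoldt_sum (x : nat) (G : nat -> int) : R :=
  \sum_(1 <= p < x.+1 | prime p) \sum_(1 <= k < x.+1) ln p%:R * (G (x %/ p ^ k)%N)%:~R.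

Lemma ln_prime_ge0 p : prime p -> 0 <= ln (p%:R : R).
Proof. by move=> pr; rewrite ln_ge0 // ler1n prime_gt0. Qed.

Lemma mangoldt_sum_widen x B (G : nat -> int) : G 0%N = 0 -> (x <= B)%N ->
  mangoldt_sum x G = \sum_(1 <= p < B.+1 | prime p) \sum_(1 <= k < B.+1)
     ln p%:R * (G (x %/ p ^ k)%N)%:~R.
Proof.
move=> G0 xB; rewrite /mangoldt_sum [RHS](big_cat_nat _ (n := x.+1)) //=.
rewrite [X in _ = _ + X]big_nat_cond [X in _ = _ + X]big1 ?addr0.
  apply: eq_bigr => p pr; rewrite [RHS](big_cat_nat _ (n := x.+1)) //=.
  rewrite [X in _ = _ + X]big_nat [X in _ = _ + X]big1 ?addr0 // => k /andP[xk _].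
  rewrite divn_small ?G0 ?mulr0 //; apply: leq_trans xk _; apply: ltnW.
  exact: ltn_expl (prime_gt1 pr).
move=> p /andP[/andP[xp _] pr]; rewrite big_nat big1 // => k /andP[k1 _].
rewrite divn_small ?G0 ?mulr0 //; apply: leq_trans xp _.
by rewrite -{1}[p]expn1 leq_exp2l ?prime_gt1.
Qed.

Lemma mangoldt_sum_div x d (G : nat -> int) : G 0%N = 0 ->
  mangoldt_sum (x %/ d) G = mangoldt_sum x (fun M => G (M %/ d)%N).
Proof.
move=> G0; rewrite (mangoldt_sum_widen _ x) ?leq_div //.
apply: eq_bigr => p _; apply: eq_bigr => k _.
by rewrite -!divnMA mulnC.
Qed.

Lemma ler_mangoldt_sum x (G H : nat -> int) : (forall M, G M <= H M) ->
  mangoldt_sum x G <= mangoldt_sum x H.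
Proof.
move=> GH; apply: ler_sum => p pr; apply: ler_sum => k _.
by rewrite ler_wpM2l ?ln_prime_ge0 // ler_int.
Qed.

Lemma mangoldt_sumD x (G H : nat -> int) :
  mangoldt_sum x (fun M => G M + H M) = mangoldt_sum x G + mangoldt_sum x H.
Proof.
rewrite /mangoldt_sum -big_split; apply: eq_bigr => p _; rewrite -big_split.
by apply: eq_bigr => k _; rewrite rmorphD mulrDr.
Qed.

Lemma mangoldt_sumZ x c (G : nat -> int) :
  mangoldt_sum x (fun M => c * G M) = c%:~R * mangoldt_sum x G.
Proof.
rewrite /mangoldt_sum big_distrr; apply: eq_bigr => p _; rewrite big_distrr.
by apply: eq_bigr => k _; rewrite rmorphM /= mulrCA.
Qed.

Lemma mangoldt_sum_lincomb x (J : Type) (s : seq J) (c : J -> int) (G : J -> nat -> int) :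
  mangoldt_sum x (fun M => \sum_(j <- s) c j * G j M)
  = \sum_(j <- s) (c j)%:~R * mangoldt_sum x (G j).
Proof.
elim: s => [|j s IHs].
  rewrite big_nil /mangoldt_sum big1 // => p _; rewrite big1 // => k _.
  by rewrite big_nil mulr0.
rewrite big_cons -IHs -mangoldt_sumZ -mangoldt_sumD.
by apply: eq_bigr => p _; apply: eq_bigr => k _; rewrite big_cons.
Qed.

Lemma prime_dvd_fact p n : prime p -> (p %| n`!)%N = (p <= n)%N.
Proof.
move=> pr; apply/idP/idP; last by move=> pn; rewrite dvdn_fact // prime_gt0.
elim: n => [|n IHn]; first by rewrite fact0 Euclid_dvd1.
rewrite factS Euclid_dvdM // => /orP[/dvdn_leq|/IHn/leqW //].
exact.
Qed.

Lemma ln_fact n : ln (n`!%:R : R) = mangoldt_sum n Posz.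
Proof.
have -> : (n`! = \prod_(1 <= p < n.+1 | prime p) p ^ logn p n`!)%N.
  rewrite {1}[n`!]prod_prime_decomp ?fact_gt0 // prime_decompE big_map /=.
  rewrite -[RHS]big_filter; apply: perm_big; apply: uniq_perm; rewrite ?primes_uniq //.
    by rewrite filter_uniq // iota_uniq.
  move=> p; rewrite mem_primes mem_filter mem_index_iota fact_gt0 /=.
  case pr: (prime p) => //=; rewrite prime_dvd_fact // ltnS.
  by rewrite (prime_gt0 pr).
rewrite /mangoldt_sum.
have -> : \sum_(1 <= p < n.+1 | prime p) \sum_(1 <= k < n.+1) ln p%:R * (Posz (n %/ p ^ k)%N)%:~R
  = \sum_(1 <= p < n.+1 | prime p) ln ((p ^ logn p n`!)%:R : R).
  apply: eq_bigr => p pr; rewrite natrX lnXn ?ltr0n ?prime_gt0 // logn_fact //.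
  by rewrite -[RHS]mulr_natr natr_sum big_distrr.
rewrite natr_prod.
have : forall p : nat, prime p -> 0 < ((p ^ logn p n`!)%:R : R).
  by move=> p pr; rewrite ltr0n expn_gt0 prime_gt0.
move: (fun p => (p ^ logn p n`!)%N) => F F0.
elim: (index_iota 1 n.+1) => [|p s IHs]; first by rewrite !big_nil ln1.
rewrite !big_cons; case: ifP => // pr; rewrite lnM ?IHs ?posrE ?F0 //.
by apply: prodr_gt0 => q qr; apply: F0.
Qed.

Definition psi (x : nat) : R := mangoldt_sum x (fun M => (0 < M)%N).

(** Because floor(x/n) >= m exactly when n <= floor(x/m). Pointwise inequalities between step
    functions thus become inequalities between values of psi. *)
Lemma psi_div x m : (0 < m)%N -> psi (x %/ m) = mangoldt_sum x (fun M => (m <= M)%N).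
Proof.
move=> m0; rewrite /psi mangoldt_sum_div //; apply: eq_bigr => p _; apply: eq_bigr => k _.
by rewrite divn_gt0.
Qed.

Lemma psi_ge0 x : 0 <= psi x.
Proof.
apply: sumr_ge0 => p pr; apply: sumr_ge0 => k _.
by rewrite mulr_ge0 ?ln_prime_ge0.
Qed.

End PrimePowerSums.

(** * Stirling's formula and the Chebyshev combination *)

Section Stirling.
Variable R : realType.

Lemma ln_le_subr1 (y : R) : 0 < y -> ln y <= y - 1.
Proof. by move=> y0; have := @le_ln1Dx R (y - 1); rewrite addrCA subrr addr0; apply; lra. Qed.

Lemma ln_div_le (a b : R) : 0 < a -> 0 < b -> b * (ln a - ln b) <= a - b.
Proof.
move=> a0 b0; rewrite -ln_div ?posrE //.
have := ln_le_subr1 (a / b) (divr_gt0 a0 b0); rewrite -(ler_pM2l b0) mulrBr mulr1.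
by rewrite [b * (a / b)]mulrC divfK ?gt_eqF.
Qed.

Lemma stirling n : (0 < n)%N ->
  n%:R * ln n%:R - n%:R + 1 <= ln (n`!%:R : R) <= n%:R * ln n%:R - n%:R + 1 + ln n%:R.
Proof.
case: n => // n _; elim: n => [|n /andP[IH1 IH2]].
  by rewrite -[1`!]/1%N ln1; apply/andP; split; lra.
rewrite factS natrM lnM ?posrE ?ltr0n ?fact_gt0 //.
have a0 : 0 < n.+1%:R :> R by rewrite ltr0n.
have b0 : 0 < n.+2%:R :> R by rewrite ltr0n.
have := ln_div_le _ _ b0 a0; have := ln_div_le _ _ a0 b0.
have -> : n.+2%:R = n.+1%:R + 1 :> R by rewrite -natr1.
move: (n.+1%:R) IH1 IH2 {a0 b0} => a IH1 IH2 h1 h2.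
move: h1 h2 IH1 IH2; move: (ln _) (ln (a + 1)) (ln a) => F lb la; lra.
Qed.

Lemma ln_fact_div x d : (0 < x)%N -> (0 < d)%N ->
  `|ln ((x %/ d)`!%:R : R) - (x%:R / d%:R * ln (x%:R / d%:R) - x%:R / d%:R)|
    <= ln x%:R + 1.
Proof.
move=> x0 d0; set t := x%:R / d%:R.
have x0' : 0 < x%:R :> R by rewrite ltr0n.
have d0' : 0 < d%:R :> R by rewrite ltr0n.
have t0 : 0 < t by apply: divr_gt0.
have lx : 0 <= ln (x%:R : R) by rewrite ln_ge0 // ler1n.
have tx : t <= x%:R by rewrite ler_pdivrMr // ler_peMr ?ler1n // ltW.
pose q := (x %/ d)%N.
have qt : q%:R <= t by rewrite ler_pdivlMr // -natrM ler_nat leq_divM.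
have tq : t < q%:R + 1 by rewrite ltr_pdivrMr // natr1 -natrM ltr_nat ltn_ceil.
have := ln_le_subr1 _ t0 => lt1.
rewrite -/q ler_norml; have [q0|q0] := posnP q.
  rewrite q0 fact0 ln1 sub0r; rewrite q0 add0r in tq.
  have l1 : ln t <= 0 by rewrite ln_le0 // ltW.
  have := ln_div_le 1 t ltr01 t0; rewrite ln1 sub0r mulrN => h.
  have : t * ln t <= 0 by rewrite mulr_ge0_le0 // ltW.
  by move=> h2; apply/andP; split; lra.
have q0' : 0 < q%:R :> R by rewrite ltr0n.
have q1 : 1 <= q%:R :> R by rewrite ler1n.
have lq : 0 <= ln (q%:R : R) by rewrite ln_ge0.
have lqx : ln (q%:R : R) <= ln x%:R by rewrite ler_ln ?posrE // (le_trans qt).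
have /andP[_ up] := stirling q q0.
(* The lower bound is taken at q + 1, which exceeds t; removing the factor q + 1 leaves q ln(q+1) -
   q <= ln(q!). *)
have /andP[lo _] := stirling q.+1 isT.
rewrite factS natrM lnM ?posrE ?ltr0n ?fact_gt0 // -natr1 in lo.
have hq : 0 <= (t - q%:R) * ln q%:R by rewrite mulr_ge0 // subr_ge0.
have hqt := ln_div_le _ _ q0' t0.
have b0 : 0 < q%:R + 1 :> R by lra.
have lq1 : ln (q%:R + 1) <= ln (x%:R : R) + 1.
  have := ln_div_le _ _ b0 q0'.
  have : ln (q%:R + 1) - ln (q%:R) <= q%:R * (ln (q%:R + 1) - ln (q%:R : R)).
    by rewrite ler_peMl // subr_ge0 ler_ln ?posrE //; lra.
  lra.
have lt2 : ln t <= ln (q%:R + 1) by rewrite ler_ln ?posrE // ltW.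
have h3 : t * ln t <= t * ln (q%:R + 1) by rewrite ler_pM2l.
have h4 : (t - q%:R) * (ln (q%:R + 1) - 1) <= ln x%:R.
  have [neg|pos] := ltP (ln (q%:R + 1 : R)) 1.
    by apply: (le_trans _ lx); rewrite mulr_ge0_le0 ?subr_ge0 ?subr_le0 // ltW.
  have h5 : ln (q%:R + 1) - 1 <= ln (x%:R : R) by lra.
  apply: (le_trans _ h5); rewrite ler_piMl ?subr_ge0 //; lra.
by apply/andP; split; move: hq hqt h3 h4 up lo; rewrite !mulrBr !mulrBl; lra.
Qed.

Lemma ln_le_sqrt (x : R) : 1 <= x -> ln x + 1 <= 2 * Num.sqrt x.
Proof.
move=> x1; have x0 : 0 < x by lra.
have s0 : 0 < Num.sqrt x by rewrite sqrtr_gt0.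
have E : x = Num.sqrt x ^+ 2 by rewrite sqr_sqrtr // ltW.
rewrite {1}E lnXn //; have := ln_le_subr1 _ s0; rewrite mulr2n; lra.
Qed.

End Stirling.

(* The Moebius function on the divisors of 2310 up to 11, completed so that the
   sum of w.2 / w.1 vanishes; cheb_step is then equal to 1 on [1, 13). *)
Definition cheb_weights : seq (nat * int) :=
  [:: (1%N, 1); (6%N, 1); (10%N, 1); (2310%N, 1);
      (2%N, -1); (3%N, -1); (5%N, -1); (7%N, -1); (11%N, -1)].

Definition cheb_step (M : nat) : int :=
  \sum_(w <- cheb_weights) w.2 * Posz (M %/ w.1)%N.

Section Chebyshev.
Variable R : realType.

Definition cheb_const : R :=
  - \sum_(w <- cheb_weights) w.2%:~R * (ln w.1%:R / w.1%:R).

(** The vanishing sum of w.2 / w.1 removes the terms in x ln x and x, up to [cheb_const]. Each of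
    the nine factorials has an error of at most ln x + 1 <= 2 sqrt x, whence 18. *)
Lemma cheb_sum_asymp x : (0 < x)%N ->
  `|mangoldt_sum R x cheb_step - cheb_const * x%:R| <= 18 * Num.sqrt x%:R.
Proof.
move=> x0; have x0' : 0 < x%:R :> R by rewrite ltr0n.
pose h (d : nat) : R := x%:R / d%:R * ln (x%:R / d%:R) - x%:R / d%:R.
have hd d : (0 < d)%N -> h d = (x%:R * ln x%:R - x%:R) * d%:R^-1 - x%:R * (ln d%:R / d%:R).
  by move=> d0; rewrite /h ln_div ?posrE ?ltr0n //; ring.
have EA : cheb_const * x%:R = \sum_(w <- cheb_weights) w.2%:~R * h w.1.
  have -> : \sum_(w <- cheb_weights) w.2%:~R * h w.1 =
      \sum_(w <- cheb_weights) ((x%:R * ln x%:R - x%:R) * (w.2%:~R * w.1%:R^-1)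
         - x%:R * (w.2%:~R * (ln w.1%:R / w.1%:R))).
    rewrite !big_seq; apply: eq_bigr => w wI; rewrite hd; first by ring.
    by have /allP/(_ _ wI) : all (fun w => 0 < w.1)%N cheb_weights by [].
  rewrite sumrB -!big_distrr /= /cheb_const [\sum_(w <- _) (w.2%:~R * w.1%:R^-1)](_ : _ = 0).
    by ring.
  by rewrite /cheb_weights !big_cons big_nil /=; lra.
have -> : mangoldt_sum R x cheb_step = \sum_(w <- cheb_weights) w.2%:~R * ln ((x %/ w.1)`!%:R : R).
  rewrite /cheb_step mangoldt_sum_lincomb; apply: eq_bigr => w _; congr (_ * _).
  by rewrite ln_fact mangoldt_sum_div.
rewrite EA -sumrB; apply: (le_trans (ler_norm_sum _ _ _)).
apply: (@le_trans _ _ (\sum_(w <- cheb_weights) (ln (x%:R : R) + 1))).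
  rewrite big_seq [leRHS]big_seq; apply: ler_sum => w wI.
  have w0 : (0 < w.1)%N by have /allP/(_ _ wI) : all (fun w => 0 < w.1)%N cheb_weights by [].
  have w2 : `|w.2%:~R| = 1 :> R.
    rewrite -intr_norm; have /allP/(_ _ wI)/eqP -> // : all (fun w => `|w.2| == 1 :> int) cheb_weights by [].
  by rewrite -mulrBr normrM w2 mul1r; apply: ln_fact_div.
have := ln_le_sqrt R x%:R; rewrite ler1n => /(_ x0).
by rewrite /cheb_weights !big_cons big_nil /=; lra.
Qed.

Lemma ln_prime_bounds (n : nat) : (0 < n)%N -> 1 - n%:R^-1 <= ln (n%:R : R) <= n%:R - 1.
Proof.
move=> n0; have n0' : 0 < n%:R :> R by rewrite ltr0n.
rewrite ln_le_subr1 // andbT.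
have h : 0 < n%:R^-1 :> R by rewrite invr_gt0.
by have := ln_le_subr1 R _ h; rewrite lnV ?posrE //; lra.
Qed.

(** Crude bounds are enough: all later bounds for psi are expressed in units of this constant, which
    is a common factor of their main terms. *)
Lemma cheb_const_bounds : 1 / 2 <= cheb_const <= 3.
Proof.
rewrite /cheb_const /cheb_weights !big_cons big_nil /=.
have l6 : ln (6%:R : R) = ln 2%:R + ln 3%:R by rewrite -lnM ?posrE ?ltr0n // -natrM.
have l10 : ln (10%:R : R) = ln 2%:R + ln 5%:R by rewrite -lnM ?posrE ?ltr0n // -natrM.
have l2310 : ln (2310%:R : R) = ln 2%:R + ln 3%:R + ln 5%:R + ln 7%:R + ln 11%:R.
  by rewrite -!lnM ?posrE ?mulr_gt0 ?ltr0n // -!natrM.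
rewrite l6 l10 l2310 ln1.
have /andP[? ?] := ln_prime_bounds 2 isT.
have /andP[? ?] := ln_prime_bounds 3 isT.
have /andP[? ?] := ln_prime_bounds 5 isT.
have /andP[? ?] := ln_prime_bounds 7 isT.
have /andP[? ?] := ln_prime_bounds 11 isT.
by apply/andP; split; lra.
Qed.

End Chebyshev.

(** * Bounds for psi *)

(* The booleans encode the coefficients: true for +1, false for -1. *)
Definition step_sum (s : seq (nat * bool)) (M : nat) : int :=
  \sum_(w <- s) (if w.2 then 1 else -1) * Posz (w.1 <= M)%N.

Section PsiBounds.
Variable R : realType.
Local Notation A := (cheb_const R).
Local Notation psi := (psi R).

Definition psi_upper (u k : R) := forall x, psi x <= u * A * x%:R + k * Num.sqrt x%:R.
Definition psi_lower (l k : R) := forall x, l * A * x%:R - k * Num.sqrt x%:R <= psi x.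

(** The coefficients of A x and sqrt x after inserting known bounds for each psi(x/m). As m >= 9,
    sqrt(x/m) is at most sqrt x / 3; the additional 3 pays for the floor of x/m when a lower bound
    is inserted, since l A <= 3. *)
Definition step_main (s : seq (nat * bool)) (u l : R) : R :=
  1 + \sum_(w <- s) (if w.2 then u else - l) / w.1%:R.
Definition step_error (s : seq (nat * bool)) (ku kl : R) : R :=
  18 + \sum_(w <- s) (if w.2 then ku / 3 else kl / 3 + 3).

Lemma psi0 : psi 0%N = 0.
Proof. by rewrite /psi /mangoldt_sum big_geq. Qed.

Lemma A_gt0 : 0 < A.
Proof. by have /andP[] := cheb_const_bounds R; lra. Qed.

Let sqrt_div x m : (9 <= m)%N -> Num.sqrt (x %/ m)%:R <= Num.sqrt x%:R / 3 :> R.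
Proof.
move=> m9; rewrite ler_pdivlMr //.
have -> : 3 = Num.sqrt 9%:R :> R by rewrite -[9%N]/(3 ^ 2)%N natrX sqrtr_sqr ger0_norm.
rewrite -sqrtrM // -natrM ler_sqrt // ler_nat; apply: leq_trans (leq_divM x m).
by rewrite leq_mul2l m9 orbT.
Qed.

Let psi_div_upper u k x m : 0 <= u -> 0 <= k -> psi_upper u k -> (9 <= m)%N ->
  psi (x %/ m) <= u / m%:R * (A * x%:R) + k / 3 * Num.sqrt x%:R.
Proof.
move=> u0 k0 U m9; apply: (le_trans (U _)); have m0 : 0 < m%:R :> R by rewrite ltr0n; lia.
apply: lerD; last by rewrite mulrAC -mulrA ler_wpM2l // sqrt_div.
have -> : u / m%:R * (A * x%:R) = u * A * (x%:R / m%:R) by ring.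
rewrite ler_wpM2l //; first by rewrite mulr_ge0 // ltW // A_gt0.
by rewrite ler_pdivlMr // -natrM ler_nat leq_divM.
Qed.

Let psi_div_lower l k x m : (0 < x)%N -> 0 <= l <= 1 -> 0 <= k -> psi_lower l k -> (9 <= m)%N ->
  l / m%:R * (A * x%:R) - (k / 3 + 3) * Num.sqrt x%:R <= psi (x %/ m).
Proof.
move=> x0 /andP[l0 l1] k0 Lw m9; apply: (le_trans _ (Lw _)).
have m0 : 0 < m%:R :> R by rewrite ltr0n; lia.
have s1 : 1 <= Num.sqrt x%:R :> R by rewrite -[leLHS]sqrtr1 ler_sqrt // ler1n.
have h1 : k * Num.sqrt (x %/ m)%:R <= k / 3 * Num.sqrt x%:R.
  by rewrite mulrAC -mulrA ler_wpM2l // sqrt_div.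
have h2 : l / m%:R * (A * x%:R) - 3 <= l * A * (x %/ m)%:R.
  have -> : l / m%:R * (A * x%:R) = l * A * (x%:R / m%:R) by ring.
  have lA : l * A <= 3.
    have /andP[_ A3] := cheb_const_bounds R; apply: le_trans A3.
    by rewrite ler_piMl // ltW // A_gt0.
  have q : x%:R / m%:R <= (x %/ m)%:R + 1 :> R.
    by rewrite ler_pdivrMr // natr1 -natrM ler_nat ltnW // ltn_ceil //; lia.
  have : l * A * (x%:R / m%:R) <= l * A * ((x %/ m)%:R + 1).
    by rewrite ler_wpM2l // mulr_ge0 // ltW // A_gt0.
  by rewrite mulrDr; lra.
have h3 : 3 <= 3 * Num.sqrt x%:R :> R by lra.
by rewrite mulrDl; lra.
Qed.

Let mangoldt_step x s : all (fun w => 9 <= w.1)%N s ->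
  mangoldt_sum R x (fun M => cheb_step M + step_sum s M)
  = mangoldt_sum R x cheb_step + \sum_(w <- s) (if w.2 then 1 else -1)%:~R * psi (x %/ w.1).
Proof.
move=> s9; rewrite mangoldt_sumD; congr (_ + _).
rewrite /step_sum mangoldt_sum_lincomb !big_seq; apply: eq_bigr => w ws.
by rewrite psi_div //; have := allP s9 w ws; case: (w.1).
Qed.

(** Summing the step inequality against von Mangoldt's function bounds psi(x) by the Chebyshev sum
    plus signed values psi(x/m); those with sign + are bounded above and those with sign - below. *)
Lemma psi_upper_step s u ku l kl : all (fun w => 9 <= w.1)%N s ->
  (forall M, Posz (0 < M)%N <= cheb_step M + step_sum s M) ->
  0 <= u -> 0 <= l <= 1 -> 0 <= ku -> 0 <= kl ->
  psi_upper u ku -> psi_lower l kl ->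
  psi_upper (step_main s u l) (step_error s ku kl).
Proof.
move=> s9 sP u0 l01 ku0 kl0 U Lw x; have [->|x0] := posnP x.
  by rewrite psi0 sqrtr0 !mulr0 addr0.
apply: (le_trans (ler_mangoldt_sum R x _ _ sP)); rewrite mangoldt_step //.
have := cheb_sum_asymp R x x0; rewrite ler_norml => /andP[_ f_up].
have : \sum_(w <- s) (if w.2 then 1 else -1)%:~R * psi (x %/ w.1) <=
   \sum_(w <- s) ((if w.2 then u else - l) / w.1%:R * (A * x%:R)
     + (if w.2 then ku / 3 else kl / 3 + 3) * Num.sqrt x%:R).
  rewrite !big_seq; apply: ler_sum => -[m b] /(allP s9) /= m9.
  case: b => /=; first by rewrite mul1r psi_div_upper.
  rewrite mulN1r; have := psi_div_lower l kl x m x0 l01 kl0 Lw m9; lra.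
rewrite big_split -!big_distrl /= /step_main /step_error.
move: (\sum_(w <- s) ((if w.2 then u else - l) / w.1%:R))
  (\sum_(w <- s) (if w.2 then ku / 3 else kl / 3 + 3)) => a b h; rewrite !mulrDl mul1r; move: f_up h.
have -> : a * A * x%:R = a * (A * x%:R) by ring.
lra.
Qed.

Lemma psi_lower_step s u ku l kl : all (fun w => 9 <= w.1)%N s ->
  (forall M, cheb_step M + step_sum s M <= Posz (0 < M)%N) ->
  0 <= u -> 0 <= l <= 1 -> 0 <= ku -> 0 <= kl ->
  psi_upper u ku -> psi_lower l kl ->
  psi_lower (step_main s l u) (step_error [seq (w.1, ~~ w.2) | w <- s] ku kl).
Proof.
move=> s9 sP u0 l01 ku0 kl0 U Lw x; have [->|x0] := posnP x.
  by rewrite psi0 sqrtr0 !mulr0 subr0.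
apply: (le_trans _ (ler_mangoldt_sum R x _ _ sP)); rewrite mangoldt_step //.
have := cheb_sum_asymp R x x0; rewrite ler_norml => /andP[f_lo _].
have : \sum_(w <- s) ((if w.2 then l else - u) / w.1%:R * (A * x%:R)
     - (if ~~ w.2 then ku / 3 else kl / 3 + 3) * Num.sqrt x%:R) <=
   \sum_(w <- s) (if w.2 then 1 else -1)%:~R * psi (x %/ w.1).
  rewrite !big_seq; apply: ler_sum => -[m b] /(allP s9) /= m9.
  case: b => /=; first by rewrite mul1r psi_div_lower.
  rewrite mulN1r; have := psi_div_upper u ku x m u0 ku0 U m9; lra.
rewrite sumrB -!big_distrl /= /step_main /step_error big_map /=.
move: (\sum_(w <- s) ((if w.2 then l else - u) / w.1%:R))
  (\sum_(w <- s) (if ~~ w.2 then ku / 3 else kl / 3 + 3)) => a b h; rewrite !mulrDl mul1r; move: f_lo h.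
have -> : a * A * x%:R = a * (A * x%:R) by ring.
lra.
Qed.

Lemma psi_upper_weaken u k u' k' : psi_upper u k -> u <= u' -> k <= k' -> psi_upper u' k'.
Proof.
move=> U uu kk x; apply: (le_trans (U x)); rewrite lerD // ler_wpM2r ?sqrtr_ge0 //.
by rewrite ler_wpM2r // ltW // A_gt0.
Qed.

Lemma psi_lower_weaken l k l' k' : psi_lower l k -> l' <= l -> k <= k' -> psi_lower l' k'.
Proof.
move=> Lw ll kk x; apply: (le_trans _ (Lw x)); rewrite lerB // ler_wpM2r ?sqrtr_ge0 //.
by rewrite ler_wpM2r // ltW // A_gt0.
Qed.

(* The recursion psi x <= T-combination + psi (x/15) + psi (x/616) solved by
   induction: sqrt 15 and sqrt 616 exceed 3, so the error term contracts. *)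
Lemma psi_upper_init :
  (forall M, Posz (0 < M)%N <= cheb_step M + step_sum [:: (15%N, true); (616%N, true)] M) ->
  psi_upper (117 / 109) 54.
Proof.
move=> sP x; elim/ltn_ind: x => x IHx; have [->|x0] := posnP x.
  by rewrite psi0 sqrtr0 !mulr0 addr0.
apply: (le_trans (ler_mangoldt_sum R x _ _ sP)); rewrite mangoldt_step //.
have := cheb_sum_asymp R x x0; rewrite ler_norml => /andP[_ f_up].
rewrite !big_cons big_nil /= !mul1r addr0.
have H m : (9 <= m)%N ->
    psi (x %/ m) <= 117 / 109 / m%:R * (A * x%:R) + 18 * Num.sqrt x%:R.
  move=> m9; have m0 : 0 < m%:R :> R by rewrite ltr0n; lia.
  apply: (le_trans (IHx _ _)); first by rewrite ltn_Pdiv //; lia.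
  apply: lerD; last by have := sqrt_div x m m9; lra.
  have -> : 117 / 109 / m%:R * (A * x%:R) = 117 / 109 * A * (x%:R / m%:R) by ring.
  rewrite ler_wpM2l //; first by apply: mulr_ge0; [lra | rewrite ltW // A_gt0].
  by rewrite ler_pdivlMr // -natrM ler_nat leq_divM.
have := H 15%N isT; have := H 616%N isT.
have : 0 <= A * x%:R by rewrite mulr_ge0 // ltW // A_gt0.
have -> : 117 / 109 * A * x%:R = 117 / 109 * (A * x%:R) :> R by rewrite mulrA.
move: (A * x%:R) f_up => a; lra.
Qed.

End PsiBounds.

(* Binary copies of the step functions, to evaluate them over a whole period. *)
Definition Zcheb_step (z : Z) : Z :=
  Z.sub (Z.add (Z.add (Z.add z (Z.div z 6)) (Z.div z 10)) (Z.div z 2310))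
    (Z.add (Z.add (Z.add (Z.add (Z.div z 2) (Z.div z 3)) (Z.div z 5)) (Z.div z 7))
       (Z.div z 11)).

Fixpoint Zstep_sum (s : seq (Z * bool)) (z : Z) : Z :=
  if s is w :: s' then
    let acc := Zstep_sum s' z in
    if Z.leb w.1 z then if w.2 then Z.succ acc else Z.pred acc else acc
  else Z0.

Fixpoint all_below (t : Z -> bool) (n : nat) (z : Z) : bool :=
  if n is n'.+1 then t z && all_below t n' (Z.succ z) else true.

Definition binary_steps (s : seq (nat * bool)) : seq (Z * bool) :=
  [seq (Z.of_nat w.1, w.2) | w <- s].

Lemma all_belowP t n z : all_below t n z -> forall i, (i < n)%N -> t (Z.add z (Z.of_nat i)).
Proof.
elim: n z => // n IHn z /= /andP[tz /IHn H] [|i] i_n; first by rewrite Z.add_0_r.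
by have := H i i_n; congr (is_true (t _)); lia.
Qed.

Lemma Z_of_nat_div M d z : z = Z.of_nat d ->
  Z.of_nat (M %/ d)%N = Z.div (Z.of_nat M) z.
Proof.
move=> ->; case: d => [|d]; first by rewrite divn0; case: M.
have h := divn_eq M d.+1; have h2 := ltn_pmod M (isT : 0 < d.+1)%N.
apply: (Z.div_unique _ _ _ (Z.of_nat (M %% d.+1))); nia.
Qed.

Lemma cheb_stepE M : Z_of_int (cheb_step M) = Zcheb_step (Z.of_nat M).
Proof.
rewrite /cheb_step /cheb_weights !big_cons big_nil /Zcheb_step divn1.
rewrite -(Z_of_nat_div M 2 (Zpos 2)) // -(Z_of_nat_div M 3 (Zpos 3)) //.
rewrite -(Z_of_nat_div M 5 (Zpos 5)) // -(Z_of_nat_div M 7 (Zpos 7)) //.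
rewrite -(Z_of_nat_div M 11 (Zpos 11)) // -(Z_of_nat_div M 6 (Zpos 6)) //.
rewrite -(Z_of_nat_div M 10 (Zpos 10)) // -(Z_of_nat_div M 2310 (Zpos 2310)) //.
move: (M %/ 2)%N (M %/ 3)%N (M %/ 5)%N (M %/ 7)%N (M %/ 11)%N.
move: (M %/ 6)%N (M %/ 10)%N (M %/ 2310)%N => *.
by rewrite !mulN1r !mul1r addr0; lia.
Qed.

Lemma step_sumE s M : Z_of_int (step_sum s M) = Zstep_sum (binary_steps s) (Z.of_nat M).
Proof.
elim: s => [|[m b] s IHs]; first by rewrite /step_sum big_nil.
rewrite /step_sum big_cons -/(step_sum s M) /= -IHs; move: (step_sum s M) => a.
by case: b; case: leqP => h; case: Z.leb_spec => h'; lia.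
Qed.

Lemma cheb_step_period M : cheb_step (M + 2310) = cheb_step M.
Proof.
have E : \sum_(w <- cheb_weights) w.2 * Posz (2310 %/ w.1)%N = 0.
  by rewrite /cheb_weights !big_cons big_nil.
rewrite -[RHS]addr0 -E -big_split /cheb_step !big_seq; apply: eq_bigr => w wI /=.
rewrite divnDr ?PoszD ?mulrDr //.
by have /allP/(_ _ wI) : all (fun w => w.1 %| 2310)%N cheb_weights by [].
Qed.

Lemma cheb_step_mod M : cheb_step M = cheb_step (M %% 2310).
Proof.
rewrite {1}(divn_eq M 2310) addnC; elim: (M %/ 2310)%N => [|k IHk]; first by rewrite mul0n addn0.
by rewrite mulSn addnCA addnC cheb_step_period.
Qed.

Lemma step_sum_final s M : all (fun w => w.1 <= 2310)%N s -> (2310 <= M)%N ->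
  step_sum s M = step_sum s 2310.
Proof.
move=> s_le hM; rewrite /step_sum !big_seq; apply: eq_bigr => w /(allP s_le) w_le.
by rewrite (leq_trans w_le hM) w_le.
Qed.

Lemma cheb_step0 : cheb_step 0 = 0.
Proof. by rewrite /cheb_step big1 // => w _; rewrite div0n mulr0. Qed.

Lemma step_sum0 s : all (fun w => 9 <= w.1)%N s -> step_sum s 0 = 0.
Proof.
by move=> s9; rewrite /step_sum big_seq big1 // => -[[|m] b] /(allP s9) //= _; rewrite mulr0.
Qed.

(** [cheb_step] has period 2310 and the corrections are constant from 2310 on, so one period
    suffices: once with the final correction, for M >= 2310, and once with the actual one, for 0 < M
    < 2310. *)
Definition step_test (rel : Z -> bool) (zs : seq (Z * bool)) : bool :=
  let fin := Zstep_sum zs (Z.of_nat 2310) in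
  all_below (fun z => rel (Z.add (Zcheb_step z) fin) &&
    (Z.eqb z Z0 || rel (Z.add (Zcheb_step z) (Zstep_sum zs z)))) 2310 Z0.

Lemma step_testP rel s M : all (fun w => 9 <= w.1 <= 2310)%N s ->
  step_test rel (binary_steps s) -> (0 < M)%N ->
  rel (Z_of_int (cheb_step M + step_sum s M)).
Proof.
move=> s_all /all_belowP H M0.
have -> : Z_of_int (cheb_step M + step_sum s M) = Z.add (Z_of_int (cheb_step M)) (Z_of_int (step_sum s M)).
  by lia.
have [M1|M1] := ltnP M 2310.
  have /andP[_ /orP[|]] := H M M1; first by move/Z.eqb_spec; lia.
  by rewrite Z.add_0_l -cheb_stepE -step_sumE.
rewrite step_sum_final //; last by apply: sub_all s_all => w /andP[].
have /andP[+ _] := H (M %% 2310)%N (ltn_pmod M (isT : 0 < 2310)%N).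
by rewrite Z.add_0_l -cheb_stepE -cheb_step_mod step_sumE.
Qed.

Lemma upper_steps s : all (fun w => 9 <= w.1 <= 2310)%N s ->
  step_test (Z.leb 1) (binary_steps s) ->
  forall M, Posz (0 < M)%N <= cheb_step M + step_sum s M.
Proof.
move=> s_all t M; have [->|M0] := posnP M.
  by rewrite cheb_step0 step_sum0 //; apply: sub_all s_all => w /andP[].
by have := step_testP _ s M s_all t M0; move/Z.leb_spec0; lia.
Qed.

Lemma lower_steps s : all (fun w => 9 <= w.1 <= 2310)%N s ->
  step_test (Z.geb 1) (binary_steps s) ->
  forall M, cheb_step M + step_sum s M <= Posz (0 < M)%N.
Proof.
move=> s_all t M; have [->|M0] := posnP M.
  by rewrite cheb_step0 step_sum0 //; apply: sub_all s_all => w /andP[].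
by have := step_testP _ s M s_all t M0; rewrite Z.geb_leb; move/Z.leb_spec0; lia.
Qed.

(* Corrections keeping cheb_step + step_sum at least 1, respectively at most 1,
   chosen by dynamic programming to optimize the resulting constants. *)
Definition upper_path : seq (nat * bool) :=
  [:: (15%N, true); (17%N, false); (22%N, true); (23%N, false); (28%N, true);
      (29%N, false); (35%N, true); (37%N, false); (45%N, true); (47%N, false);
      (56%N, true); (59%N, false); (66%N, true); (79%N, false); (88%N, true);
      (89%N, false); (99%N, true); (113%N, false); (126%N, true); (616%N, true);
      (617%N, false); (800%N, true)].

Definition lower_path : seq (nat * bool) :=
  [:: (13%N, false); (14%N, true); (15%N, true); (17%N, false); (19%N, false);
      (21%N, true); (31%N, false); (33%N, true); (41%N, false); (44%N, true);
      (53%N, false); (55%N, true); (61%N, false); (63%N, true); (73%N, false);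
      (84%N, true); (97%N, false); (110%N, true); (131%N, false); (195%N, true);
      (223%N, false); (315%N, true); (349%N, false)].

Lemma upper_pathP M : Posz (0 < M)%N <= cheb_step M + step_sum upper_path M.
Proof. by apply: upper_steps; [|vm_compute]. Qed.

Lemma lower_pathP M : cheb_step M + step_sum lower_path M <= Posz (0 < M)%N.
Proof. by apply: lower_steps; [|vm_compute]. Qed.

Section Iteration.
Variable R : realType.

(** 117/109 lies just above the solution of u = 1 + u/15 + u/616, and 54 solves k = 18 + 2k/3. *)
Lemma psi_upper0 : psi_upper R (117 / 109) 54.
Proof. by apply: psi_upper_init; apply: upper_steps; [|vm_compute]. Qed.

(** As 117 = 9 * 13, the value 1 - (117/109)/13 is exactly 100/109; and 36 = 18 + 54/3. *)
Lemma psi_lower0 : psi_lower R (100 / 109) 36.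
Proof.
have P M : cheb_step M + step_sum [:: (13%N, false)] M <= Posz (0 < M)%N.
  by apply: lower_steps; [|vm_compute].
have triv : psi_lower R 0 0.
  by move=> x; rewrite !mul0r subrr psi_ge0.
have := psi_lower_step R [:: (13%N, false)] _ _ _ _ isT P _ _ _ _ psi_upper0 triv.
rewrite /step_main /step_error /= !big_cons !big_nil /= => H.
apply: psi_lower_weaken (H _ _ _ _) _ _; lra.
Qed.

Lemma psi_upper_iter u ku l kl u' k' : 0 <= u -> 0 <= l <= 1 -> 0 <= ku -> 0 <= kl ->
  psi_upper R u ku -> psi_lower R l kl ->
  step_main R upper_path u l <= u' -> step_error R upper_path ku kl <= k' ->
  psi_upper R u' k'.
Proof.
move=> u0 l0 ku0 kl0 U Lw; apply: psi_upper_weaken.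
by apply: psi_upper_step => //; apply: upper_pathP.
Qed.

Lemma psi_lower_iter u ku l kl l' k' : 0 <= u -> 0 <= l <= 1 -> 0 <= ku -> 0 <= kl ->
  psi_upper R u ku -> psi_lower R l kl ->
  l' <= step_main R lower_path l u ->
  step_error R [seq (w.1, ~~ w.2) | w <- lower_path] ku kl <= k' ->
  psi_lower R l' k'.
Proof.
move=> u0 l0 ku0 kl0 U Lw; apply: psi_lower_weaken.
by apply: psi_lower_step => //; apply: lower_pathP.
Qed.

(** From here lower and upper bounds improve alternately along the long paths, every constant being
    rounded outward from [step_main] and [step_error]. The final ratio (248/235)/(89/94) = 496/445
    is below 19/17. *)
Lemma psi_lower1 : psi_lower R (57 / 61) 400.
Proof.
apply: (psi_lower_iter _ _ _ _ _ _ _ _ _ _ psi_upper0 psi_lower0);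
  rewrite /step_main /step_error /upper_path /lower_path /= ?big_cons ?big_nil /=; lra.
Qed.

Lemma psi_upper1 : psi_upper R (17 / 16) 1600.
Proof.
apply: (psi_upper_iter _ _ _ _ _ _ _ _ _ _ psi_upper0 psi_lower1);
  rewrite /step_main /step_error /upper_path /lower_path /= ?big_cons ?big_nil /=; lra.
Qed.

Lemma psi_lower2 : psi_lower R (33 / 35) (80 * 100).
Proof.
apply: (psi_lower_iter _ _ _ _ _ _ _ _ _ _ psi_upper1 psi_lower1);
  rewrite /step_main /step_error /upper_path /lower_path /= ?big_cons ?big_nil /=; lra.
Qed.

Lemma psi_upper2 : psi_upper R (55 / 52) (340 * 100).
Proof.
apply: (psi_upper_iter _ _ _ _ _ _ _ _ _ _ psi_upper1 psi_lower2);
  rewrite /step_main /step_error /upper_path /lower_path /= ?big_cons ?big_nil /=; lra.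
Qed.

Lemma psi_lower3 : psi_lower R (89 / 94) (170 * 1000).
Proof.
apply: (psi_lower_iter _ _ _ _ _ _ _ _ _ _ psi_upper2 psi_lower2);
  rewrite /step_main /step_error /upper_path /lower_path /= ?big_cons ?big_nil /=; lra.
Qed.

Lemma psi_upper3 : psi_upper R (248 / 235) (710 * 1000).
Proof.
apply: (psi_upper_iter _ _ _ _ _ _ _ _ _ _ psi_upper2 psi_lower3);
  rewrite /step_main /step_error /upper_path /lower_path /= ?big_cons ?big_nil /=; lra.
Qed.

End Iteration.

(** * Primes between x and 19x/17 *)

Lemma nat_sqrt y : exists s : nat, (s ^ 2 <= y < s.+1 ^ 2)%N.
Proof.
elim: y => [|y [s /andP[h1 h2]]]; first by exists 0%N.
have [h|h] := ltnP y.+1 (s.+1 ^ 2); first by exists s; rewrite h leqW.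
by exists s.+1; rewrite h /=; apply: leq_ltn_trans h2 _; rewrite ltn_sqr.
Qed.

Section ShortIntervals.
Variable R : realType.
Local Notation psi := (psi R).

(** Without primes in (x, y], only powers p^k with k >= 2, hence p <= s, contribute to psi(y) -
    psi(x). As y <= 2x, each p has at most one power there, so the total is at most the sum of ln p
    over p <= s. *)
Lemma psi_no_primes x y s : (x <= y <= 2 * x)%N -> (y < s.+1 ^ 2)%N -> (s <= y)%N ->
  (forall p, prime p -> ~~ (x < p <= y)%N) ->
  psi y <= psi x + psi s.
Proof.
move=> /andP[xy y2x] ys sy no.
rewrite -lerBlDl {2}/psi (mangoldt_sum_widen R x y) // {1}/psi /mangoldt_sum -sumrB.
rewrite /psi (mangoldt_sum_widen R s y) //.
apply: ler_sum => p pr; rewrite -sumrB.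
have lp := ln_prime_ge0 R p pr; have p1 := prime_gt1 pr.
have E : \sum_(1 <= k < y.+1) (ln p%:R * (Posz (0 < y %/ p ^ k)%N)%:~R
     - ln p%:R * (Posz (0 < x %/ p ^ k)%N)%:~R)
   = ln p%:R * \sum_(1 <= k < y.+1) ((x < p ^ k <= y)%N)%:R :> R.
  rewrite big_distrr /=; apply: eq_bigr => k _; rewrite -mulrBr; congr (_ * _).
  have pk : (0 < p ^ k)%N by rewrite expn_gt0 ltnW.
  rewrite !divn_gt0 //; case: (leqP (p ^ k) x) => h1; case: (leqP (p ^ k) y) => h2 /=.
  - by rewrite subrr.
  - by have := leq_trans h1 xy; rewrite leqNgt h2.
  - by rewrite subr0.
  - by rewrite subr0.
rewrite E -big_distrr /=; apply: ler_wpM2l => //.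
have [sp|ps] := ltnP s p.
  rewrite big_nat big1 => [|k /andP[k1 _]].
    by apply: sumr_ge0 => k _; rewrite ler0z.
  case: (ltnP 1 k) => k2.
    have : (y < p ^ k)%N.
      apply: leq_trans ys _; apply: (@leq_trans (p ^ 2)); first by rewrite leq_sqr.
      by rewrite leq_exp2l.
    by rewrite ltnNge => /negPf->; rewrite andbF.
  have -> : k = 1%N by lia.
  by rewrite expn1 (negPf (no p pr)).
have [y0|y0] := posnP y; first by move: ps p1; lia.
have one : \sum_(1 <= k < y.+1) ((x < p ^ k <= y)%N)%:R <= 1 :> R.
  have uniq_k k j : (x < p ^ k <= y)%N -> (x < p ^ j <= y)%N -> (k <= j)%N.
    move=> /andP[xk ky] /andP[xj jy]; rewrite leqNgt; apply/negP => jk.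
    have : (p ^ j.+1 <= p ^ k)%N by rewrite leq_exp2l.
    rewrite expnS => h; have : (2 * p ^ j <= p * p ^ j)%N by rewrite leq_mul2r p1 orbT.
    move: h ky xj y2x; clear; lia.
  have [/hasP[k0 k0I hk0]|/hasPn none] :=
      boolP (has (fun k => x < p ^ k <= y)%N (index_iota 1 y.+1)).
    rewrite (bigD1_seq k0) ?iota_uniq //= hk0 big1 ?addr0 // => k kk0.
    case hk: (x < p ^ k <= y)%N => //; have := uniq_k _ _ hk hk0; have := uniq_k _ _ hk0 hk.
    by move=> h1 h2; move: kk0; rewrite eqn_leq h1 h2.
  by rewrite big_seq big1 // => k kI; rewrite (negPf (none k kI)).
apply: (le_trans one); rewrite big_ltn; last by rewrite ltnS.
have -> : (0 < s %/ p ^ 1)%N by rewrite expn1 divn_gt0 // ltnW.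
by rewrite lerDl; apply: sumr_ge0 => k _; rewrite ler0z.
Qed.

Lemma billion_le : 1000 * 1000 * 1000 <= 2 ^+ 30 :> R.
Proof.
have h : 1000 <= 2 ^+ 10 :> R by rewrite -natrX ler_nat.
have h2 : 1000 * 1000 <= 2 ^+ 10 * 2 ^+ 10 :> R by apply: ler_pM.
have h3 : 1000 * 1000 * 1000 <= 2 ^+ 10 * 2 ^+ 10 * 2 ^+ 10 :> R.
  by apply: ler_pM => //; apply: mulr_ge0.
by rewrite -!exprD in h3.
Qed.

(** With r = sqrt x, the main terms leave a margin of about 0.0014 r^2, using A >= 1/2, while the
    square-root errors add up to less than 10^6 r. So r >= 2^30 > 10^9 decides. *)
Lemma prime_in_short_interval_large x : 2 ^+ 60 <= x%:R :> R ->
  exists2 p, prime p & (x < p <= (19 * x) %/ 17)%N.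
Proof.
move=> x_large; apply: contrapT => none.
pose y := ((19 * x) %/ 17)%N.
have no p : prime p -> ~~ (x < p <= y)%N.
  by move=> pr; apply/negP => h; apply: none; exists p.
have y_le : (17 * y <= 19 * x)%N by rewrite /y; clear; lia.
have y_ge : (19 * x <= 17 * y + 17)%N by rewrite /y; clear; lia.
have [s /andP[sy ys]] := nat_sqrt y.
have x1 : (0 < x)%N.
  by rewrite lt0n; apply/eqP => x0; move: x_large; rewrite x0 leNgt exprn_gt0.
have xy : (x <= y <= 2 * x)%N by rewrite /y; clear -x1; lia.
have s_y : (s <= y)%N by apply: leq_trans sy; case: (s) => // n; rewrite leq_pmull.
have key := psi_no_primes x y s xy ys s_y no.
have up_x := psi_upper3 R x; have up_s := psi_upper0 R s; have lo_y := psi_lower3 R y.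
have /andP[A1 A2] := cheb_const_bounds R.
set r := Num.sqrt (x%:R : R) in up_x.
have r0 : 0 <= r by apply: sqrtr_ge0.
have Er : x%:R = r ^+ 2 by rewrite sqr_sqrtr.
have r_large : 2 ^+ 30 <= r.
  rewrite -(@ler_pXn2r _ 2) ?nnegrE ?exprn_ge0 // -Er -exprM //.
have yx : y%:R <= 19 / 17 * r ^+ 2 :> R.
  by move: y_le; rewrite -Er -(ler_nat R) !natrM; clear; lra.
have xy' : 19 / 17 * r ^+ 2 - 1 <= y%:R :> R.
  by move: y_ge; rewrite -Er -(ler_nat R) natrD !natrM; clear; lra.
have ry : Num.sqrt (y%:R : R) <= 11 / 10 * r.
  rewrite -[leRHS]ger0_norm; last by apply: mulr_ge0 => //; clear; lra.
  rewrite -sqrtr_sqr ler_sqrt ?sqr_ge0 //; apply: le_trans yx _.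
  by rewrite exprMn; move: (sqr_ge0 r); clear; move: (r ^+ 2) => t; lra.
have sr : s%:R <= 11 / 10 * r :> R.
  apply: le_trans ry; rewrite -[leLHS]ger0_norm // -sqrtr_sqr ler_sqrt // -natrX ler_nat //.
have r_large' : 1000 * 1000 * 1000 <= r.
  exact: le_trans billion_le r_large.
clear x_large r_large y_le y_ge no none.
have := ler_wpM2r r0 r_large'; rewrite -[r * r]/(r ^+ 2).
move: (r ^+ 2) Er yx xy' => r2 Er yx xy' hr.
have ss : Num.sqrt (s%:R : R) <= s%:R.
  rewrite -[leRHS]ger0_norm // -sqrtr_sqr ler_sqrt ?sqr_ge0 // -natrX ler_nat.
  by case: (s) => // n; rewrite leq_pmull.
move: A1 A2 up_x up_s lo_y; rewrite Er; set A := cheb_const R => A1 A2 up_x up_s lo_y.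
have A0 : 0 <= A by lra.
have As : A * s%:R <= 3 * (11 / 10 * r) by apply: ler_pM.
have Ay : A * (19 / 17 * r2 - 1) <= A * y%:R by apply: ler_wpM2l.
pose e := 89 / 94 * (19 / 17 * r2 - 1) - 248 / 235 * r2.
have e_ge : 28 / 10000 * r2 - 1 <= e by rewrite /e; clear -hr r_large' r0; lra.
have Ae : 1 / 2 * e <= A * e by apply: ler_wpM2r => //; clear -e_ge hr r_large' r0; lra.
have Eu : 89 / 94 * A * y%:R = 89 / 94 * (A * y%:R) by rewrite mulrA.
have Ex : 248 / 235 * A * r2 = 248 / 235 * (A * r2) by rewrite mulrA.
have Es : 117 / 109 * A * s%:R = 117 / 109 * (A * s%:R) by rewrite mulrA.
have Ee : A * e = 89 / 94 * (A * (19 / 17 * r2 - 1)) - 248 / 235 * (A * r2).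
  by rewrite /e mulrBr mulrCA [A * (_ * r2)]mulrCA.
move: up_x up_s lo_y key Ae; rewrite Eu Ex Es Ee.
move: (A * (_ - 1)) (A * r2) (A * y%:R) (A * s%:R) As Ay => b1 b2 b3 b4 As Ay.
move: (psi x) (psi y) (psi s) => p1 p2 p3.
move: (Num.sqrt s%:R) (Num.sqrt y%:R) ss ry => q1 q2 ss ry.
clear -As Ay sr ss ry e_ge hr r_large' r0.
lra.
Qed.

End ShortIntervals.

(** * Prime certificates *)

Local Close Scope ring_scope.

(* Proth: modulo any prime factor r of n, the class of a ^ m has order 2 ^ k, so
   that 2 ^ k divides r - 1 and n < r ^ 2. *)
Lemma proth_prime n m k a : n.-1 = m * 2 ^ k.+1 -> 0 < m < 2 ^ k.+1 ->
  a ^ (m * 2 ^ k) = n.-1 %[mod n] -> prime n.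
Proof.
move=> En /andP[m0 mk] an.
have n1 : 1 < n by rewrite -subn_gt0 subn1 En muln_gt0 m0 expn_gt0.
have := pdiv_prime n1; have := pdiv_dvd n; have := @ltn_pdiv2_prime n (ltnW n1).
move: (pdiv n) => r n_pr rn r_pr.
have r1 := prime_gt1 r_pr.
have odd_n : odd n by rewrite -(prednK (ltnW n1)) En /= oddM oddX andbF.
have r2 : 2 < r.
  rewrite ltn_neqAle r1 andbT; apply/eqP => r2.
  by move: rn; rewrite -r2 dvdn2 odd_n.
have {}an : (a ^ m) ^ (2 ^ k) = r.-1 %[mod r].
  rewrite -expnM -(modn_dvdm _ rn) an modn_dvdm //; apply/eqP.
  rewrite -(eqn_modDr 1) !addn1 !prednK ?(ltnW r1) ?(ltnW n1) //.
  by rewrite modnn -/(r %| n).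
have co : coprime r (a ^ m).
  have : coprime r ((a ^ m) ^ (2 ^ k)).
    by rewrite coprime_sym -coprime_modl an coprime_modl coprimePn // ltnW.
  by rewrite coprime_pexpr // expn_gt0.
have uam : ((a ^ m)%:R : 'Z_r)%R \is a GRing.unit by rewrite unitZpE.
pose u : {unit 'Z_r} := FinRing.unit _ uam.
have uX j : (u ^+ j == 1)%g = ((a ^ m) ^ j == 1 %[mod r]).
  rewrite -val_eqE /= FinRing.val_unitX /= -natrX -[1%R in LHS]/(1%:R)%R -val_eqE.
  by rewrite [val _]val_Zp_nat // [val _]val_Zp_nat.
have u_neq : (u ^+ (2 ^ k) != 1)%g.
  by rewrite uX an !modn_small ?(ltnW r2) //; lia.
have u_dvd : #[u]%g %| 2 ^ k.+1.
  rewrite order_dvdn uX expnSr expnM -modnXm an modnXm -(eqn_modDr (r.-1 * 2)).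
  have -> : r.-1 ^ 2 + r.-1 * 2 = r * r.-1 + r.-1 by clear -r1; nia.
  have -> : 1 + r.-1 * 2 = r + r.-1 by lia.
  by rewrite mulnC modnMDl modnDl.
(* The order divides 2^(k+1) but not 2^k. *)
have ou : #[u]%g = 2 ^ k.+1.
  have /(dvdn_pfactor _ _ (isT : prime 2))[j jk oj] := u_dvd.
  rewrite oj; congr (_ ^ _); apply/eqP; rewrite eqn_leq jk ltnNge; apply: contra u_neq.
  by rewrite -order_dvdn oj => jk'; rewrite dvdn_exp2l.
have k_r : 2 ^ k.+1 <= r.-1.
  have : #[u]%g %| #|units_Zp r| by apply: order_dvdG; rewrite in_setT.
  rewrite card_units_Zp ?totient_prime ?(ltnW r1) // ou; apply: dvdn_leq.
  by lia.
apply: n_pr; rewrite -(prednK (ltnW n1)) En -mulnn.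
by clear -k_r mk; nia.
Qed.

Fixpoint powmod (a : N) (e : positive) (m : N) : N :=
  match e with
  | xH => N.modulo a m
  | xO e' => let r := powmod a e' m in N.modulo (N.mul r r) m
  | xI e' => let r := powmod a e' m in N.modulo (N.mul (N.modulo (N.mul r r) m) a) m
  end.

Definition powmodN (a e m : N) : N :=
  if e is Npos e' then powmod a e' m else N.modulo 1%num m.

Lemma to_nat_mod a m : m <> N0 -> N.to_nat (N.modulo a m) = N.to_nat a %% N.to_nat m.
Proof.
move=> m0; have E := N.div_mod' a m; have L := N.mod_lt a m m0.
have -> : N.to_nat a = N.to_nat (N.div a m) * N.to_nat m + N.to_nat (N.modulo a m).
  by rewrite {1}E; lia.
by rewrite modnMDl modn_small //; lia.
Qed.

Lemma powmodE a e m : m <> N0 ->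
  N.to_nat (powmod a e m) = N.to_nat a ^ Pos.to_nat e %% N.to_nat m.
Proof.
move=> m0; elim: e => [e IHe|e IHe|] /=; rewrite ?to_nat_mod // !N2Nat.inj_mul ?to_nat_mod //.
- rewrite N2Nat.inj_mul IHe modnMm modnMml Pos2Nat.inj_xI; congr (_ %% _).
  have -> : (2 * Pos.to_nat e)%coq_nat.+1 = Pos.to_nat e + Pos.to_nat e + 1 by lia.
  by rewrite !expnD expn1.
- rewrite IHe modnMm Pos2Nat.inj_xO; congr (_ %% _).
  have -> : (2 * Pos.to_nat e)%coq_nat = Pos.to_nat e + Pos.to_nat e by lia.
  by rewrite expnD.
Qed.

Lemma powmodNE a e m : m <> N0 ->
  N.to_nat (powmodN a e m) = N.to_nat a ^ N.to_nat e %% N.to_nat m.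
Proof. by move=> m0; case: e => [|e] /=; [rewrite to_nat_mod | rewrite powmodE]. Qed.

Definition proth_value (c : N * N * N) : N :=
  let: (_, m, k) := c in N.succ (N.mul 2 (N.mul m (N.pow 2 k))).

(* (a, m, k) certifies m * 2 ^ (k + 1) + 1. *)
Definition proth_ok (c : N * N * N) : bool :=
  let: (a, m, k) := c in
  let h := N.mul m (N.pow 2 k) in
  let p := N.succ (N.mul 2 h) in
  [&& N.ltb 0 m, N.ltb m (N.pow 2 (N.succ k)) & N.eqb (powmodN a h p) (N.pred p)].

Lemma to_nat_pow2 k : N.to_nat (N.pow 2 k) = 2 ^ N.to_nat k.
Proof.
elim/N.peano_ind: k => [|k IHk] //.
by rewrite N.pow_succ_r' N2Nat.inj_mul IHk N2Nat.inj_succ expnS.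
Qed.

Lemma proth_ok_prime c : proth_ok c -> prime (N.to_nat (proth_value c)).
Proof.
case: c => [[a m] k] /and3P[/N.ltb_spec0 m0 /N.ltb_spec0 mk /N.eqb_spec am].
have Eh : N.to_nat (N.mul m (N.pow 2 k)) = N.to_nat m * 2 ^ N.to_nat k.
  by rewrite N2Nat.inj_mul to_nat_pow2.
apply: (proth_prime _ (N.to_nat m) (N.to_nat k) (N.to_nat a)).
  by rewrite N2Nat.inj_succ N2Nat.inj_mul Eh expnS mulnCA.
  rewrite -[(N.to_nat k).+1]N2Nat.inj_succ -to_nat_pow2.
  by clear -m0 mk; lia.
have p0 : N.succ (N.mul 2 (N.mul m (N.pow 2 k))) <> N0 by lia.
rewrite -Eh -(powmodNE a _ _ p0) am N.pred_succ N2Nat.inj_succ.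
by rewrite modn_small.
Qed.

Definition trial_ok (n : N) : bool :=
  N.ltb 1 n && all (fun d => ~~ N.eqb (N.modulo n (N.of_nat d)) 0)
                   (iota 2 (N.to_nat (N.sqrt n)).-1).

Lemma trial_ok_prime n : trial_ok n -> prime (N.to_nat n).
Proof.
case/andP => /N.ltb_spec0 n1 /allP no_div.
have {}n1 : 1 < N.to_nat n by clear -n1; lia.
apply: ltn_pdiv2_prime; first exact: ltnW.
set r := pdiv _; have r1 : 1 < r := prime_gt1 (pdiv_prime n1).
have [_ n_lt] := N.sqrt_spec' n.
rewrite ltnNge; apply/negP => rn.
have /no_div/N.eqb_spec[] : r \in iota 2 (N.to_nat (N.sqrt n)).-1.
  by rewrite mem_iota r1 /=; clear -rn n_lt r1; rewrite -mulnn in rn; nia.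
apply: N2Nat.inj; rewrite to_nat_mod; last by clear -r1; lia.
by rewrite Nat2N.id; apply/eqP; apply: pdiv_dvd.
Qed.

Definition ratio_ok (p q : N) : bool := N.leb (4 * (q * q)) (5 * (p * p)).

Lemma prime_in_chain prev l x : all (fun p => prime (N.to_nat p)) l ->
  path ratio_ok prev l -> N.to_nat prev <= x < N.to_nat (last prev l) ->
  exists2 p, prime p & (x < p) && (4 * p ^ 2 <= 5 * x ^ 2).
Proof.
elim: l prev => [|q l IHl] prev /=; first by move=> _ _; lia.
case/andP => pr lp /andP[le ok] /andP[px xl].
have [xq|qx] := ltnP x (N.to_nat q); last by apply: IHl lp ok _; rewrite qx.
exists (N.to_nat q) => //; rewrite xq /=.
apply: (@leq_trans (5 * N.to_nat prev ^ 2)); last by rewrite leq_mul2l leq_sqr px orbT.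
move/N.leb_spec0: le => le.
have : N.to_nat (4 * (q * q)) <= N.to_nat (5 * (prev * prev)) by clear -le; lia.
by rewrite !N2Nat.inj_mul -!mulnn; clear; lia.
Qed.

Lemma certified_primes l c : all trial_ok l -> all proth_ok c ->
  all (fun p => prime (N.to_nat p)) (l ++ map proth_value c).
Proof.
move=> l_ok c_ok; rewrite all_cat (sub_all trial_ok_prime) //= all_map.
exact: sub_all proth_ok_prime _ c_ok.
Qed.

Definition small_primes : seq N := [::
  127; 139; 151; 167; 181; 199; 211; 233; 257; 283; 313; 349; 389; 433; 479; 523; 577;
  643; 709; 787; 877; 977; 1091; 1217; 1327; 1483; 1657; 1847; 2063; 2297; 2557; 2857;
  3191; 3559; 3967; 4423; 4943; 5521; 6163; 6883; 7691; 8597; 9601; 10733; 11987;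
  13399; 14969; 16729; 18701; 20903; 23369; 26119; 29201; 32647; 36497; 40801]%num.

(* Proth primes, the first of which follows 40801. *)
Definition proth_certificates : seq (N * N * N) := [::
  (3, 178, 7); (3, 196, 7); (3, 202, 7); (7, 225, 7); (11, 240, 7); (3, 131, 8);
  (5, 138, 8); (11, 150, 8); (7, 165, 8); (5, 171, 8); (11, 189, 8); (5, 201, 8);
  (3, 224, 8); (3, 245, 8); (7, 270, 8); (3, 299, 8); (5, 333, 8); (3, 368, 8);
  (5, 396, 8); (3, 431, 8); (7, 474, 8); (5, 264, 9); (5, 294, 9); (5, 324, 9);
  (3, 358, 9); (3, 385, 9); (13, 420, 9); (13, 462, 9); (5, 513, 9); (5, 564, 9);
  (3, 628, 9); (5, 699, 9); (3, 778, 9); (3, 859, 9); (37, 957, 9); (5, 534, 10);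
  (7, 591, 10); (5, 657, 10); (3, 734, 10); (3, 815, 10); (3, 911, 10); (3, 1004, 10);
  (5, 1122, 10); (3, 1247, 10); (3, 1385, 10); (3, 1547, 10); (5, 1722, 10);
  (3, 1925, 10); (3, 1066, 11); (7, 1188, 11); (5, 1326, 11); (5, 1467, 11);
  (5, 1632, 11); (3, 1822, 11); (5, 2031, 11); (3, 2251, 11); (5, 2496, 11);
  (3, 2776, 11); (3, 3097, 11); (3, 3460, 11); (3, 3865, 11); (11, 2139, 12);
  (3, 2384, 12); (3, 2654, 12); (3, 2954, 12); (3, 3299, 12); (3, 3686, 12);
  (3, 4115, 12); (19, 4590, 12); (3, 5129, 12); (5, 5733, 12); (3, 6404, 12);
  (7, 7155, 12); (3, 7991, 12); (5, 4458, 13); (7, 4980, 13); (11, 5565, 13);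
  (3, 6220, 13); (5, 6948, 13); (3, 7762, 13); (3, 8677, 13); (3, 9685, 13);
  (5, 10824, 13); (7, 12090, 13); (5, 13509, 13); (7, 15102, 13); (11, 8436, 14);
  (3, 9404, 14); (3, 10511, 14); (7, 11730, 14); (5, 13104, 14); (3, 14630, 14);
  (3, 16355, 14); (3, 18281, 14); (3, 20435, 14); (3, 22844, 14); (5, 25524, 14);
  (11, 28500, 14); (3, 31859, 14); (3, 17806, 15); (5, 19896, 15); (3, 22231, 15);
  (3, 24850, 15); (5, 27762, 15); (3, 31036, 15); (3, 34693, 15); (3, 38782, 15);
  (5, 43341, 15); (3, 48448, 15); (3, 54160, 15); (3, 60538, 15); (5, 33831, 16);
  (3, 37823, 16); (3, 42260, 16); (3, 47243, 16); (7, 52809, 16); (3, 59030, 16);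
  (3, 65984, 16); (3, 73763, 16); (7, 82464, 16); (5, 92178, 16); (3, 103043, 16);
  (3, 115154, 16); (3, 128738, 16); (5, 71964, 17); (3, 80455, 17); (3, 89944, 17);
  (7, 100557, 17); (3, 112420, 17); (3, 125689, 17); (3, 140512, 17); (7, 157092, 17);
  (3, 175627, 17); (3, 196339, 17); (5, 219504, 17); (3, 245410, 17); (3, 137171, 18);
  (3, 153350, 18); (7, 171450, 18); (7, 191676, 18); (13, 214296, 18); (3, 239576, 18);
  (3, 267845, 18); (7, 299445, 18); (5, 334782, 18); (3, 374285, 18); (7, 418455, 18);
  (7, 467826, 18); (3, 523034, 18); (3, 292366, 19); (3, 326857, 19); (3, 365431, 19);
  (3, 408547, 19); (13, 456750, 19); (3, 510661, 19); (5, 570906, 19); (3, 638242, 19);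
  (3, 713566, 19); (3, 797791, 19); (5, 891942, 19); (7, 997200, 19); (5, 557436, 20);
  (3, 623213, 20); (5, 696768, 20); (3, 779006, 20); (3, 870938, 20); (3, 973733, 20);
  (3, 1088666, 20); (5, 1217121, 20); (3, 1360781, 20); (3, 1521383, 20);
  (7, 1700934, 20); (3, 1901678, 20); (7, 1063050, 21); (3, 1188523, 21);
  (7, 1328790, 21); (7, 1485570, 21); (3, 1660903, 21); (3, 1856944, 21);
  (5, 2076123, 21); (3, 2321164, 21); (3, 2595133, 21); (5, 2901393, 21);
  (7, 3243855, 21); (3, 3626704, 21); (5, 4054764, 21); (7, 2266680, 22);
  (3, 2534207, 22); (3, 2833256, 22); (11, 3167661, 22); (3, 3541511, 22);
  (3, 3959522, 22); (3, 4426859, 22); (3, 4949375, 22); (3, 5533559, 22);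
  (3, 6186707, 22); (5, 6916944, 22); (11, 7733376, 22); (3, 4323076, 23);
  (3, 4833340, 23); (5, 5403822, 23); (7, 6041655, 23); (3, 6754771, 23);
  (7, 7552038, 23); (11, 8443410, 23); (5, 9440016, 23); (3, 10554250, 23);
  (3, 11800003, 23); (11, 13192788, 23); (13, 14749983, 23); (5, 16490976, 23);
  (3, 9218714, 24); (7, 10306815, 24); (7, 11523360, 24); (7, 12883464, 24);
  (3, 14404088, 24); (7, 16104255, 24); (5, 18005091, 24); (3, 20130296, 24);
  (3, 22506338, 24); (3, 25162850, 24); (3, 28132910, 24); (7, 31453494, 24);
  (3, 17583037, 25); (3, 19658422, 25); (7, 21978762, 25); (3, 24572992, 25);
  (5, 27473433, 25); (5, 30716223, 25); (3, 34341745, 25); (3, 38395237, 25);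
  (3, 42927178, 25); (5, 47994009, 25); (7, 53658900, 25); (3, 59992438, 25);
  (5, 67073544, 25); (5, 37495227, 26); (3, 41920925, 26); (3, 46868984, 26);
  (3, 52401092, 26); (3, 58586189, 26); (3, 65501345, 26); (7, 73232730, 26);
  (5, 81876672, 26); (3, 91540877, 26); (3, 102345806, 26); (3, 114426089, 26);
  (7, 127932240, 26); (3, 71516296, 27); (5, 79957647, 27); (3, 89395360, 27);
  (3, 99947035, 27); (3, 111744175, 27); (5, 124933782, 27); (3, 139680211, 27);
  (3, 156167167, 27); (3, 174600148, 27); (7, 195208890, 27); (5, 218250156, 27);
  (5, 244011087, 27); (3, 136406333, 28); (11, 152506914, 28); (3, 170507900, 28);
  (5, 190633626, 28); (11, 213134844, 28); (5, 238291983, 28); (5, 266418516, 28);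
  (11, 297864909, 28); (5, 333023091, 28); (11, 372331134, 28); (3, 416278853, 28);
  (3, 465413900, 28); (3, 520348535, 28); (3, 290883652, 29); (13, 325217805, 29);
  (17, 363604557, 29); (3, 406522222, 29); (3, 454505632, 29); (3, 508152733, 29);
  (3, 568131988, 29); (3, 635190853, 29); (11, 710164962, 29); (3, 793988554, 29);
  (3, 887706187, 29); (13, 992485662, 29); (3, 554816336, 30)]%num.

(* From 114 to 2 ^ 60, each member less than sqrt (5 / 4) times the preceding one. *)
Definition prime_chain : seq N := small_primes ++ map proth_value proth_certificates.

Lemma small_primes_ok : all trial_ok small_primes.
Proof. by vm_compute. Qed.

Lemma proth_certificates_ok : all proth_ok proth_certificates.
Proof. by vm_compute. Qed.

Lemma prime_chain_ok : path ratio_ok 114%num prime_chain.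
Proof. by vm_compute. Qed.

Lemma prime_chain_last : N.leb (N.pow 2 60) (last 114%num prime_chain).
Proof. by vm_compute. Qed.

Lemma prime_above_chain (b : N) x : N.leb (N.pow 2 60) b -> N.to_nat b <= x ->
  exists2 p, prime p & (x < p) && (4 * p ^ 2 <= 5 * x ^ 2).
Proof.
(* The power is abstracted so that 2^60 is never expanded as a unary number. *)
have := to_nat_pow2 60; rewrite -[N.to_nat 60]/60; move: (N.pow 2 60) => c Ec /N.leb_spec0 cb bx.
have [|p pr /andP[xp px]] := prime_in_short_interval_large Rdefinitions.R x.
  rewrite -natrX ler_nat -Ec; clear -cb bx; lia.
exists p => //; rewrite xp /=.
(* 19/17 is just small enough: 4 * 19^2 = 1444 and 5 * 17^2 = 1445. *)
have h : 17 * p <= 19 * x by clear -px; lia.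
have : (17 * p) ^ 2 <= (19 * x) ^ 2 by rewrite leq_sqr.
by rewrite !expnMn; clear; lia.
Qed.

(** The bound 114 is sharp: the prime after 113 is 127, and 4 * 127^2 exceeds 5 * 113^2 but not 5 *
    114^2. *)
Lemma prime_in_short_interval x : 114 <= x ->
  exists2 p, prime p & (x < p) && (4 * p ^ 2 <= 5 * x ^ 2).
Proof.
move=> x_ge; have chain_pr := certified_primes _ _ small_primes_ok proth_certificates_ok.
have := prime_in_chain _ _ x chain_pr prime_chain_ok.
move: prime_chain_last; move: (last _ _) => b b_large chain_x.
have [xb|bx] := ltnP x (N.to_nat b); first by apply: chain_x; rewrite x_ge.
exact: prime_above_chain b_large bx.
Qed.

(** * The corollary *)

Definition represented (n : nat) : Prop :=
  exists x y z w p : nat,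
    [/\ prime p, n = x ^ 2 + y ^ 2 + z ^ 2 + 2 * w ^ 2 & x + 2 * y = p].

(* If x + 2y = p and 2x - y = t then 5 (x^2 + y^2) = p^2 + t^2; the bound
   4n <= p^2 forces 2|t| <= p, so that both x and y come out nonnegative. *)
Lemma represented_of_prime n p : prime p -> p != 5 -> 4 * n <= p ^ 2 <= 5 * n ->
  represented n.
Proof.
move=> pr p5 /andP[lo hi].
have pm : (p %% 5 != 0).
  by apply: contra p5 => h; rewrite eq_sym -(dvdn_prime2 (isT : prime 5) pr).
pose N := 5 * n - p ^ 2.
have EN : N + p ^ 2 = 5 * n by rewrite subnK.
have p2 : (p ^ 2 %% 5 = 1 \/ p ^ 2 %% 5 = 4).
  rewrite -modnXm; move: pm (ltn_pmod p (isT : 0 < 5)).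
  by case: (p %% 5) => [|[|[|[|[|]]]]] // _ _; auto.
have N5 : N %% 5 = 1 \/ N %% 5 = 4 by clear -EN p2; lia.
have [s [z [w E]]] := ternary_represented (Rdefinitions.R : realType) N N5.
(* 4s^2 <= 4N = 20n - 4p^2, and 20n <= 5p^2. *)
have sp : 4 * s ^ 2 <= p ^ 2 by clear -E EN lo; lia.
have {}sp : 2 * s <= p by rewrite -leq_sqr expnMn.
have s5 : (s ^ 2 + p ^ 2) %% 5 = 0 by clear -E EN; lia.
(* From s^2 = -p^2 = (2p)^2 modulo 5, s is 2p or -2p. The term p + 3s stands for p - 2s and avoids
   truncated subtraction. *)
have [d|d] : (p + 2 * s) %% 5 = 0 \/ (p + 3 * s) %% 5 = 0.
  move: s5; rewrite -modnDm -(modnXm _ _ s) -(modnXm _ _ p) -!(modnDm p) -!(modnMmr _ s).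
  move: pm (ltn_pmod p (isT : 0 < 5)) (ltn_pmod s (isT : 0 < 5)).
  by case: (p %% 5) => [|[|[|[|[|]]]]] //; case: (s %% 5) => [|[|[|[|[|]]]]] // _ _ _ h;
     (left; reflexivity) || (right; reflexivity) || discriminate h.
- exists ((p + 2 * s) %/ 5), ((2 * p - s) %/ 5), z, w, p; split=> //; last by clear -d sp; lia.
  have [x Ex] : exists x, p + 2 * s = 5 * x by exists ((p + 2 * s) %/ 5); clear -d; lia.
  have [y Ey] : exists y, 2 * p = 5 * y + s.
    by exists ((2 * p - s) %/ 5); clear -d sp; lia.
  have -> : (p + 2 * s) %/ 5 = x by clear -Ex; lia.
  have -> : (2 * p - s) %/ 5 = y by clear -Ey; lia.
  have Ep : p = x + 2 * y by clear -Ex Ey; lia.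
  have Es : s + y = 2 * x by clear -Ex Ey; lia.
  by clear -E EN Ep Es; nia.
exists ((p - 2 * s) %/ 5), ((2 * p + s) %/ 5), z, w, p; split=> //; last by clear -d sp; lia.
have [x Ex] : exists x, p = 5 * x + 2 * s by exists ((p - 2 * s) %/ 5); clear -d sp; lia.
have [y Ey] : exists y, 2 * p + s = 5 * y.
  by exists ((2 * p + s) %/ 5); clear -d sp; lia.
have -> : (p - 2 * s) %/ 5 = x by clear -Ex; lia.
have -> : (2 * p + s) %/ 5 = y by clear -Ey; lia.
have Ep : p = x + 2 * y by clear -Ex Ey; lia.
have Es : s + 2 * x = y by clear -Ex Ey; lia.
by clear -E EN Ep Es; nia.
Qed.

(* An item [:: p] accounts for the n with p^2/5 <= n <= p^2/4, an item
   [:: x; y; z; w] for the single number it represents. *)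
Fixpoint covered_up_to (n : nat) (l : seq (seq nat)) : nat :=
  match l with
  | [:: p] :: l' =>
      if [&& prime p, p != 5 & p ^ 2 <= 5 * n] then covered_up_to (p ^ 2 %/ 4).+1 l' else n
  | [:: x; y; z; w] :: l' =>
      if prime (x + 2 * y) && (n == x ^ 2 + y ^ 2 + z ^ 2 + 2 * w ^ 2)
      then covered_up_to n.+1 l' else n
  | _ => n
  end.

Lemma covered_represented n l m : n <= m < covered_up_to n l -> represented m.
Proof.
elim: l n => [|it l IHl] n /=; first by lia.
case: it => [|a [|b [|c [|d [|e it]]]]]; try by lia.
  case: ifP => [/and3P[pr p5 le]|_]; last by lia.
  move=> /andP[nm mc]; have [h|h] := leqP (4 * m) (a ^ 2).
    by apply: (represented_of_prime _ a) => //; rewrite h (leq_trans le) // leq_mul2l nm orbT.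
  by apply: (IHl (a ^ 2 %/ 4).+1); rewrite mc andbT; clear -h; lia.
case: ifP => [/andP[pr /eqP En]|_]; last by lia.
move=> /andP[nm mc]; have [nm'|mn] := ltnP n m; first by apply: (IHl n.+1); rewrite nm'.
have -> : m = n by clear -nm mn; lia.
by exists a, b, c, d, (a + 2 * b).
Qed.

(** The quadruples bridge the gaps between consecutive intervals [p^2/5, p^2/4]; the last gap lies
    between the intervals of 113 and 127. *)
Definition small_cover : seq (seq nat) :=
[::
  [:: 2]; [:: 3]; [:: 1; 1; 1; 0]; [:: 2; 0; 0; 0]; [:: 1; 2; 0; 0]; [:: 1; 2; 1; 0];
  [:: 1; 2; 0; 1]; [:: 2; 0; 2; 0]; [:: 3; 0; 0; 0]; [:: 7]; [:: 3; 2; 0; 0];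
  [:: 3; 2; 1; 0]; [:: 3; 2; 0; 1]; [:: 3; 2; 1; 1]; [:: 3; 2; 2; 0];
  [:: 3; 0; 3; 0]; [:: 3; 1; 3; 0]; [:: 2; 0; 4; 0]; [:: 1; 2; 4; 0];
  [:: 3; 2; 3; 0]; [:: 1; 2; 4; 1]; [:: 3; 2; 3; 1]; [:: 11]; [:: 5; 0; 2; 1];
  [:: 5; 1; 2; 1]; [:: 5; 0; 0; 2]; [:: 13]; [:: 5; 3; 3; 0]; [:: 5; 4; 1; 1];
  [:: 5; 4; 2; 0]; [:: 1; 6; 3; 0]; [:: 5; 4; 2; 1]; [:: 1; 6; 3; 1];
  [:: 7; 0; 0; 0]; [:: 7; 0; 1; 0]; [:: 5; 1; 5; 0]; [:: 7; 0; 1; 1];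
  [:: 7; 2; 0; 0]; [:: 7; 2; 1; 0]; [:: 7; 2; 0; 1]; [:: 7; 2; 1; 1];
  [:: 7; 2; 2; 0]; [:: 17]; [:: 19]; [:: 9; 1; 3; 0]; [:: 7; 5; 4; 1];
  [:: 9; 1; 3; 1]; [:: 9; 2; 3; 0]; [:: 3; 8; 2; 3]; [:: 9; 2; 3; 1];
  [:: 9; 4; 0; 0]; [:: 9; 4; 1; 0]; [:: 7; 5; 5; 0]; [:: 9; 4; 1; 1];
  [:: 9; 4; 2; 0]; [:: 7; 2; 7; 0]; [:: 9; 4; 2; 1]; [:: 2; 0; 10; 0];
  [:: 5; 4; 8; 0]; [:: 23]; [:: 9; 4; 6; 0]; [:: 11; 3; 2; 0]; [:: 9; 4; 6; 1];
  [:: 11; 3; 2; 1]; [:: 11; 4; 0; 0]; [:: 11; 4; 1; 0]; [:: 11; 3; 3; 0];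
  [:: 11; 4; 1; 1]; [:: 11; 4; 2; 0]; [:: 9; 5; 6; 0]; [:: 11; 4; 2; 1];
  [:: 9; 5; 6; 1]; [:: 3; 10; 6; 0]; [:: 11; 4; 3; 0]; [:: 11; 1; 5; 0];
  [:: 2; 0; 12; 0]; [:: 7; 8; 6; 0]; [:: 2; 0; 12; 1]; [:: 7; 8; 6; 1];
  [:: 11; 3; 2; 3]; [:: 11; 4; 4; 0]; [:: 3; 8; 9; 0]; [:: 11; 3; 5; 0];
  [:: 3; 8; 9; 1]; [:: 11; 6; 0; 0]; [:: 11; 6; 1; 0]; [:: 11; 6; 0; 1];
  [:: 11; 6; 1; 1]; [:: 11; 6; 2; 0]; [:: 11; 4; 5; 0]; [:: 9; 1; 9; 0];
  [:: 11; 4; 5; 1]; [:: 1; 8; 10; 0]; [:: 11; 6; 3; 0]; [:: 1; 8; 10; 1];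
  [:: 11; 6; 3; 1]; [:: 29]; [:: 31]; [:: 15; 4; 0; 0]; [:: 15; 4; 1; 0];
  [:: 13; 5; 7; 0]; [:: 15; 4; 1; 1]; [:: 15; 4; 2; 0]; [:: 11; 10; 5; 0];
  [:: 15; 4; 2; 1]; [:: 11; 10; 5; 1]; [:: 13; 8; 4; 0]; [:: 13; 9; 0; 0];
  [:: 13; 9; 1; 0]; [:: 13; 9; 0; 1]; [:: 3; 10; 12; 0]; [:: 13; 9; 2; 0];
  [:: 3; 10; 12; 1]; [:: 13; 9; 2; 1]; [:: 15; 4; 4; 0]; [:: 13; 8; 5; 0];
  [:: 13; 9; 3; 0]; [:: 2; 0; 16; 0]; [:: 1; 14; 8; 0]; [:: 15; 1; 6; 0];
  [:: 1; 14; 8; 1]; [:: 15; 1; 6; 1]; [:: 15; 2; 6; 0]; [:: 13; 9; 4; 0];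
  [:: 15; 2; 6; 1]; [:: 13; 9; 4; 1]; [:: 13; 8; 6; 0]; [:: 11; 10; 7; 0];
  [:: 13; 8; 6; 1]; [:: 11; 10; 7; 1]; [:: 13; 2; 10; 0]; [:: 37]; [:: 41]; [:: 43];
  [:: 47]; [:: 3; 20; 12; 0]; [:: 23; 4; 3; 0]; [:: 1; 23; 5; 0]; [:: 23; 4; 3; 1];
  [:: 19; 14; 0; 0]; [:: 19; 14; 1; 0]; [:: 19; 14; 0; 1]; [:: 19; 14; 1; 1];
  [:: 19; 14; 2; 0]; [:: 53]; [:: 59]; [:: 61]; [:: 67]; [:: 73]; [:: 79]; [:: 83];
  [:: 89]; [:: 97]; [:: 107]; [:: 113]; [:: 45; 32; 12; 0]; [:: 55; 12; 5; 0];
  [:: 47; 31; 5; 0]; [:: 55; 12; 5; 1]; [:: 45; 34; 4; 0]; [:: 49; 26; 11; 0];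
  [:: 45; 34; 4; 1]; [:: 49; 26; 11; 1]; [:: 1; 56; 8; 0]; [:: 49; 24; 15; 0];
  [:: 55; 3; 13; 0]; [:: 49; 24; 15; 1]; [:: 55; 12; 6; 0]; [:: 45; 34; 5; 0];
  [:: 55; 12; 6; 1]; [:: 45; 34; 5; 1]; [:: 47; 30; 10; 0]; [:: 55; 8; 11; 0];
  [:: 51; 23; 9; 0]; [:: 55; 8; 11; 1]; [:: 37; 38; 20; 0]; [:: 53; 18; 9; 0];
  [:: 37; 38; 20; 1]; [:: 53; 18; 9; 1]; [:: 45; 34; 6; 0]; [:: 55; 12; 7; 0];
  [:: 47; 31; 7; 0]; [:: 55; 12; 7; 1]; [:: 55; 14; 0; 0]; [:: 55; 14; 1; 0];
  [:: 55; 14; 0; 1]; [:: 55; 14; 1; 1]; [:: 55; 14; 2; 0]; [:: 127]].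

Lemma small_represented n : 0 < n -> n < 3249 -> represented n.
Proof.
move=> n0 n_lt; apply: (@covered_represented 1 small_cover).
have cov : 3249 <= covered_up_to 1 small_cover by vm_compute.
by rewrite n0 (leq_trans n_lt cov).
Qed.

Theorem corollary2 (n : nat) (hn : 0 < n) :
  exists x y z w p : nat,
    [/\ prime p, n = x ^ 2 + y ^ 2 + z ^ 2 + 2 * w ^ 2 & x + 2 * y = p].
Proof.
have [n_small|n_large] := ltnP n 3249; first exact: small_represented.
have [s /andP[s_le s_gt]] := nat_sqrt (4 * n).
(* 3249 = 57^2, so 4n >= 114^2. *)
have s_ge : 114 <= s.
  rewrite leqNgt; apply/negP => s_lt.
  have : s.+1 ^ 2 <= 114 ^ 2 by rewrite leq_sqr.
  by clear -s_gt n_large; lia.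
have [p pr /andP[sp ps]] := prime_in_short_interval s s_ge.
apply: (represented_of_prime n p) => //; first by apply/eqP; clear -sp s_ge; lia.
(* p > s gives p^2 > 4n, and 4p^2 <= 5s^2 <= 20n gives p^2 <= 5n. *)
have : s.+1 ^ 2 <= p ^ 2 by rewrite leq_sqr.
by clear -s_le s_gt ps; lia.
Qed.
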